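(* $d(4) = 2$ and $c(4) \le \omega$.
   Context: A tournament is an orientation of a complete graph. For a fixed tournament $T$, $T$-DETECT asks whether an input $n$-vertex tournament $G$ contains a copy of $T$; $T$-COUNT asks for the number of copies of $T$ in $G$. $d(T)$ (resp. $c(T)$) is the infimum over all reals $t$ such that $T$-DETECT (resp. $T$-COUNT) can be solved in $O(n^t)$ time, and $d(k)$ (resp. $c(k)$) is the maximum of $d(T)$ (resp. $c(T)$) over all tournaments $T$ on $k$ vertices. $\omega$ denotes the matrix multiplication exponent, i.e. the infimum over all reals $t$ such that two $n \times n$ matrices can be multiplied using $O(n^t)$ field operations. *)

(* Defs.v *)
From mathcomp Require Import all_boot all_order all_algebra.
From mathcomp Require Import all_classical all_reals all_analysis.

Set Implicit Arguments.
Unset Strict Implicit.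
Unset Printing Implicit Defensive.

Import Order.TTheory GRing.Theory Num.Theory numFieldNormedType.Exports.

Local Open Scope ring_scope.

(* A digraph on the vertices 0, ..., n-1, given by its set of arcs. *)
Definition digraph (n : nat) := {set 'I_n * 'I_n}.

Definition tournament n (G : digraph n) : bool :=
  [forall x, (x, x) \notin G] &&
  [forall x, forall y, (x != y) ==> (((x, y) \in G) (+) ((y, x) \in G))].

Definition embedding k n (T : digraph k) (G : digraph n)
    (f : {ffun 'I_k -> 'I_n}) : bool :=
  injectiveb f && [forall x, forall y, ((x, y) \in T) ==> ((f x, f y) \in G)].

(* In a tournament, a subgraph isomorphic to the tournament T is determined by
   its vertex set, so copies are counted as vertex sets. *)
Definition copies k n (T : digraph k) (G : digraph n) : {set {set 'I_n}} :=
  [set f @: [set: 'I_k] | f : {ffun 'I_k -> 'I_n} & embedding T G f].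

Definition count_copies k (T : digraph k) n (G : digraph n) : nat :=
  #|copies T G|.

Definition has_copy k (T : digraph k) n (G : digraph n) : bool :=
  copies T G != finset.set0.

Variant binop := OpAdd | OpSub | OpMul | OpDiv.

Definition binop_eval (o : binop) (a b : int) : int :=
  match o with
  | OpAdd => a + b
  | OpSub => a - b
  | OpMul => a * b
  | OpDiv => (a %/ b)%Z
  end.

Variant instr :=
  | Const (d : nat) (c : int)           (* r_d := c *)
  | Arith (o : binop) (d a b : nat)     (* r_d := r_a o r_b *)
  | Read (d a : nat)                    (* r_d := memory[r_a] *)
  | Write (a s : nat)                   (* memory[r_a] := r_s *)
  | JumpLe (a b : nat) (l : nat)        (* if r_a <= r_b then goto l *)
  | Halt.

Definition program := seq instr.

Record state := State {
  pc : option nat;                      (* [None] once halted *)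
  reg : nat -> int;
  memory : int -> int
}.

Definition upd (K : eqType) (f : K -> int) (k : K) (v : int) : K -> int :=
  fun x => if x == k then v else f x.

(* Running past the end of the program halts. *)
Definition step (p : program) (s : state) : state :=
  let: State c r m := s in
  if c is Some l then
    match nth Halt p l with
    | Const d v => State (Some l.+1) (upd r d v) m
    | Arith o d a b => State (Some l.+1) (upd r d (binop_eval o (r a) (r b))) m
    | Read d a => State (Some l.+1) (upd r d (m (r a))) m
    | Write a b => State (Some l.+1) r (upd m (r a) (r b))
    | JumpLe a b l' => State (Some (if r a <= r b then l' else l.+1)) r m
    | Halt => State None r m
    end
  else s.

Definition steps (p : program) (i : nat) (s : state) : state := iter i (step p) s.

(* The input: n in register 0, and the n x n adjacency matrix of G in row-major
   order, one entry per cell, from address 0 on.  All the rest is 0. *)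
Definition init n (G : digraph n) : state :=
  State (Some 0%N)
    (fun r => if r == 0%N then n%:Z else 0)
    (fun z => [exists a in G, z == (a.1 * n + a.2)%N%:Z] : nat).

(* Words have O(log n) bits: every integer that the machine ever holds on an
   n-vertex input is at most (n + 2)^c in absolute value.  Without such a bound,
   unit-cost arithmetic would be unrealistically powerful. *)
Definition word_sized (p : program) (c n : nat) (G : digraph n) : Prop :=
  forall i, (forall r, (`|reg (steps p i (init G)) r| <= (n + 2) ^ c)%N) /\
            (forall z, (`|memory (steps p i (init G)) z| <= (n + 2) ^ c)%N).

(* On G, the program halts within the given number of steps, with the given
   answer in register 0. *)
Definition outputs_within (p : program) (time : nat) n (G : digraph n)
    (answer : nat) : Prop :=
  let s := steps p time (init G) in pc s = None /\ reg s 0%N = answer%:Z.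

Local Open Scope classical_set_scope.

Definition bigO_power (R : realType) (m : nat -> nat) (t : R) : Prop :=
  (fun n => (m n)%:R : R) =O_\oo (fun n => n%:R `^ t : R).

(* The problem mapping each tournament G to f G is solvable in O(n^t) time. *)
Definition solvable_in (R : realType) (f : forall n, digraph n -> nat) (t : R) :
    Prop :=
  exists (p : program) (c : nat) (time : nat -> nat),
    bigO_power time t /\
    forall n (G : digraph n), tournament G ->
      word_sized p c G /\ outputs_within p (time n) G (f n G).

Local Open Scope ereal_scope.

(* The infima below are taken in the extended reals, so that no default value
   is involved for an empty or unbounded set of exponents. *)
Definition detect_exponent (R : realType) k (T : digraph k) : \bar R :=
  ereal_inf [set t%:E | t in [set t : R | solvable_in (@has_copy k T) t]].

Definition count_exponent (R : realType) k (T : digraph k) : \bar R :=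
  ereal_inf [set t%:E | t in [set t : R | solvable_in (@count_copies k T) t]].

Definition max_detect_exponent (R : realType) (k : nat) : \bar R :=
  \big[maxe/-oo]_(T : digraph k | tournament T) detect_exponent R T.

Definition max_count_exponent (R : realType) (k : nat) : \bar R :=
  \big[maxe/-oo]_(T : digraph k | tournament T) count_exponent R T.

Local Close Scope ereal_scope.
Local Close Scope classical_set_scope.

(* Straight-line programs over a field F whose inputs are the entries of two
   n x n matrices A and B.  [Res k] is the result of the k-th operation. *)
Variant operand (F : fieldType) (n : nat) :=
  | Cst of F
  | EntA of 'I_n & 'I_n
  | EntB of 'I_n & 'I_n
  | Res of nat.

Definition slp (F : fieldType) (n : nat) :=
  seq (binop * operand F n * operand F n).

Definition operand_eval (F : fieldType) n (A B : 'M[F]_n) (vs : seq F)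
    (x : operand F n) : F :=
  match x with
  | Cst a => a
  | EntA i j => A i j
  | EntB i j => B i j
  | Res k => nth 0 vs k
  end.

Definition field_op (F : fieldType) (o : binop) (a b : F) : option F :=
  match o with
  | OpAdd => Some (a + b)
  | OpSub => Some (a - b)
  | OpMul => Some (a * b)
  | OpDiv => if b == 0 then None else Some (a / b)
  end.

(* The results of all operations, following the earlier results [vs]; [None] if
   there is a division by zero. *)
Fixpoint slp_eval (F : fieldType) n (A B : 'M[F]_n) (vs : seq F) (p : slp F n) :
    option (seq F) :=
  if p is (o, x, y) :: p' then
    if field_op o (operand_eval A B vs x) (operand_eval A B vs y) is Some v
    then slp_eval A B (rcons vs v) p' else None
  else Some vs.

Definition multiplies (F : fieldType) n (p : slp F n)
    (out : 'I_n -> 'I_n -> operand F n) : Prop :=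
  forall A B : 'M[F]_n, exists2 vs, slp_eval A B [::] p = Some vs &
    forall i j, operand_eval A B vs (out i j) = (A *m B) i j.

(* n x n matrices over F can be multiplied using O(n^t) field operations. *)
Definition matmul_in (R : realType) (F : fieldType) (t : R) : Prop :=
  exists m : nat -> nat, bigO_power m t /\
    forall n, exists (p : slp F n) (out : 'I_n -> 'I_n -> operand F n),
      (size p <= m n)%N /\ multiplies p out.

(* The exponent depends only on the characteristic of the field; the usual
   choice is characteristic 0. *)
Definition omega (R : realType) : \bar R :=
  ereal_inf [set t%:E | t in [set t : R | matmul_in rat t]]%classic.

(* Main.v *)
Require Import Defs.
From mathcomp Require Import all_boot all_order all_algebra.
From mathcomp Require Import all_classical all_reals all_analysis.
From mathcomp Require Import zify ring lra.

(* A tournament on four vertices is determined up to isomorphism by whether it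
   has a source and whether it has a sink, which leaves four types.

   Detection in time O(n^2).  The transitive type occurs in every tournament with
   at least 8 vertices.  A tournament has no strong subtournament on four vertices
   if and only if it has exactly as many 3-cycles (that is, C(n,3) minus the sum of
   the C(d,2) over the scores d) as scores attained three times.  For a vertex
   dominating a 3-cycle, discard the transitive tail made of the scores below the
   least missing one; the type is absent if and only if the out-neighbourhood of
   every remaining vertex v has a source s(v) and s permutes these vertices
   cyclically.  The fourth type follows by reversing all arcs.  Conversely, in a
   transitive tournament the reversal of any of a quadratic number of arcs creates
   a vertex dominating a 3-cycle, so a correct program must read all these arcs.

   Counting.  The numbers of copies of the four types are linear combinations of
   C(n,4), the sums of C(d,3) over the out- and in-degrees d, and the trace of the
   fourth power of the adjacency matrix.  To square this matrix with small
   integers, a straight-line program multiplying q x q matrices is expanded along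
   (s A, s B) to second order in s (Strassen), which gives an integer bilinear
   identity of rank r = O(q^t), up to a common denominator D.  Its L-th tensor
   power multiplies matrices of order q^L, and its three linear maps are applied
   one tensor factor at a time (Yates) in time O(L r^L) = O((2r)^L). *)

Set Implicit Arguments.
Unset Strict Implicit.
Unset Printing Implicit Defensive.

Import Order.TTheory GRing.Theory Num.Theory.
Local Open Scope ring_scope.

(** * A structured language for the RAM *)

(** The machine model shapes the work: a solution is a jump program all of whose words must stay
    polynomially bounded at every moment. Programs are therefore written in a small loop language
    compiled to the machine, and one triple states result, running time and word size together. The
    maximum defining d(4) needs a quadratic lower bound for one tournament only; the transitive type
    could not serve, as it is decided in bounded time. The hypothesis on matrix multiplication is
    non-uniform (an unrelated straight-line program for each order), works over the rationals and
    admits divisions, so it cannot be run on the machine as it stands. Only a single order q is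
    used: its identity is a finite table of integers hard-wired in the program, and all growth in n
    comes from the tensor power L, about log_q n. This is why constants are harmless: the extra
    factor 2^L of the time is absorbed by choosing q large, as 2r <= q^t' can be reached for any t'
    > t, and D^L or the L-th powers of the coefficients stay polynomial in n. *)

Inductive expr :=
  | Var of nat
  | Cst of int
  | Bin of binop & expr & expr
  | Arr of nat & expr
  | Inp of expr.

Inductive cmd :=
  | Skip
  | Set_ of nat & expr
  | Store of nat & expr & expr
  | Seq of cmd & cmd
  | IfLe of expr & expr & cmd & cmd
  | For of nat & expr & cmd.

Record store := Mk_store { var : nat -> int; arr : nat -> nat -> int }.

Definition setv s x v := Mk_store (fun y => if y == x then v else var s y) (arr s).
Definition seta s t i v :=
  Mk_store (var s) (fun t' i' => if (t' == t) && (i' == i) then v else arr s t' i').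

(** The registers are split modulo 3 into program variables, temporaries of expressions and loop
    counters. Variable 0 is register 0, where the machine expects both the input size and the
    answer. *)
Definition vreg x := (3 * x)%N.
Definition treg d := (3 * d + 1)%N.
Definition lreg d := (3 * d + 2)%N.

(* The input occupies the nonnegative addresses, so the arrays are interleaved
   in the negative ones. *)
Definition address (t i : nat) : int := - (i * 16 + t + 1)%N%:Z.

(** Expression code has no jumps, so this length is also its running time. *)
Fixpoint esize e : nat :=
  match e with
  | Var _ => 2
  | Cst _ => 1
  | Bin _ e1 e2 => esize e1 + esize e2 + 1
  | Arr _ e => esize e + 5
  | Inp e => esize e + 1
  end.

Definition caddr d t : seq instr :=
  [:: Const (treg d.+1) (- 16%:Z); Arith OpMul (treg d) (treg d) (treg d.+1);
      Const (treg d.+1) (- (t + 1)%N%:Z);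
      Arith OpAdd (treg d) (treg d) (treg d.+1)].

(** Intermediate results form a stack of temporaries: the code at depth [d] leaves its value in
    [treg d] and overwrites no temporary below it. Adding 0 serves as a move instruction. *)
Fixpoint cexpr d e : seq instr :=
  match e with
  | Var x => [:: Const (treg d) 0; Arith OpAdd (treg d) (vreg x) (treg d)]
  | Cst z => [:: Const (treg d) z]
  | Bin o e1 e2 =>
      cexpr d e1 ++ cexpr d.+1 e2 ++ [:: Arith o (treg d) (treg d) (treg d.+1)]
  | Arr t e => cexpr d e ++ caddr d t ++ [:: Read (treg d) (treg d)]
  | Inp e => cexpr d e ++ [:: Read (treg d) (treg d)]
  end.

Fixpoint csize c : nat :=
  match c with
  | Skip => 0
  | Set_ x e => esize e + 2
  | Store t e1 e2 => esize e1 + 4 + esize e2 + 1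
  | Seq c1 c2 => csize c1 + csize c2
  | IfLe e1 e2 c1 c2 => esize e1 + esize e2 + 1 + csize c2 + 1 + csize c1
  | For x e c => esize e + 3 + 3 + csize c + 3
  end.

(** Jump targets are absolute, hence the start address [l]; the nesting depth [d] gives nested loops
    separate registers for counter and bound. The counter is copied to [x] at each round, so the
    body may overwrite [x]. [JumpLe 0 0] always jumps. *)
Fixpoint compile d l c : seq instr :=
  match c with
  | Skip => [::]
  | Set_ x e =>
      cexpr 0 e ++ [:: Const (treg 1) 0; Arith OpAdd (vreg x) (treg 0) (treg 1)]
  | Store t e1 e2 =>
      cexpr 0 e1 ++ caddr 0 t ++ cexpr 1 e2 ++ [:: Write (treg 0) (treg 1)]
  | Seq c1 c2 => compile d l c1 ++ compile d (l + csize c1) c2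
  | IfLe e1 e2 c1 c2 =>
      let l2 := (l + esize e1 + esize e2 + 1)%N in
      let l1 := (l2 + csize c2 + 1)%N in
      cexpr 0 e1 ++ cexpr 1 e2 ++ [:: JumpLe (treg 0) (treg 1) l1] ++
      compile d l2 c2 ++ [:: JumpLe 0 0 (l1 + csize c1)] ++ compile d l1 c1
  | For x e c =>
      let lh := (l + esize e + 3)%N in
      cexpr 0 e ++
      [:: Const (treg 1) 0; Arith OpAdd (lreg (2 * d + 1)) (treg 0) (treg 1);
          Const (lreg (2 * d)) 0] ++
      [:: JumpLe (lreg (2 * d + 1)) (lreg (2 * d)) (lh + 3 + csize c + 3);
          Const (treg 0) 0; Arith OpAdd (vreg x) (lreg (2 * d)) (treg 0)] ++
      compile d.+1 (lh + 3) c ++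
      [:: Const (treg 0) 1; Arith OpAdd (lreg (2 * d)) (lreg (2 * d)) (treg 0);
          JumpLe 0 0 lh]
  end.

Fixpoint modv c y : bool :=
  match c with
  | Skip | Store _ _ _ => false
  | Set_ x _ => y == x
  | Seq c1 c2 | IfLe _ _ c1 c2 => modv c1 y || modv c2 y
  | For x _ c => (y == x) || modv c y
  end.

Fixpoint moda c t : bool :=
  match c with
  | Skip | Set_ _ _ => false
  | Store t' _ _ => t == t'
  | Seq c1 c2 | IfLe _ _ c1 c2 => moda c1 t || moda c2 t
  | For _ _ c => moda c t
  end.

(** The modified variables and arrays are computed syntactically, so that frame conditions about
    concrete commands reduce to [isT]. *)
Definition keeps c s s' :=
  (forall y, ~~ modv c y -> var s' y = var s y) /\
  (forall t i, ~~ moda c t -> arr s' t i = arr s t i).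

Lemma size_cexpr d e : size (cexpr d e) = esize e.
Proof.
by elim: e d => //= [op e1 IH1 e2 IH2|t e IH|e IH] d;
  rewrite !size_cat ?IH1 ?IH2 ?IH //= addnA.
Qed.

Lemma size_compile d l c : size (compile d l c) = csize c.
Proof.
elim: c d l => //= [x e|t e1 e2|c1 IH1 c2 IH2|e1 e2 c1 IH1 c2 IH2|x e c IH] d l;
  rewrite ?(size_cat, size_cexpr) /= ?(size_cat, size_cexpr) /= ?size_cat /=.
- by [].  
- lia.
- by rewrite IH1 IH2.
- by rewrite IH1 IH2; lia.
- by rewrite IH; lia.
Qed.

Lemma size_caddr d t : size (caddr d t) = 4%N.
Proof. by []. Qed.

Lemma addressE t i : address t i = i%:Z * - 16%:Z + - (t + 1)%N%:Z.
Proof. by rewrite /address; lia. Qed.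

Lemma address_inj t i t' i' : (t < 16)%N -> (t' < 16)%N ->
  address t i = address t' i' -> t = t' /\ i = i'.
Proof. by rewrite /address; lia. Qed.

(** * Total correctness of the compiled code, with time and word bounds *)

Definition code_at (p : program) l c :=
  forall i, (i < size c)%N -> nth Halt p (l + i) = nth Halt c i.

Lemma code_at_cat p l c1 c2 :
  code_at p l (c1 ++ c2) -> code_at p l c1 /\ code_at p (l + size c1) c2.
Proof.
move=> H; split=> i Hi; first by rewrite H ?size_cat ?nth_cat ?Hi //; lia.
rewrite -addnA H ?size_cat ?nth_cat; last by lia.
by rewrite ltnNge leq_addr /= addKn.
Qed.

Lemma code_at_cons p l x c :
  code_at p l (x :: c) -> nth Halt p l = x /\ code_at p l.+1 c.
Proof.
move=> H; split=> [|i Hi]; first by have := H 0 isT; rewrite addn0.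
by rewrite addSnnS; apply: (H i.+1).
Qed.

Section Bounded.

Variables (B : nat) (inp : int -> int).
Definition small (z : int) := (absz z <= B)%N.

Definition bounded (st : state) :=
  (forall x, small (reg st x)) /\ (forall z, small (memory st z)).

(** The exact number of steps stays existential, so that time bounds can be rounded up. Every
    intermediate state is bounded because [word_sized] speaks of all moments. *)
Definition runs p T st st' := exists t,
  [/\ (t <= T)%N, steps p t st = st' & forall i, (i <= t)%N -> bounded (steps p i st)].

Lemma runs0 p st : bounded st -> runs p 0 st st.
Proof. by exists 0; split=> // i; rewrite leqn0 => /eqP->. Qed.

Lemma runs_bounded p T st st' : runs p T st st' -> bounded st'.
Proof. by case=> t [_ <-]; apply. Qed.

Lemma runs_le p T T' st st' : (T <= T')%N -> runs p T st st' -> runs p T' st st'.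
Proof. by move=> le [t [h1 h2 h3]]; exists t; split=> //; apply: leq_trans le. Qed.

Lemma runs_trans p T1 T2 st1 st2 st3 :
  runs p T1 st1 st2 -> runs p T2 st2 st3 -> runs p (T1 + T2) st1 st3.
Proof.
move=> [t1 [h1 e1 b1]] [t2 [h2 e2 b2]]; exists (t2 + t1)%N; split.
- by rewrite addnC leq_add.
- by rewrite /steps iterD -[iter t1 _ _]/(steps p t1 st1) e1.
- move=> i Hi; case: (leqP i t1) => Hit; first exact: b1.
  rewrite -(subnK (ltnW Hit)) /steps iterD -[iter t1 _ _]/(steps p t1 st1) e1.
  by apply: b2; lia.
Qed.

Lemma runs1 p st st' : step p st = st' -> bounded st -> bounded st' -> runs p 1 st st'.
Proof.
move=> <- b1 b2; exists 1%N; split=> // [[|[|]]] //.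
Qed.

Lemma runs_const p l r m d v : nth Halt p l = Const d v -> small v ->
  bounded (State (Some l) r m) ->
  runs p 1 (State (Some l) r m) (State (Some l.+1) (upd r d v) m).
Proof.
move=> H sv b; apply: runs1 => //; first by rewrite /= H.
by split=> x /=; [rewrite /upd; case: eqP => // _; exact: b.1 | exact: b.2].
Qed.

Lemma runs_arith p l r m o d a b : nth Halt p l = Arith o d a b ->
  small (binop_eval o (r a) (r b)) -> bounded (State (Some l) r m) ->
  runs p 1 (State (Some l) r m)
    (State (Some l.+1) (upd r d (binop_eval o (r a) (r b))) m).
Proof.
move=> H sv bb; apply: runs1 => //; first by rewrite /= H.
by split=> x /=; [rewrite /upd; case: eqP => // _; exact: bb.1 | exact: bb.2].
Qed.

Lemma runs_read p l r m d a : nth Halt p l = Read d a ->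
  bounded (State (Some l) r m) ->
  runs p 1 (State (Some l) r m) (State (Some l.+1) (upd r d (m (r a))) m).
Proof.
move=> H bb; apply: runs1 => //; first by rewrite /= H.
split=> x /=; last exact: bb.2.
by rewrite /upd; case: eqP => _; [exact: bb.2 | exact: bb.1].
Qed.

Lemma runs_write p l r m a b : nth Halt p l = Write a b ->
  bounded (State (Some l) r m) ->
  runs p 1 (State (Some l) r m) (State (Some l.+1) r (upd m (r a) (r b))).
Proof.
move=> H bb; apply: runs1 => //; first by rewrite /= H.
split=> x /=; first exact: bb.1.
by rewrite /upd; case: eqP => _; [exact: bb.1 | exact: bb.2].
Qed.

Lemma runs_jump p l r m a b l' : nth Halt p l = JumpLe a b l' ->
  bounded (State (Some l) r m) ->
  runs p 1 (State (Some l) r m) (State (Some (if r a <= r b then l' else l.+1)) r m).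
Proof. by move=> H bb; apply: runs1 => //; rewrite /= H. Qed.

Fixpoint ev e s : int :=
  match e with
  | Var x => var s x
  | Cst z => z
  | Bin o e1 e2 => binop_eval o (ev e1 s) (ev e2 s)
  | Arr t e => arr s t (absz (ev e s))
  | Inp e => inp (ev e s)
  end.

(** For an array access the machine computes -16 i and then -(16 i + t + 1), both at most 16 i + 16
    in absolute value as t < 16. An input address must be nonnegative because the negative ones hold
    the arrays. *)
Fixpoint eok e s : Prop :=
  match e with
  | Var x => True
  | Cst z => small z
  | Bin o e1 e2 =>
      [/\ eok e1 s, eok e2 s & small (binop_eval o (ev e1 s) (ev e2 s))]
  | Arr t e =>
      [/\ eok e s, (t < 16)%N, 0 <= ev e s & small (16%:Z * ev e s + 16%:Z)]
  | Inp e => eok e s /\ 0 <= ev e s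
  end.

Definition represents s (r : nat -> int) (m : int -> int) :=
  [/\ forall x, r (vreg x) = var s x,
      forall t i, (t < 16)%N -> m (address t i) = arr s t i &
      forall z, 0 <= z -> m z = inp z].

Definition same_below d (r r' : nat -> int) :=
  forall x, (forall d', (d <= d')%N -> x <> treg d') -> r' x = r x.

Lemma same_below_trans d d' r1 r2 r3 : (d <= d')%N ->
  same_below d r1 r2 -> same_below d' r2 r3 -> same_below d r1 r3.
Proof.
move=> le H1 H2 x Hx; rewrite H2 ?H1 // => d'' /(leq_trans le); exact: Hx.
Qed.

Lemma same_below_upd d d' r v : (d <= d')%N -> same_below d r (upd r (treg d') v).
Proof. by move=> le x Hx; rewrite /upd; case: eqP => // /(Hx _ le). Qed.

Lemma represents_below d s r r' m :
  represents s r m -> same_below d r r' -> represents s r' m.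
Proof.
by move=> [h1 h2 h3] H; split=> // x; rewrite H // => d' _; rewrite /vreg /treg; lia.
Qed.

Lemma runs_caddr p l r m d t (i : int) : (32 <= B)%N -> code_at p l (caddr d t) ->
  (t < 16)%N -> 0 <= i -> r (treg d) = i -> small (16%:Z * i + 16%:Z) ->
  bounded (State (Some l) r m) -> exists r',
  [/\ runs p 4 (State (Some l) r m) (State (Some (l + 4)%N) r' m),
      r' (treg d) = address t (absz i) & same_below d r r'].
Proof.
move=> B32 /code_at_cons[c1 /code_at_cons[c2 /code_at_cons[c3 /code_at_cons[c4 _]]]] Ht Hi ri Hs b.
have E1 : (treg d == treg d.+1) = false by rewrite /treg; lia.
have [s1 s2] : small (- 16%:Z) /\ small (- (t + 1)%N%:Z).
  by rewrite /small; lia.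
have R1 := runs_const c1 s1 b.
have R2 := runs_arith c2 _ (runs_bounded R1).
move: R2; rewrite /upd E1 eqxx ri /= => R2.
have {}R2 := R2 ltac:(by rewrite /small in Hs *; lia).
have R3 := runs_const c3 s2 (runs_bounded R2).
have R4 := runs_arith c4 _ (runs_bounded R3).
move: R4; rewrite /upd E1 !eqxx /= => R4.
have {}R4 := R4 ltac:(by rewrite /small in Hs *; lia).
eexists; split.
- by rewrite addn4; exact: runs_trans (runs_trans (runs_trans R1 R2) R3) R4.
- by rewrite /= eqxx addressE gez0_abs.
- do 4 (apply: same_below_trans (leqnn d) _ _; last apply: same_below_upd; try exact: leqnn; try exact: leqnSn).
  by [].
Qed.

Lemma runs_cexpr p e d l r m s : (32 <= B)%N -> code_at p l (cexpr d e) ->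
  represents s r m -> bounded (State (Some l) r m) -> eok e s -> exists r',
  [/\ runs p (esize e) (State (Some l) r m) (State (Some (l + esize e)%N) r' m),
      r' (treg d) = ev e s & same_below d r r'].
Proof.
move=> B32; elim: e d l r => [x|z|op e1 IH1 e2 IH2|t e IH|e IH] d l r.
- move=> /code_at_cons[c1 /code_at_cons[c2 _]] rep b _.
  have E1 : (vreg x == treg d) = false by rewrite /treg /vreg; lia.
  have R1 := @runs_const _ _ r m _ _ c1 (leq0n _) b.
  have R2 := runs_arith c2 _ (runs_bounded R1).
  rewrite (_ : binop_eval _ _ _ = r (vreg x)) in R2; last first.
    by rewrite /= /upd eqxx E1 addr0.
  have {}R2 := R2 (b.1 _).
  eexists; split.
  + by rewrite addnC; apply: runs_trans R1 R2.
  + by rewrite /upd eqxx; case: rep => ->.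
  + by apply: same_below_trans (leqnn d) _ _; apply: same_below_upd.
- move=> /code_at_cons[c1 _] rep b sz.
  have R1 := runs_const c1 sz b.
  eexists; split; [by rewrite addn1; exact: R1|by rewrite /upd eqxx|].
  exact: same_below_upd.
- move=> /code_at_cat[C1 /code_at_cat[C2 C3]] rep b [ok1 ok2 sm].
  have [r1 [R1 e1' k1]] := IH1 _ _ _ C1 rep b ok1.
  rewrite size_cexpr in C2 C3.
  have [r2 [R2 e2' k2]] := IH2 _ _ _ C2 (represents_below rep k1) (runs_bounded R1) ok2.
  rewrite size_cexpr in C3; have /code_at_cons[c3 _] := C3.
  have E : r2 (treg d) = ev e1 s.
    by rewrite k2 // => d'; rewrite /treg; lia.
  have R3 := runs_arith c3 _ (runs_bounded R2).
  rewrite E e2' in R3; have {}R3 := R3 sm.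
  eexists; split.
  + by rewrite !addnA [(l + _ + _ + 1)%N]addn1; exact: runs_trans (runs_trans R1 R2) R3.
  + by rewrite /upd eqxx.
  + apply: same_below_trans (leqnn d) _ (same_below_upd _ _ (leqnn d)).
    exact: same_below_trans k1 k2.
- move=> /code_at_cat[C1 /code_at_cat[C2 C3]] rep b [ok Ht Hi sm].
  have [r1 [R1 e1' k1]] := IH _ _ _ C1 rep b ok.
  rewrite size_cexpr in C2 C3; rewrite size_caddr in C3.
  have [r2 [R2 e2' k2]] := runs_caddr B32 C2 Ht Hi e1' sm (runs_bounded R1).
  have /code_at_cons[c3 _] := C3.
  have R3 := runs_read c3 (runs_bounded R2).
  eexists; split.
  + rewrite (_ : l + _ = (l + esize e + 4).+1)%N; last by rewrite /=; lia.
    rewrite (_ : esize (Arr t e) = esize e + 4 + 1)%N; last by rewrite /=; lia.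
    exact: runs_trans (runs_trans R1 R2) R3.
  + by rewrite /upd eqxx e2'; case: rep => _ ->.
  + apply: same_below_trans (leqnn d) _ (same_below_upd _ _ (leqnn d)).
    exact: same_below_trans k1 k2.
- move=> /code_at_cat[C1 C3] rep b [ok Hi].
  have [r1 [R1 e1' k1]] := IH _ _ _ C1 rep b ok.
  rewrite size_cexpr in C3.
  have /code_at_cons[c3 _] := C3.
  have R3 := runs_read c3 (runs_bounded R1).
  eexists; split.
  + by rewrite addnA [(l + _ + 1)%N]addn1; exact: runs_trans R1 R3.
  + by rewrite /upd eqxx e1'; case: rep => _ _ ->.
  + exact: same_below_trans (leqnn d) k1 (same_below_upd _ _ (leqnn d)).
Qed.

(* Total correctness: started in [s], the code of [c] reaches its end within [T]
   steps, all words staying at most [B], in a store satisfying [Q]; outer loop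
   counters, whose depth is below [d], are preserved. *)
Definition trip c s T (Q : store -> Prop) := forall d p l r m, (32 <= B)%N ->
  code_at p l (compile d l c) -> represents s r m -> bounded (State (Some l) r m) ->
  exists r' m' s',
  [/\ runs p T (State (Some l) r m) (State (Some (l + csize c)%N) r' m'),
      represents s' r' m',
      forall j, (j < 2 * d)%N -> r' (lreg j) = r (lreg j),
      keeps c s s' & Q s'].

Lemma trip_weaken c s T T' (Q Q' : store -> Prop) : trip c s T Q -> (T <= T')%N ->
  (forall s', keeps c s s' -> Q s' -> Q' s') -> trip c s T' Q'.
Proof.
move=> H le HQ d p l r m B32 C rep b.
have [r' [m' [s' [h1 h2 h3 h4 h5]]]] := H d p l r m B32 C rep b.
exists r', m', s'; split=> //; [exact: runs_le h1 | exact: HQ].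
Qed.

Lemma trip_le c s T T' Q : trip c s T Q -> (T <= T')%N -> trip c s T' Q.
Proof. by move=> H le; exact: (trip_weaken H le (fun _ _ q => q)). Qed.

Lemma trip_skip s (Q : store -> Prop) : Q s -> trip Skip s 0 Q.
Proof.
move=> HQ d p l r m _ _ rep b; exists r, m, s; rewrite addn0; split=> //.
exact: runs0.
Qed.

(** With the triple of the second command as postcondition of the first, no intermediate assertion
    has to be named: proofs run forward, command by command. *)
Lemma trip_seq c1 c2 s T1 T2 Q :
  trip c1 s T1 (fun s' => trip c2 s' T2 Q) -> trip (Seq c1 c2) s (T1 + T2) Q.
Proof.
move=> H d p l r m B32 /code_at_cat[]; rewrite size_compile => C1 C2 rep b.
have [r1 [m1 [s1 [h1 h2 h3 h4 h5]]]] := H d p l r m B32 C1 rep b.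
have [r2 [m2 [s2 [k1 k2 k3 k4 k5]]]] := h5 d p _ r1 m1 B32 C2 h2 (runs_bounded h1).
exists r2, m2, s2; split=> //.
- by rewrite /= addnA; apply: runs_trans h1 k1.
- by move=> j Hj; rewrite k3 // h3.
- split=> [y|t i] /=; rewrite negb_or => /andP[n1 n2].
    by rewrite k4.1 // h4.1.
  by rewrite k4.2 // h4.2.
Qed.

Lemma trip_set x e s (Q : store -> Prop) : eok e s -> Q (setv s x (ev e s)) ->
  trip (Set_ x e) s (esize e + 2) Q.
Proof.
move=> ok HQ d p l r m B32 /code_at_cat[C1 C2] rep b.
have [r1 [R1 e1 k1]] := runs_cexpr B32 C1 rep b ok.
move: C2; rewrite size_cexpr => /code_at_cons[c1 /code_at_cons[c2 _]].
have R2 := @runs_const _ _ r1 m _ _ c1 (leq0n _) (runs_bounded R1).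
have R3 := runs_arith c2 _ (runs_bounded R2).
rewrite (_ : binop_eval _ _ _ = ev e s) in R3; last by rewrite /= /upd /= addr0.
have {}R3 := R3 ltac:(by rewrite -e1; exact: (runs_bounded R1).1).
exists (upd (upd r1 (treg 1) 0) (vreg x) (ev e s)), m, (setv s x (ev e s)); split=> //.
- rewrite [csize _]/= addnA [(l + _ + 2)%N]addn2.
  exact: runs_trans R1 (runs_trans R2 R3).
- have [h1 h2 h3] := rep; split=> // y /=; rewrite /upd.
  have -> : (vreg y == vreg x) = (y == x) by rewrite /vreg; lia.
  case: eqP => // _; have -> : (vreg y == treg 1) = false by rewrite /vreg /treg; lia.
  by rewrite k1 // => d' _; rewrite /vreg /treg; lia.
- move=> j Hj; rewrite /upd.
  have -> : (lreg j == vreg x) = false by rewrite /lreg /vreg; lia.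
  have -> : (lreg j == treg 1) = false by rewrite /lreg /treg; lia.
  by rewrite k1 // => d' _; rewrite /lreg /treg; lia.
- by split=> // y /= /negbTE ->.
Qed.

Lemma trip_store t e1 e2 s (Q : store -> Prop) :
  eok (Arr t e1) s -> eok e2 s -> Q (seta s t (absz (ev e1 s)) (ev e2 s)) ->
  trip (Store t e1 e2) s (esize e1 + 4 + esize e2 + 1) Q.
Proof.
move=> [ok1 Ht Hi sm] ok2 HQ d p l r m B32 /code_at_cat[C1 /code_at_cat[C2 /code_at_cat[C3 C4]]] rep b.
rewrite ?size_cexpr ?size_caddr in C2 C3 C4.
have [r1 [R1 E1 k1]] := runs_cexpr B32 C1 rep b ok1.
have [r2 [R2 E2 k2]] := runs_caddr B32 C2 Ht Hi E1 sm (runs_bounded R1).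
have k12 := same_below_trans (leqnn _) k1 k2.
have [r3 [R3 E3 k3]] := runs_cexpr B32 C3 (represents_below rep k12) (runs_bounded R2) ok2.
have /code_at_cons[c4 _] := C4.
have R4 := runs_write c4 (runs_bounded R3).
have k := same_below_trans (leq0n 1) k12 k3.
exists r3, (upd m (r3 (treg 0)) (r3 (treg 1))), (seta s t (absz (ev e1 s)) (ev e2 s)); split=> //.
- rewrite [csize _]/= !addnA [(l + _ + _ + _ + 1)%N]addn1.
  exact: runs_trans (runs_trans (runs_trans R1 R2) R3) R4.
- have [h1 h2 h3] := represents_below rep k; split=> //.
  + move=> t' i' Ht' /=; rewrite /upd E3 k3; last by move=> d'; rewrite /treg; lia.
    rewrite E2; case: eqP => [/(address_inj Ht' Ht) [-> ->]|ne]; first by rewrite !eqxx.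
    by case: andP => [[/eqP E /eqP E']|_]; [case: ne; rewrite E E'| exact: h2].
  + move=> z Hz; rewrite /upd k3; last by move=> d'; rewrite /treg; lia.
    rewrite E2; case: eqP => [E|_]; last exact: h3.
    by move: Hz; rewrite E /address; lia.
- by move=> j Hj; rewrite k // => d' _; rewrite /lreg /treg; lia.
- by split=> // t' i' /= /negbTE ->.
Qed.

Lemma trip_if e1 e2 c1 c2 s T1 T2 Q : eok e1 s -> eok e2 s ->
  (ev e1 s <= ev e2 s -> trip c1 s T1 Q) ->
  (ev e2 s < ev e1 s -> trip c2 s T2 Q) ->
  trip (IfLe e1 e2 c1 c2) s (esize e1 + esize e2 + maxn T1 T2 + 2) Q.
Proof.
move=> ok1 ok2 H1 H2 d p l r m B32
 /code_at_cat[C1 /code_at_cat[C2 /code_at_cat[C3 /code_at_cat[C4 /code_at_cat[C5 C6]]]]] rep b.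
rewrite !(size_cexpr, size_compile) /= in C2 C3 C4 C5 C6.
have [r1 [R1 E1 k1]] := runs_cexpr B32 C1 rep b ok1.
have [r2 [R2 E2 k2]] := runs_cexpr B32 C2 (represents_below rep k1) (runs_bounded R1) ok2.
have /code_at_cons[c3 _] := C3.
have R3 := runs_jump c3 (runs_bounded R2).
have k := same_below_trans (leq0n 1) k1 k2.
have kl j : r2 (lreg j) = r (lreg j).
  by rewrite k // => d' _; rewrite /lreg /treg; lia.
rewrite E2 (_ : r2 (treg 0) = ev e1 s) in R3; last first.
  by rewrite k2 // => d'; rewrite /treg; lia.
have R := runs_trans (runs_trans R1 R2) R3.
move: R; case: leP => [le|lt] R.
  have [r3 [m3 [s3 [h1 h2 h3 h4 h5]]]] := H1 le d p _ r2 m B32 C6 (represents_below rep k) (runs_bounded R).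
  exists r3, m3, s3; split=> //.
  - have := runs_trans R h1; rewrite /= (_ : l + (_ + _) = l + esize e1 + esize e2 + 1 + csize c2 + 1 + csize c1)%N; last by lia.
    by apply: runs_le; have := leq_maxl T1 T2; lia.
  - by move=> j Hj; rewrite h3 // kl.
  - split=> [y|t i] /=; rewrite negb_or => /andP[n1 n2]; [exact: h4.1 | exact: h4.2].
rewrite -[(l + _ + _).+1]addn1 in R.
have [r3 [m3 [s3 [h1 h2 h3 h4 h5]]]] := H2 lt d p _ r2 m B32 C4 (represents_below rep k) (runs_bounded R).
have /code_at_cons[c5 _] := C5.
have R5 := runs_jump c5 (runs_bounded h1).
rewrite lexx in R5.
exists r3, m3, s3; split=> //.
- have := runs_trans (runs_trans R h1) R5; rewrite /= (_ : l + (_ + _) = l + esize e1 + esize e2 + 1 + csize c2 + 1 + csize c1)%N; last by lia.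
  by apply: runs_le; have := leq_maxr T1 T2; lia.
- by move=> j Hj; rewrite h3 // kl.
- split=> [y|t i] /=; rewrite negb_or => /andP[n1 n2]; [exact: h4.1 | exact: h4.2].
Qed.

(** The body may use [keeps] from the state before the loop, so the invariant mentions only what the
    loop changes. The 6 extra steps per round are the test, the copy of the counter, the increment
    and the jump back. *)
Lemma trip_for x e c s T (N : nat) (I : nat -> store -> Prop) :
  eok e s -> ev e s = N%:Z -> I 0%N s ->
  (forall k s', (k < N)%N -> I k s' -> keeps (For x e c) s s' ->
     trip c (setv s' x k%:Z) T (I k.+1)) ->
  trip (For x e c) s (esize e + 4 + N * (T + 6)) (I N).
Proof.
move=> ok EN I0 Istep d p l r m B32
 /code_at_cat[C1 /code_at_cat[C2 /code_at_cat[C3 /code_at_cat[C4 C5]]]] rep b.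
rewrite !(size_cexpr, size_compile) /= in C2 C3 C4 C5.
have [r1 [R1 E1 k1]] := runs_cexpr B32 C1 rep b ok.
have /code_at_cons[c1 /code_at_cons[c2 /code_at_cons[c3 _]]] := C2.
have R2 := @runs_const _ _ r1 m _ _ c1 (leq0n _) (runs_bounded R1).
have R3 := runs_arith c2 _ (runs_bounded R2).
rewrite (_ : binop_eval _ _ _ = ev e s) in R3; last by rewrite /= /upd /= addr0.
have {}R3 := R3 ltac:(by rewrite -E1; exact: (runs_bounded R1).1).
have R4 := runs_const c3 (leq0n _) (runs_bounded R3).
have := runs_trans R1 (runs_trans R2 (runs_trans R3 R4)).
set r4 := upd _ _ 0 => R.
have {R1 R2 R3 R4 c1 c2 c3} : represents s r4 m /\ (forall j, (j < 2 * d)%N -> r4 (lreg j) = r (lreg j)).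
  split.
    have [h1 h2 h3] := represents_below rep k1; split=> // y; rewrite /r4 /upd.
    have [-> -> ->] : [/\ (vreg y == lreg (2 * d)) = false, (vreg y == lreg (2 * d + 1)) = false & (vreg y == treg 1) = false].
      by split; rewrite /vreg /lreg /treg; lia.
    exact: h1.
  move=> j Hj; rewrite /r4 /upd.
  have [-> -> ->] : [/\ (lreg j == lreg (2 * d)) = false, (lreg j == lreg (2 * d + 1)) = false & (lreg j == treg 1) = false].
    by split; rewrite /vreg /lreg /treg; lia.
  by rewrite k1 // => d' _; rewrite /lreg /treg; lia.
have : r4 (lreg (2 * d)) = 0 /\ r4 (lreg (2 * d + 1)) = N%:Z.
  rewrite /r4 /upd eqxx (_ : (lreg (2 * d + 1) == lreg (2 * d)) = false) ?eqxx ?EN //.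
  by rewrite /lreg; lia.
move: R; rewrite -[(l + _).+3]addn3.
set lh := (l + esize e + 3)%N => R [z4 N4] [rep4 l4].
(* The counter never exceeds [N], which itself sits in a register of a bounded state. *)
have small_k k : (k <= N)%N -> small k%:Z.
  move=> le; have := (runs_bounded R).1 (lreg (2 * d + 1)); rewrite /= N4 /small; lia.
have /code_at_cons[c1 /code_at_cons[c2 /code_at_cons[c3 _]]] := C3.
have /code_at_cons[c5 /code_at_cons[c6 /code_at_cons[c7 _]]] := C5.
have loop k : (k <= N)%N -> exists r' m' s',
    [/\ runs p (esize e + 3 + k * (T + 6)) (State (Some l) r m) (State (Some lh) r' m'),
        represents s' r' m' /\ r' (lreg (2 * d)) = k%:Z /\ r' (lreg (2 * d + 1)) = N%:Z,
        forall j, (j < 2 * d)%N -> r' (lreg j) = r (lreg j),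
        keeps (For x e c) s s' & I k s'].
  elim: k => [|k IH] lek; first by exists r4, m, s; split=> //; rewrite mul0n addn0; exact: R.
  have {IH} [r' [m' [s' [h1 [h2 [h3 h4]] h5 h6 h7]]]] := IH (ltnW lek).
  have := runs_jump c1 (runs_bounded h1); rewrite h3 h4 lez_nat leqNgt lek /= => S1.
  have S2 := runs_const c2 (leq0n _) (runs_bounded S1).
  have S3 := runs_arith c3 _ (runs_bounded S2).
  have n1 : (lreg (2 * d) == treg 0) = false by rewrite /lreg /treg; lia.
  rewrite (_ : binop_eval _ _ _ = k%:Z) in S3; last first.
    by rewrite /= /upd eqxx n1 h3 addr0.
  have {}S3 := S3 (small_k _ (ltnW lek)).
  have := runs_trans h1 (runs_trans S1 (runs_trans S2 S3)).
  set r5 := upd _ (vreg x) _ => {S1 S2 S3} S.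
  have rep5 : represents (setv s' x k%:Z) r5 m'.
    have [g1 g2 g3] := h2; split=> // y; rewrite /r5 /upd /=.
    have [-> ->] : (vreg y == vreg x) = (y == x) /\ (vreg y == treg 0) = false.
      by rewrite /vreg /treg; lia.
    by case: ifP.
  have l5 j : r5 (lreg j) = r' (lreg j).
    rewrite /r5 /upd; have [-> ->] // : (lreg j == vreg x) = false /\ (lreg j == treg 0) = false.
    by rewrite /vreg /treg /lreg; lia.
  have S' := S; rewrite -[lh.+3]addn3 in S'.
  have [r6 [m6 [s6 [j1 j2 j3 j4 j5]]]] :=
    Istep k s' lek h7 h6 d.+1 p _ r5 m' B32 C4 rep5 (runs_bounded S').
  have V1 := runs_const c5 (_ : small 1) (runs_bounded j1).
  have {}V1 := V1 ltac:(by rewrite /small; lia).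
  have V2 := runs_arith c6 _ (runs_bounded V1).
  rewrite (_ : binop_eval _ _ _ = k.+1%:Z) in V2; last first.
    by rewrite /= /upd eqxx n1 j3 ?l5 ?h3; lia.
  have {}V2 := V2 (small_k _ lek).
  have V3 := runs_jump c7 (runs_bounded V2).
  rewrite lexx in V3.
  have W := runs_trans S' (runs_trans j1 (runs_trans V1 (runs_trans V2 V3))).
  exists (upd (upd r6 (treg 0) 1) (lreg (2 * d)) k.+1%:Z), m6, s6; split.
  - by apply: runs_le W; lia.
  - split; [|split].
    + have [g1 g2 g3] := j2; split=> // y; rewrite /upd.
      have [-> ->] // : (vreg y == lreg (2 * d)) = false /\ (vreg y == treg 0) = false.
      by rewrite /vreg /treg /lreg; lia.
    + by rewrite /upd eqxx.
    + rewrite /upd; have [-> ->] : (lreg (2 * d + 1) == lreg (2 * d)) = false /\ (lreg (2 * d + 1) == treg 0) = false.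
        by rewrite /vreg /treg /lreg; lia.
      by rewrite j3 ?l5 ?h4 //; lia.
  - move=> j Hj; rewrite /upd.
    have [-> ->] : (lreg j == lreg (2 * d)) = false /\ (lreg j == treg 0) = false.
      by rewrite /vreg /treg /lreg; lia.
    by rewrite j3 ?l5 ?h5 //; lia.
  - split=> [y /=|t i /= mt].
      rewrite negb_or => /andP[n2 n3]; rewrite j4.1 //= (negbTE n2) h6.1 //=.
      by rewrite (negbTE n2) (negbTE n3).
    by rewrite j4.2 // h6.2.
  - exact: j5.
have [r' [m' [s' [h1 [h2 [h3 h4]] h5 h6 h7]]]] := loop N (leqnn _).
have := runs_jump c1 (runs_bounded h1); rewrite h3 h4 lexx => S1.
exists r', m', s'; split=> //.
rewrite /= (_ : l + _ = lh + 3 + csize c + 3)%N; last by rewrite /lh; lia.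
have := runs_trans h1 S1; apply: runs_le; lia.
Qed.

End Bounded.

Definition input n (G : digraph n) (z : int) : int := memory (init G) z.

Definition initial_store (n : nat) : store :=
  Mk_store (fun x => if x == 0%N then n%:Z else 0) (fun _ _ => 0).

Lemma steps_halted p i st : pc st = None -> steps p i st = st.
Proof. by case: st => [[l|] r m] // _; elim: i => //= i ->. Qed.

(** One further step is spent on halting past the end of the code. The exponent 5 makes the word
    bound at least 2^5 = 32 even for n = 0, which covers the constants of array addressing. *)
Lemma trip_solvable (R : realType) (f : forall n, digraph n -> nat) (t : R)
    (c : cmd) (e : nat) (T : nat -> nat) :
  (5 <= e)%N -> bigO_power (fun n => (T n).+1) t ->
  (forall n (G : digraph n), tournament G ->
     trip ((n + 2) ^ e) (input G) c (initial_store n) (T n)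
       (fun s => var s 0%N = (f n G)%:Z)) ->
  solvable_in f t.
Proof.
move=> e5 bigT H; exists (compile 0 0 c), e, (fun n => (T n).+1); split=> // n G tG.
set B := ((n + 2) ^ e)%N.
have nB : (n + 2 <= B)%N by rewrite /B -{1}(expn1 (n + 2)) leq_exp2l; lia.
have B32 : (32 <= B)%N by apply: leq_trans (_ : 2 ^ e <= B)%N; [exact: (@leq_pexp2l 2 5) | rewrite leq_exp2r; lia].
have b0 : bounded B (init G).
  split=> z; rewrite /small /=; first by case: eqP => _ //=; lia.
  by case: [exists _ in _, _] => /=; lia.
have rep : represents (input G) (initial_store n) (reg (init G)) (memory (init G)).
  split=> //; first by move=> x /=; rewrite /vreg muln_eq0.
  move=> t' i _ /=; case: existsP => // -[a /andP[_ /eqP]].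
  by rewrite /address; lia.
have C : code_at (compile 0 0 c) 0 (compile 0 0 c) by [].
have [r [m [s [[i [iT Ei bi]] [rep0 _ _] _ _ Q]]]] := H n G tG _ _ _ _ _ B32 C rep b0.
rewrite [State _ _ _](_ : _ = init G) // in Ei bi.
have E1 : steps (compile 0 0 c) i.+1 (init G) = State None r m.
  by rewrite /steps iterS -/(steps _ _ _) Ei /= nth_default // size_compile.
have E2 j : (i < j)%N -> steps (compile 0 0 c) j (init G) = State None r m.
  by move=> lt; rewrite -(subnK lt) /steps iterD -!/(steps _ _ _) E1 steps_halted.
split; last first.
  by split; rewrite E2 //= -?Q -?rep0.
move=> j; case: (leqP j i) => ji; first exact: bi.
by rewrite E2 //; have := bi _ (leqnn i); rewrite Ei.
Qed.

(** * Types of tournaments on four vertices *)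

Definition tour (V : finType) (e : rel V) :=
  (forall x, e x x = false) /\ (forall x y, x != y -> e y x = ~~ e x y).

Definition arcs n (G : digraph n) : rel 'I_n := fun x y => (x, y) \in G.

Lemma tour_arcs n (G : digraph n) : tournament G -> tour (arcs G).
Proof.
move=> /andP[/forallP irr /forallP tot]; split=> [x|x y ne].
  exact/negbTE/irr.
have := forallP (tot x) y; rewrite ne /= /arcs.
by case: (_ \in G); case: (_ \in G).
Qed.

Section Types.
Variables (V : finType) (e : rel V).

Definition source_in (S : {set V}) x := (x \in S) && [forall y in S, (y != x) ==> e x y].
Definition sink_in (S : {set V}) x := (x \in S) && [forall y in S, (y != x) ==> e y x].
Definition type_of (S : {set V}) : bool * bool :=
  ([exists x, source_in S x], [exists x, sink_in S x]).
End Types.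

(* A tournament on 0, 1, 2, 3 given by the orientations of the six pairs. *)
Definition rel4 (b : seq bool) (i j : nat) : bool :=
  let get k := nth false b k in
  match i, j with
  | 0, 1 => get 0%N | 0, 2 => get 1%N | 0, 3 => get 2%N
  | 1, 2 => get 3%N | 1, 3 => get 4%N | 2, 3 => get 5%N
  | 1, 0 => ~~ get 0%N | 2, 0 => ~~ get 1%N | 3, 0 => ~~ get 2%N
  | 2, 1 => ~~ get 3%N | 3, 1 => ~~ get 4%N | 3, 2 => ~~ get 5%N
  | _, _ => false
  end.

Definition type4 (b : seq bool) : bool * bool :=
  (has (fun i => all (fun j => (j != i) ==> rel4 b i j) (iota 0 4)) (iota 0 4),
   has (fun i => all (fun j => (j != i) ==> rel4 b j i) (iota 0 4)) (iota 0 4)).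

Definition all_bits : seq (seq bool) :=
  iter 6 (fun s => map (cons true) s ++ map (cons false) s) [:: [::]].

Lemma mem_all_bits b : size b = 6%N -> b \in all_bits.
Proof.
have H k : forall b, size b = k ->
    b \in iter k (fun s => map (cons true) s ++ map (cons false) s) [:: [::]].
  elim: k => [|k IH] [|x c] //= [sc]; rewrite mem_cat.
  by case: x; rewrite map_f ?orbT //; exact: IH.
exact: H.
Qed.

Definition iso4 b b' (l : seq nat) :=
  all (fun i => all (fun j =>
    rel4 b i j == rel4 b' (nth 0%N l i) (nth 0%N l j)) (iota 0 4)) (iota 0 4).

(** The 64 labelled tournaments are compared pairwise by computation, over the 24 permutations.
    Source and sink, a source above a 3-cycle, a sink below a 3-cycle, and neither are the four
    isomorphism types. *)
Lemma type4_iso b b' : size b = 6%N -> size b' = 6 -> type4 b = type4 b' ->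
  exists2 l, perm_eq l (iota 0 4) & iso4 b b' l.
Proof.
move=> /mem_all_bits sb /mem_all_bits sb' E.
have : all (fun b => all (fun b' => (type4 b == type4 b') ==>
    has (iso4 b b') (permutations (iota 0 4))) all_bits) all_bits by vm_compute.
move=> /allP /(_ b sb) /allP /(_ b' sb'); rewrite E eqxx implyTb => /hasP[l].
by rewrite mem_permutations => ? ?; exists l.
Qed.

Definition cycles4 b : nat :=
  sumn [seq sumn [seq sumn [seq sumn [seq
    (rel4 b i j && rel4 b j k && rel4 b k l && rel4 b l i : nat)
    | l <- iota 0 4] | k <- iota 0 4] | j <- iota 0 4] | i <- iota 0 4].

(** The strong tournament on four vertices has a single Hamiltonian cycle, met once from each of its
    four starting points; the other types have none. *)
Lemma cycles4E b : size b = 6%N -> cycles4 b = (4 * (type4 b == (false, false)))%N.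
Proof.
move=> /mem_all_bits sb; apply/eqP.
have : all (fun b => cycles4 b == 4 * (type4 b == (false, false)))%N all_bits by vm_compute.
by move/allP => /(_ b sb).
Qed.

Section Bits.
Variables (V : finType) (e : rel V) (te : tour e) (f : 'I_4 -> V) (inj_f : injective f).

Definition pt (i : nat) : V := f (inord i).
Definition bits_of : seq bool :=
  [:: e (pt 0) (pt 1); e (pt 0) (pt 2); e (pt 0) (pt 3);
      e (pt 1) (pt 2); e (pt 1) (pt 3); e (pt 2) (pt 3)].

Lemma bits_ofE (i j : 'I_4) : e (f i) (f j) = rel4 bits_of i j.
Proof.
have [irr tot] := te.
have ptE (k : 'I_4) : f k = pt k by rewrite /pt inord_val.
have ne a b : (a < 4)%N -> (b < 4)%N -> a != b -> pt a != pt b.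
  by move=> Ha Hb; apply: contraNneq => /inj_f /(congr1 val); rewrite /= !inordK // => ->.
rewrite !ptE; case: i => [[|[|[|[|//]]]] Hi]; case: j => [[|[|[|[|//]]]] Hj];
  rewrite /= ?irr // tot //; exact: ne.
Qed.

Lemma exists_ord4 (P : nat -> bool) : [exists i : 'I_4, P i] = has P (iota 0 4).
Proof.
apply/existsP/hasP => [[i Pi]|[i]]; first by exists (val i) => //; rewrite mem_iota ltn_ord.
by rewrite mem_iota => /andP[_ Hi] Pi; exists (Ordinal Hi).
Qed.

Lemma forall_ord4 (P : nat -> bool) : [forall i : 'I_4, P i] = all P (iota 0 4).
Proof.
apply/forallP/allP => [H i|H i]; last by apply: H; rewrite mem_iota ltn_ord.
by rewrite mem_iota => /andP[_ Hi]; exact: (H (Ordinal Hi)).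
Qed.

Lemma type_of_bits : type_of e (f @: [set: 'I_4]) = type4 bits_of.
Proof.
have step (r : rel V) (r' : nat -> nat -> bool) :
    (forall i j : 'I_4, r (f i) (f j) = r' i j) ->
    [exists x, (x \in f @: [set: 'I_4]) && [forall y in f @: [set: 'I_4], (y != x) ==> r x y]]
    = has (fun i => all (fun j => (j != i) ==> r' i j) (iota 0 4)) (iota 0 4).
  move=> rE; rewrite -exists_ord4; apply/existsP/existsP.
    move=> [x /andP[/imsetP[i _ ->] /forall_inP H]]; exists i.
    rewrite -forall_ord4; apply/forallP => j; rewrite -rE.
    have := H (f j) (imset_f _ (finset.in_setT _)); rewrite (inj_eq inj_f) => Hj.
    exact: Hj.
  move=> [i]; rewrite -forall_ord4 => /forallP H; exists (f i).
  rewrite imset_f ?finset.in_setT //=; apply/forall_inP => y /imsetP[j _ ->].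
  by rewrite (inj_eq inj_f) rE; exact: H.
congr pair; first by apply: (step e); exact: bits_ofE.
apply: (step (fun x y => e y x) (fun i j => rel4 bits_of j i)) => i j.
exact: bits_ofE.
Qed.

End Bits.

Lemma set4P (V : finType) (S : {set V}) : #|S| = 4%N ->
  exists2 f : 'I_4 -> V, injective f & S = f @: [set: 'I_4].
Proof.
move=> S4.
have H (i : 'I_4) : (i < #|S|)%N by rewrite S4.
pose f i := enum_val (Ordinal (H i)).
have injf : injective f by move=> i j /enum_val_inj [] /val_inj.
exists f => //; apply/eqP; rewrite eq_sym eqEcard card_imset // cardsT card_ord.
apply/andP; split; last by rewrite S4.
by apply/fintype.subsetP => x /imsetP[i _ ->]; exact: enum_valP.
Qed.

(** Between tournaments an injection that preserves arcs also reflects them, so the image carries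
    the same six orientations. *)
Lemma embedding_type n (T : digraph 4) (G : digraph n) f :
  tournament T -> tournament G -> embedding T G f ->
  type_of (arcs G) (f @: [set: 'I_4]) = type_of (arcs T) [set: 'I_4].
Proof.
move=> /tour_arcs tT /tour_arcs tG /andP[/injectiveP injf /forallP H].
have arcE x y : arcs G (f x) (f y) = arcs T x y.
  case: (eqVneq x y) => [->|ne]; first by rewrite tG.1 tT.1.
  have Hxy := implyP (forallP (H x) y); have Hyx := implyP (forallP (H y) x).
  have := tT.2 _ _ ne; case E: (arcs T x y) => /= E'; first exact: Hxy.
  rewrite tG.2; last by rewrite (inj_eq injf) eq_sym.
  by rewrite /arcs Hyx //; exact: E'.
have bE : bits_of (arcs G) f = bits_of (arcs T) id by rewrite /bits_of /pt !arcE.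
rewrite (type_of_bits tG injf) bE -(type_of_bits tT (@inj_id _)).
by rewrite imset_id.
Qed.

(** A set of the right type is labelled arbitrarily; [type4_iso] then supplies the permutation that
    turns the labelling into an embedding. *)
Lemma copiesP n (T : digraph 4) (G : digraph n) S : tournament T -> tournament G ->
  (S \in copies T G) = (#|S| == 4%N) && (type_of (arcs G) S == type_of (arcs T) [set: 'I_4]).
Proof.
move=> tT tG; apply/imsetP/andP.
  move=> [f]; rewrite finset.inE => emb ->; have /andP[/injectiveP injf _] := emb.
  by rewrite (embedding_type tT tG emb) card_imset // cardsT card_ord.
move=> [/eqP/set4P[f injf ->] /eqP E].
have [aT aG] := (tour_arcs tT, tour_arcs tG).
have ET : type_of (arcs T) [set: 'I_4] = type4 (bits_of (arcs T) id).
  by rewrite -(type_of_bits aT (@inj_id _)) imset_id.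
move: E; rewrite ET (type_of_bits aG injf) => /esym E.
have [l lp iso] := type4_iso (erefl : size (bits_of _ _) = 6%N) (erefl : size (bits_of _ _) = 6%N) E.
have l4 (i : 'I_4) : (nth 0 l i < 4)%N.
  by have := mem_nth 0%N (_ : i < size l)%N; rewrite (perm_size lp) (perm_mem lp) mem_iota; apply; exact: ltn_ord.
pose s (i : 'I_4) : 'I_4 := Ordinal (l4 i).
have injs : injective s.
  move=> i j /(congr1 val) /= /eqP; rewrite nth_uniq ?(perm_size lp) ?ltn_ord //.
    by move/eqP/val_inj.
  by rewrite (perm_uniq lp) iota_uniq.
exists [ffun i => f (s i)].
  rewrite finset.inE; apply/andP; split.
    by apply/injectiveP => i j; rewrite !ffunE => /injf/injs.
  apply/forallP => i; apply/forallP => j; apply/implyP; rewrite !ffunE.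
  rewrite -[(_, _) \in T]/(arcs T (id i) (id j)) -[(_, _) \in G]/(arcs G (f (s i)) (f (s j))).
  rewrite (bits_ofE aG injf) (bits_ofE aT (@inj_id _)).
  have /allP/(_ (val i)) := iso; rewrite mem_iota ltn_ord => /(_ isT)/allP/(_ (val j)).
  by rewrite mem_iota ltn_ord => /(_ isT)/eqP ->.
apply/eqP; rewrite eq_sym eqEcard !card_imset // ?leqnn ?andbT; last first.
  by move=> i j; rewrite !ffunE => /injf/injs.
by apply/fintype.subsetP => x /imsetP[i _ ->]; rewrite ffunE imset_f ?finset.in_setT.
Qed.

Lemma big_ord_iota (g : nat -> nat) k : (\sum_(i < k) g i = sumn [seq g i | i <- iota 0 k])%N.
Proof. by rewrite sumnE big_map -[in RHS](subn0 k) big_mkord. Qed.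

Lemma card_set_sum (T : finType) (P : pred T) : (#|[set x | P x]| = \sum_x P x)%N.
Proof. by rewrite -sum1_card big_mkcond; apply: eq_bigr => x _; rewrite finset.inE; case: (P x). Qed.

(** * Double counting of the 4-subsets by type *)

Section Counts.
Variables (V : finType).
Implicit Types (e : rel V) (S : {set V}).

Lemma tour_asym e x y : tour e -> e x y -> e y x = false.
Proof.
move=> [irr tot] xy; rewrite tot ?xy //; apply: contraTneq xy => ->.
by rewrite irr.
Qed.

Lemma tour_neq e x y : tour e -> e x y -> x != y.
Proof. by move=> [irr _]; apply: contraTneq => ->; rewrite irr. Qed.

Definition converse e : rel V := fun x y => e y x.

Lemma tour_converse e : tour e -> tour (converse e).
Proof. by move=> [irr tot]; split=> // x y ne; rewrite /converse tot // eq_sym. Qed.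

Definition out e x := [set y | e x y].

Lemma source_unique e S x y : tour e -> source_in e S x -> source_in e S y -> x = y.
Proof.
move=> te /andP[xS /forall_inP Hx] /andP[yS /forall_inP Hy].
apply: contraTeq (Hx y yS) => ne; rewrite eq_sym ne /=.
by rewrite (tour_asym te) //; have := Hy x xS; rewrite ne.
Qed.

(** Removing the source [x] is a bijection onto the [k]-subsets of its out-neighbourhood. *)
Lemma card_source e k x : tour e ->
  #|[set S : {set V} | (#|S| == k.+1) && source_in e S x]| = 'C(#|out e x|, k).
Proof.
move=> te; rewrite -cards_draws.
have nx (A : {set V}) : A \subset out e x -> x \notin A.
  by move=> AN; apply/negP => /(fintype.subsetP AN); rewrite finset.inE te.1.
rewrite -[RHS](card_in_imset (f := fun A => x |: A)); last first.
  move=> A A'; rewrite !finset.inE => /andP[/nx nA _] /andP[/nx nA' _] E.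
  by rewrite -(finset.setU1K nA) E finset.setU1K.
apply: eq_card => S; rewrite finset.inE; apply/andP/imsetP.
  move=> [/eqP cS /andP[xS /forall_inP H]]; exists (S :\ x); last by rewrite finset.setD1K.
  rewrite finset.inE; apply/andP; split.
    apply/fintype.subsetP => y; rewrite !finset.inE => /andP[ne yS].
    by have := H y yS; rewrite ne.
  by move: cS; rewrite (cardsD1 x) xS add1n => -[->].
move=> [A]; rewrite finset.inE => /andP[AN /eqP cA] ->.
rewrite finset.cardsU1 (nx _ AN) cA; split=> //; rewrite /source_in finset.setU11 /=.
apply/forall_inP => y; rewrite !finset.inE => /orP[->//|/(fintype.subsetP AN)].
by rewrite finset.inE => ->; rewrite implybT.
Qed.

(** A set has at most one source, so the sum over all possible sources counts each set once. *)
Lemma sum_bin_out e k : tour e ->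
  (\sum_x 'C(#|out e x|, k))%N =
  #|[set S : {set V} | (#|S| == k.+1) && [exists x, source_in e S x]]|.
Proof.
move=> te; transitivity (\sum_x \sum_(S : {set V} | #|S| == k.+1) source_in e S x)%N.
  apply: eq_bigr => x _; rewrite -card_source // card_set_sum.
  rewrite [RHS]big_mkcond /=; apply: eq_bigr => S _.
  by case: (_ == _); case: source_in.
rewrite exchange_big /= card_set_sum big_mkcond /=.
apply: eq_bigr => S _; case: (_ == _) => //=.
case: existsP => [[x sx]|no].
  rewrite (bigD1 x) //= sx big1 // => y ne.
  by case E: source_in => //; case/eqP: ne; exact: source_unique E sx.
by rewrite big1 // => x _; case E: source_in => //; case: no; exists x.
Qed.

Definition card_type e (t : bool * bool) :=
  #|[set S : {set V} | (#|S| == 4%N) && (type_of e S == t)]|.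

Lemma card_type_source e : tour e ->
  (card_type e (true, true) + card_type e (true, false) = \sum_x 'C(#|out e x|, 3))%N.
Proof.
move=> te; rewrite sum_bin_out // /card_type !card_set_sum -big_split /=.
apply: eq_bigr => S _ /=; rewrite /type_of; case: (_ == 4) => //=.
by case: [exists x, _]; case: [exists x, _].
Qed.

Lemma card_type_converse e b c : card_type (converse e) (b, c) = card_type e (c, b).
Proof.
apply: eq_card => S; rewrite !finset.inE; congr andb.
by rewrite /type_of /= !xpair_eqE andbC.
Qed.

Lemma card_type_sink e : tour e ->
  (card_type e (true, true) + card_type e (false, true) = \sum_x 'C(#|out (converse e) x|, 3))%N.
Proof.
by move=> te; rewrite -(card_type_source (tour_converse te)) (card_type_converse e true true) (card_type_converse e true false).
Qed.

Lemma card_type_total e :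
  (card_type e (true, true) + card_type e (true, false) + card_type e (false, true)
    + card_type e (false, false) = 'C(#|V|, 4))%N.
Proof.
rewrite -card_draws /card_type !card_set_sum -!big_split /=.
apply: eq_bigr => S _ /=; case: (_ == 4) => //=.
by case: (type_of e S) => [[] []].
Qed.

Definition closed4 e (q : V * V * V * V) : bool :=
  let: (x, y, z, w) := q in e x y && e y z && e z w && e w x.

Definition set_of4 (q : V * V * V * V) : {set V} :=
  let: (x, y, z, w) := q in [set u in [:: x; y; z; w]].

(** A coincidence x = z or y = w would put both orientations of one pair into the walk. *)
Lemma card_closed4 e q : tour e -> closed4 e q -> #|set_of4 q| = 4%N.
Proof.
case: q => [[[x y] z] w] te /andP[/andP[/andP[xy yz] zw] wx].
have [nxy nyz nzw nwx] := And4 (tour_neq te xy) (tour_neq te yz) (tour_neq te zw) (tour_neq te wx).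
have nxz : x != z by apply: contraTneq yz => <-; rewrite (tour_asym te xy).
have nyw : y != w by apply: contraTneq zw => <-; rewrite (tour_asym te yz).
rewrite /set_of4 cardsE; apply/card_uniqP.
by rewrite /= !inE !negb_or nxy nxz nyz nyw nzw eq_sym nwx.
Qed.

Lemma closed4_set e S : tour e -> #|S| = 4%N ->
  (\sum_(q | S == set_of4 q) closed4 e q = 4 * (type_of e S == (false, false)))%N.
Proof.
move=> te S4; transitivity
  (\sum_(q : V * V * V * V | [&& q.1.1.1 \in S, q.1.1.2 \in S, q.1.2 \in S & q.2 \in S])
     closed4 e q)%N.
  rewrite big_mkcond [RHS]big_mkcond /=; apply: eq_bigr => -[[[x y] z] w] _.
  case C: (closed4 e (x, y, z, w)); last by rewrite !if_same.
  have c4 := card_closed4 te C.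
  rewrite eq_sym eqEcard c4 S4 leqnn andbT /=.
  congr (if _ then _ else _); apply/fintype.subsetP/and4P => /=.
    by move=> H; split; apply: H; rewrite !inE eqxx ?orbT.
  by move=> [? ? ? ?] u; rewrite !inE => /or4P[] /eqP ->.
have [f injf E] := set4P S4.
have reix (g : V -> nat) : (\sum_(x in S) g x = \sum_(i < 4) g (f i))%N.
  by rewrite E big_imset /=; [apply: eq_bigl => i; rewrite finset.inE | move=> ? ? _ _ /injf].
rewrite E (type_of_bits te injf) -cycles4E // -E.
transitivity (\sum_(x in S) \sum_(y in S) \sum_(z in S) \sum_(w in S) closed4 e (x, y, z, w))%N.
  rewrite pair_big /= pair_big /= pair_big /=.
  by apply: eq_big => [[[[x y] z] w]|[[[x y] z] w] _] //=; rewrite -!andbA.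
rewrite reix /cycles4 -big_ord_iota; apply: eq_bigr => i _.
rewrite reix -big_ord_iota; apply: eq_bigr => j _.
rewrite reix -big_ord_iota; apply: eq_bigr => k _.
rewrite reix -big_ord_iota; apply: eq_bigr => l _.
by rewrite /closed4 !(bits_ofE te injf).
Qed.

(** The walks are grouped by their vertex sets; a strong set receives four of them, any other set
    none. *)
Lemma card_type_closed4 e : tour e -> (\sum_q closed4 e q = 4 * card_type e (false, false))%N.
Proof.
move=> te; transitivity (\sum_q \sum_(S : {set V} | (#|S| == 4%N) && (S == set_of4 q)) closed4 e q)%N.
  apply: eq_bigr => q _; case C: (closed4 e q); last by rewrite big1.
  rewrite (big_pred1 (set_of4 q)) // => S /=.
  by case: (eqVneq S) => [->|]; rewrite ?andbT ?andbF ?(card_closed4 te C).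
rewrite (exchange_big_dep (fun S : {set V} => #|S| == 4%N)) /=; last by move=> q S _ /andP[].
transitivity (\sum_(S : {set V} | #|S| == 4%N) 4 * (type_of e S == (false, false)))%N.
  apply: eq_bigr => S /eqP S4; rewrite -closed4_set //.
  by apply: eq_bigl => q; rewrite S4.
rewrite -big_distrr /=; congr muln; rewrite /card_type card_set_sum big_mkcond /=.
by apply: eq_bigr => S _; case: (_ == 4); case: (_ == _).
Qed.
End Counts.

Lemma count_copiesE n (T : digraph 4) (G : digraph n) : tournament T -> tournament G ->
  count_copies T G = card_type (arcs G) (type_of (arcs T) [set: 'I_4]).
Proof.
by move=> tT tG; apply: eq_card => S; rewrite copiesP // finset.inE.
Qed.

Lemma has_copyE n (T : digraph 4) (G : digraph n) : 
  has_copy T G = (0 < count_copies T G)%N.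
Proof. by rewrite /has_copy /count_copies card_gt0. Qed.

(** * Structure of the tournaments avoiding a type *)

Definition oriented (V : finType) (e : rel V) (b : bool) x y := if b then e x y else e y x.

Definition pattern4 (V : finType) (e : rel V) (b : seq bool) x0 x1 x2 x3 :=
  let get := nth false b in
  [/\ oriented e (get 0%N) x0 x1, oriented e (get 1%N) x0 x2 & oriented e (get 2%N) x0 x3] /\
  [/\ oriented e (get 3%N) x1 x2, oriented e (get 4%N) x1 x3 & oriented e (get 5%N) x2 x3].

Lemma set3_rot (V : finType) (a b c : V) : [set a; b; c] = [set b; c; a].
Proof. by apply/setP => x; rewrite !finset.inE -orbA orbC. Qed.

Section Patterns.
Variables (V : finType) (e : rel V).
Hypothesis te : tour e.

(** Trades a set and its type for four explicit vertices. [pattern4] need not require them to be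
    distinct, since equal vertices have no arc between them. *)
Lemma card_type_pattern b : size b = 6%N ->
  (0 < card_type e (type4 b))%N <-> exists x0 x1 x2 x3, pattern4 e b x0 x1 x2 x3.
Proof.
move=> sb; split.
  rewrite card_gt0 => /set0Pn[S]; rewrite finset.inE => /andP[/eqP/set4P[f injf ->]].
  rewrite (type_of_bits te injf) => /eqP/esym E.
  have [l lp iso] := type4_iso sb (erefl : size (bits_of _ _) = 6%N) E.
  have l4 i : (i < 4)%N -> (nth 0 l i < 4)%N.
    by move=> Hi; have := mem_nth 0%N (_ : i < size l)%N; rewrite (perm_size lp) (perm_mem lp) mem_iota; apply.
  have arcE i j : (i < 4)%N -> (j < 4)%N -> e (pt f (nth 0%N l i)) (pt f (nth 0%N l j)) = rel4 b i j.
    move=> Hi Hj; rewrite /pt (bits_ofE te injf) !inordK ?l4 //.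
    have /allP/(_ i) := iso; rewrite mem_iota => /(_ Hi)/allP/(_ j).
    by rewrite mem_iota => /(_ Hj)/eqP ->.
  exists (pt f (nth 0%N l 0)), (pt f (nth 0%N l 1)), (pt f (nth 0%N l 2)), (pt f (nth 0%N l 3)).
  have orE i j c : (i < 4)%N -> (j < 4)%N -> rel4 b i j = c -> rel4 b j i = ~~ c ->
     oriented e c (pt f (nth 0%N l i)) (pt f (nth 0%N l j)).
    by move=> Hi Hj E1 E2; rewrite /oriented; case: c E1 E2; rewrite arcE.
  by split; split; apply: orE.
move=> [x0 [x1 [x2 [x3 P]]]].
pose f (i : 'I_4) := nth x0 [:: x0; x1; x2; x3] i.
have orE c x y : oriented e c x y -> e x y = c /\ e y x = ~~ c.
  by case: c => /= xy; rewrite xy (tour_asym te).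
have fE (i j : 'I_4) : e (f i) (f j) = rel4 b i j.
  have [[/orE[? ?] /orE[? ?] /orE[? ?]] [/orE[? ?] /orE[? ?] /orE[? ?]]] := P.
  by case: i => [[|[|[|[|//]]]] Hi]; case: j => [[|[|[|[|//]]]] Hj]; rewrite /f /= ?te.1.
have injf : injective f.
  move=> i j E; apply/eqP/negPn/negP => ne.
  have : rel4 b i j || rel4 b j i.
    move: ne; case: i {E} => [[|[|[|[|//]]]] Hi]; case: j => [[|[|[|[|//]]]] Hj] //= _;
    by rewrite ?orbN // orNb.
  by rewrite -!fE E te.1.
rewrite card_gt0; apply/set0Pn; exists (f @: [set: 'I_4]).
rewrite finset.inE card_imset // cardsT card_ord eqxx /= (type_of_bits te injf).
apply/eqP; congr type4; rewrite /bits_of /pt !fE !inordK //=.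
by case: b sb {P fE} => [|? [|? [|? [|? [|? [|? [|? ?]]]]]]].
Qed.

(** The other vertices of [A], at least 2k - 1 in number, split into out- and in-neighbours of [x],
    so one of the two parts has at least k. *)
Lemma halve (A : {set V}) k : (0 < k)%N -> (2 * k <= #|A|)%N -> exists x (A' : {set V}),
  [/\ x \in A, A' \subset A, (k <= #|A'|)%N &
   (forall y, y \in A' -> e x y) \/ (forall y, y \in A' -> e y x)].
Proof.
move=> k0 kA; have /set0Pn[x xA] : A != finset.set0 by rewrite -card_gt0; lia.
have cA : (#|A| <= 1 + #|out e x :&: A| + #|out (converse e) x :&: A|)%N.
  rewrite (cardsD1 x) xA -addnA leq_add2l -cardsUI; apply: leq_trans (leq_addr _ _).
  apply: subset_leq_card; apply/fintype.subsetP => y; rewrite !finset.inE => /andP[ne ->].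
  by rewrite /converse te.2 ?andbT //; case: (e y x).
case: (leqP k #|out e x :&: A|) => Hk.
  exists x, (out e x :&: A); rewrite finset.subsetIr; split=> //; left=> y.
  by rewrite !finset.inE => /andP[].
exists x, (out (converse e) x :&: A); rewrite finset.subsetIr; split=> //; first by lia.
by right=> y; rewrite !finset.inE => /andP[].
Qed.

(** Halving from 8 to 4, 2 and 1: each chosen vertex is a source or a sink relative to all that
    remains, so the four vertices are transitively ordered. The eight cases only sort them. *)
Lemma transitive4_exists : (8 <= #|V|)%N -> (0 < card_type e (true, true))%N.
Proof.
move=> V8; rewrite (_ : (true, true) = type4 (nseq 6 true)) //.
apply/card_type_pattern => //=.
have [x0 [A1 [_ _ c1 H1]]] := @halve [set: V] 4 isT ltac:(by rewrite cardsT).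
have [x1 [A2 [x1A s2 c2 H2]]] := @halve A1 2 isT c1.
have [x2 [A3 [x2A s3 c3 H3]]] := @halve A2 1 isT c2.
have /set0Pn[x3 x3A] : A3 != finset.set0 by rewrite -card_gt0.
have x3A2 := fintype.subsetP s3 _ x3A.
have [x3A1 x2A1] := (fintype.subsetP s2 _ x3A2, fintype.subsetP s2 _ x2A).
case: H1 => H1; case: H2 => H2; case: H3 => H3;
have := (H1 _ x1A, H1 _ x2A1, H1 _ x3A1, H2 _ x2A, H2 _ x3A2, H3 _ x3A);
move=> [[[[[? ?] ?] ?] ?] ?].
- by exists x0, x1, x2, x3.
- by exists x0, x1, x3, x2.
- by exists x0, x2, x3, x1.
- by exists x0, x3, x2, x1.
- by exists x1, x2, x3, x0.
- by exists x1, x3, x2, x0.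
- by exists x2, x3, x1, x0.
- by exists x3, x2, x1, x0.
Qed.

Definition cyclic3 a b c := [&& e a b, e b c & e c a].

Lemma cyclic3_rot a b c : cyclic3 a b c -> cyclic3 b c a.
Proof. by rewrite /cyclic3 => /and3P[-> -> ->]. Qed.

Definition triangles : {set {set V}} :=
  [set S : {set V} | (#|S| == 3%N) && ~~ [exists x, source_in e S x]].

Lemma card_triangles : (\sum_x 'C(#|out e x|, 2) + #|triangles| = 'C(#|V|, 3))%N.
Proof.
rewrite -card_draws sum_bin_out // !card_set_sum -big_split /=.
by apply: eq_bigr => S _; case: (_ == 3) => //=; case: [exists x, _].
Qed.

Lemma set3P (S : {set V}) : #|S| = 3%N -> exists a b c, [/\ a != b, b != c, c != a & S = [set a; b; c]].
Proof.
move=> S3; have /set0Pn[a aS] : S != finset.set0 by rewrite -card_gt0 S3.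
have := S3; rewrite (cardsD1 a) aS add1n => /eq_add_S/eqP/cards2P[b [c [bc E]]].
have [bS cS] : b \in S :\ a /\ c \in S :\ a by rewrite E !finset.inE !eqxx orbT.
move: bS cS; rewrite !finset.inE => /andP[ba _] /andP[ca _].
exists a, b, c; rewrite eq_sym; split=> //.
by rewrite -(finset.setD1K aS) E finset.setUA.
Qed.

Lemma trianglesP S : reflect (exists a b c, cyclic3 a b c /\ S = [set a; b; c]) (S \in triangles).
Proof.
rewrite finset.inE; apply: (iffP andP) => [[/eqP/set3P[a [b [c [ab bc ca ->]]]]]|].
  rewrite negb_exists => /forallP ns.
  have nsrc x y z : x != y -> y != z -> z != x -> [set a; b; c] = [set x; y; z] ->
      ~~ (e x y && e x z).
    move=> xy yz zx E; apply: contra (ns x) => /andP[exy exz].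
    rewrite /source_in E !finset.inE eqxx /=; apply/forall_inP => u.
    by rewrite !finset.inE => /orP[/orP[]|] /eqP -> //; rewrite ?eqxx ?exy ?exz ?implybT.
  have Na := nsrc a b c ab bc ca erefl.
  have Nb := nsrc b c a bc ca ab (set3_rot _ _ _).
  have Nc := nsrc c a b ca ab bc (esym (set3_rot _ _ _)).
  have [ba cb ac] := And3 (te.2 _ _ ab) (te.2 _ _ bc) (te.2 _ _ ca).
  case Eab: (e a b) in ba Na.
    exists a, b, c; split=> //; rewrite /cyclic3 Eab /=.
    by move: Na Nb Nc; rewrite ac cb ba; case: (e c a); case: (e b c).
  exists a, c, b; split; last by rewrite finset.setUAC.
  rewrite /cyclic3 ba andbT ac cb.
  by move: Na Nb Nc; rewrite ac cb ba; case: (e c a); case: (e b c).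
move=> [a [b [c [/and3P[ab bc ca] ->]]]].
have [nab nbc nca] := And3 (tour_neq te ab) (tour_neq te bc) (tour_neq te ca).
split.
  have nac : a != c by rewrite eq_sym.
  by rewrite -!finset.setUA !finset.cardsU1 !finset.inE cards1 negb_or nab nbc nac.
apply/negP => /existsP[x /andP[]].
rewrite !finset.inE => /orP[/orP[]|] /eqP -> /forall_inP H.
- by have := H c; rewrite !finset.inE eqxx orbT nca (tour_asym te ca) => /(_ isT).
- by have := H a; rewrite !finset.inE eqxx nab (tour_asym te ab) => /(_ isT).
- by have := H b; rewrite !finset.inE eqxx orbT nbc (tour_asym te bc) => /(_ isT).
Qed.

(** If an arc u -> v lies on no 3-cycle, every out-neighbour of v is one of u, and v itself is one
    more, so the scores differ. *)
Lemma equal_out_triangle u v : u != v -> #|out e u| = #|out e v| ->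
  exists S, [/\ S \in triangles, u \in S & v \in S].
Proof.
wlog uv : u v / e u v.
  move=> H ne E; case uv: (e u v); first exact: H.
  have vu : e v u by rewrite (te.2 _ _ ne) uv.
  have [S [? ? ?]] := H v u vu ltac:(by rewrite eq_sym) (esym E).
  by exists S.
move=> ne E; have [/existsP[w /andP[vw wu]]|no] := boolP [exists w, e v w && e w u].
  exists [set u; v; w]; split; [|by rewrite !finset.inE eqxx|by rewrite !finset.inE eqxx orbT].
  by apply/trianglesP; exists u, v, w; rewrite /cyclic3 uv vw wu.
have : (#|out e v| < #|out e u|)%N; last by rewrite E ltnn.
apply: proper_card; apply/properP; split; last first.
  by exists v; rewrite !finset.inE ?te.1.
apply/fintype.subsetP => w; rewrite !finset.inE => vw.
have nuw : w != u by apply: contraTneq vw => ->; rewrite (tour_asym te uv).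
by rewrite te.2 //; apply: contra no => wu; apply/existsP; exists w; rewrite vw.
Qed.

Definition level d : {set V} := [set v | #|out e v| == d].

(** For an arc u -> v of the 3-cycle with third vertex w, u -> x -> v would make u, x, v, w a closed
    4-walk. Hence an arc to x is passed on from u to v, and so all around the cycle. *)
Lemma homogeneous a b c x : (forall q, ~~ closed4 e q) -> cyclic3 a b c ->
  x \notin [set a; b; c] -> e a x = e b x.
Proof.
move=> no C; rewrite !finset.inE !negb_or => /andP[/andP[xa xb] xc].
have step u v w : cyclic3 u v w -> x != v -> e u x -> e v x.
  move=> /and3P[uv vw wu] nv ux; rewrite te.2 //; apply/negP => xv.
  by have := no (u, x, v, w); rewrite /= ux xv vw wu.
have C1 := cyclic3_rot C; have C2 := cyclic3_rot C1.
by apply/idP/idP => [|H]; [exact: step C _ | apply: (step _ _ _ C2) => //; exact: (step _ _ _ C1)].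
Qed.

(** Homogeneity gives the three vertices the same out-neighbours outside [S], and each has one
    inside, hence equal scores. A further vertex [y] of this score would share with [a] another
    3-cycle [S'], and [S], [S'] cannot both be homogeneous. *)
Lemma triangle_level S d : (forall q, ~~ closed4 e q) -> S \in triangles ->
  (exists2 u, u \in S & #|out e u| = d) -> S = level d.
Proof.
move=> no ST.
have outE a b c : cyclic3 a b c -> #|out e a| = #|out e b|.
  move=> C; have /and3P[ab bc ca] := C.
  rewrite -(cardsID [set a; b; c] (out e a)) -(cardsID [set a; b; c] (out e b)).
  have -> : out e a :\: [set a; b; c] = out e b :\: [set a; b; c].
    apply/setP => x; rewrite !finset.inE; case E: (_ || _) => //=.
    by apply: (@homogeneous a b c) => //; rewrite !finset.inE E.
  have -> : out e a :&: [set a; b; c] = [set b].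
    apply/setP => x; rewrite !finset.inE; case: (eqVneq x b) => [->|_]; rewrite ?ab ?eqxx ?orbT //.
    by case: (eqVneq x a) => [->|_]; rewrite ?te.1 //; case: eqP => [->|_]; rewrite ?(tour_asym te ca) ?andbF.
  have -> : out e b :&: [set a; b; c] = [set c].
    apply/setP => x; rewrite !finset.inE; case: (eqVneq x c) => [->|_]; rewrite ?bc ?eqxx ?orbT //.
    by case: (eqVneq x a) => [->|_]; rewrite ?(tour_asym te ab) //; case: eqP => [->|_]; rewrite ?te.1 ?andbF.
  by rewrite !cards1.
have rep u : u \in S -> exists b c, cyclic3 u b c /\ S = [set u; b; c].
  have /trianglesP[a [b [c [C ES]]]] := ST; rewrite {1}ES !finset.inE.
  move=> /orP[/orP[]|] /eqP ->; [exists b, c|exists c, a|exists a, b]; split=> //.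
  - exact: cyclic3_rot.
  - by rewrite ES set3_rot.
  - exact/cyclic3_rot/cyclic3_rot.
  - by rewrite ES -set3_rot.
move=> [a aS ad]; have [b [c [C ES]]] := rep a aS.
have C1 := cyclic3_rot C; have [ab bc] := (outE _ _ _ C, outE _ _ _ C1).
apply/setP => y; rewrite finset.inE; apply/idP/eqP.
  by rewrite ES !finset.inE => /orP[/orP[]|] /eqP ->; rewrite -?bc -?ab.
move=> yd; apply/negPn/negP => yS.
have ny : a != y by apply: contraNneq yS => <-.
have [S' [S'T aS' yS']] := equal_out_triangle ny (etrans ad (esym yd)).
have hom u v : u \in S -> v \in S -> e u y = e v y.
  have H u' : u' \in S -> e a y = e u' y.
    have H1 := @homogeneous a b c y no C; have H2 := @homogeneous b c a y no C1.
    rewrite ES !finset.inE => /orP[/orP[]|] /eqP -> //; first by apply: H1; rewrite -ES.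
    by rewrite H1 -?ES // H2 // -set3_rot -ES.
  by move=> /H <- /H <-.
have /trianglesP[a' [b' [c' [C' ES']]]] := S'T.
have /and3P[eab ebc eca] := C.
have [bS cS] : b \in S /\ c \in S by rewrite ES !finset.inE !eqxx ?orbT.
have homS' x u v : x \notin S' -> u \in S' -> v \in S' -> e u x = e v x.
  have D1 := cyclic3_rot C'; rewrite ES' => xS'.
  have H1 := homogeneous no C' xS'.
  have H2 : e b' x = e c' x.
    by apply: (homogeneous no D1); rewrite -set3_rot.
  by rewrite !finset.inE => /orP[/orP[]|] /eqP -> /orP[/orP[]|] /eqP ->; rewrite ?H1 ?H2.
(* With both [b] and [c], [S'] is too large. If [b] is outside, [y] beats all of [S]; if [c] is
   outside, [S] beats [y]. Then the third vertex of [S] either gives [S'] a source or contradicts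
   the homogeneity of [S']. *)
have [/andP[bS' cS']|/nandP[nb|nc]] := boolP ((b \in S') && (c \in S')).
- have : (#|[set y; a; b; c]| <= #|S'|)%N.
    apply: subset_leq_card; apply/fintype.subsetP => x.
    by rewrite !finset.inE => /orP[/orP[/orP[]|]|] /eqP ->.
  have S3 : #|S| = 3%N by move: ST; rewrite finset.inE => /andP[/eqP].
  have S'3 : #|S'| = 3%N by move: S'T; rewrite finset.inE => /andP[/eqP].
  rewrite (_ : [set y; a; b; c] = y |: S); last by rewrite ES !finset.setUA.
  by rewrite finset.cardsU1 yS S3 S'3.
- have E1 := homS' b a y nb aS' yS'.
  have yb : e y b by rewrite -E1.
  have E2 := hom a b aS bS; have Eb : e b y = false by rewrite (tour_asym te yb).
  have ya : e y a by rewrite te.2 ?E2 ?Eb.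
  have yc : e y c by rewrite te.2 ?(hom c b) ?Eb //; apply: contraNneq yS => <-.
  case cS': (c \in S').
    have E3 : e c y = false by rewrite (tour_asym te yc).
    have S'3 : S' = [set a; y; c].
      apply/eqP; rewrite eq_sym eqEcard; apply/andP; split.
        by apply/fintype.subsetP => x; rewrite !finset.inE => /orP[/orP[]|] /eqP ->.
      have -> : #|S'| = 3%N by move: S'T; rewrite finset.inE => /andP[/eqP].
      rewrite -!finset.setUA !finset.cardsU1 !finset.inE cards1 negb_or ny.
      by rewrite (tour_neq te yc) eq_sym (tour_neq te eca).
    have : ~~ [exists x, source_in e S' x] by move: S'T; rewrite finset.inE => /andP[].
    move=> /existsP[]; exists y; rewrite /source_in yS' /=; apply/forall_inP => x.
    by rewrite S'3 !finset.inE => /orP[/orP[]|] /eqP ->; rewrite ?ya ?yc ?eqxx ?implybT.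
  have := homS' c y a (negbT cS') yS' aS'; rewrite yc => /esym ac.
  by rewrite (tour_asym te eca) in ac.
- have E1 := homS' c a y nc aS' yS'.
  have E0 : e y c = false by rewrite -E1 (tour_asym te eca).
  have cy : e c y by rewrite te.2 ?E0 //; apply: contraNneq yS => ->.
  have ay : e a y by rewrite (hom a c).
  have byy : e b y by rewrite (hom b c).
  case bS': (b \in S').
    have S'3 : S' = [set a; y; b].
      apply/eqP; rewrite eq_sym eqEcard; apply/andP; split.
        by apply/fintype.subsetP => x; rewrite !finset.inE => /orP[/orP[]|] /eqP ->.
      have -> : #|S'| = 3%N by move: S'T; rewrite finset.inE => /andP[/eqP].
      rewrite -!finset.setUA !finset.cardsU1 !finset.inE cards1 negb_or ny.
      by rewrite (tour_neq te eab) (eq_sym y b) (tour_neq te byy).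
    have : ~~ [exists x, source_in e S' x] by move: S'T; rewrite finset.inE => /andP[].
    move=> /existsP[]; exists a; rewrite /source_in aS' /=; apply/forall_inP => x.
    by rewrite S'3 !finset.inE => /orP[/orP[]|] /eqP ->; rewrite ?ay ?eab ?eqxx ?implybT.
  have := homS' b y a (negbT bS') yS' aS'; rewrite eab (tour_asym te byy) //.
Qed.

End Patterns.

(** * Avoiding the strong type: 3-cycles against scores attained three times *)

Section Strong.
Variables (V : finType) (e : rel V).
Hypothesis te : tour e.

Lemma out_lt x : (#|out e x| < #|V|)%N.
Proof.
rewrite -cardsT; apply: proper_card; apply/properP; split; first exact: finset.subsetT.
by exists x; rewrite ?finset.inE // te.1.
Qed.

Lemma card_triangle S : S \in triangles e -> #|S| = 3%N.
Proof. by rewrite finset.inE => /andP[/eqP]. Qed.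

(** Whatever the directions of its two diagonals, a 4-cycle contains two 3-cycles with a common
    arc. *)
Lemma closed4_triangles q : closed4 e q -> exists S S' u v,
  [/\ S \in triangles e, S' \in triangles e, S != S', u != v &
      [/\ u \in S, v \in S, u \in S' & v \in S']].
Proof.
case: q => [[[x y] z] w] C; have C4 := card_closed4 te C.
have /andP[/andP[/andP[xy yz] zw] wx] := C.
have nS a b c d : cyclic3 e a b c -> cyclic3 e a b d -> set_of4 (x,y,z,w) \subset [set a; b; c; d] ->
    exists S S' u v,
    [/\ S \in triangles e, S' \in triangles e, S != S', u != v &
      [/\ u \in S, v \in S, u \in S' & v \in S']].
  move=> C1 C2 sub.
  have T' : [set a; b; d] \in triangles e by apply/(trianglesP te); exists a, b, d.
  have T : [set a; b; c] \in triangles e by apply/(trianglesP te); exists a, b, c.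
  exists [set a; b; c], [set a; b; d], a, b; split=> //.
  - apply: contraL (subset_leq_card sub) => /eqP E; rewrite C4 -ltnNge.
    rewrite finset.setUC (_ : d |: _ = [set a; b; c]); first by rewrite (card_triangle T).
    by apply/setP => u; rewrite finset.in_setU1; case: eqP => //= ->; rewrite E !finset.inE eqxx orbT.
  - by have /and3P[/(tour_neq te)] := C1.
  - by rewrite !finset.inE !eqxx !orbT.
have sub a b c d : {subset [:: x; y; z; w] <= [:: a; b; c; d]} -> set_of4 (x, y, z, w) \subset [set a; b; c; d].
  by move=> H; apply/fintype.subsetP => u; rewrite finset.inE => /H; rewrite !finset.inE ?inE !orbA.
have /and3P[_ nxz nyw] : [&& x != y, x != z & y != w].
  have : uniq [:: x; y; z; w] by apply/card_uniqP; rewrite -cardsE.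
  by rewrite /= !inE !negb_or => /and3P[/and3P[-> -> _] /andP[_ ->]].
case xz: (e x z); case yw: (e y w).
- apply: (nS w x z y); rewrite /cyclic3 ?wx ?xz ?zw ?yw ?xy; [by []|by []|].
  by apply: sub => u; rewrite !inE => /or4P[] ->; rewrite ?orbT.
- have wy : e w y by rewrite te.2 ?yw.
  apply: (nS z w x y); rewrite /cyclic3 ?wx ?xz ?zw ?yw ?xy ?yz ?wy; [by []|by []|].
  by apply: sub => u; rewrite !inE => /or4P[] ->; rewrite ?orbT.
- have zx : e z x by rewrite te.2 ?xz.
  apply: (nS x y z w); rewrite /cyclic3 ?wx ?zx ?zw ?yw ?xy ?yz; [by []|by []|].
  by apply: sub => u; rewrite !inE => /or4P[] ->; rewrite ?orbT.
- have wy : e w y by rewrite te.2 ?yw.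
  have zx : e z x by rewrite te.2 ?xz.
  apply: (nS y z x w); rewrite /cyclic3 ?wx ?zx ?zw ?yw ?xy ?yz ?wy; [by []|by []|].
  by apply: sub => u; rewrite !inE => /or4P[] ->; rewrite ?orbT.
Qed.

(* Without closed 4-walks, a 3-cycle is homogeneous, so its vertices are all the
   vertices of some score; conversely two vertices of equal score lie on a common
   3-cycle, so each level with two vertices accounts for at least one 3-cycle, and
   a closed 4-walk gives two 3-cycles sharing two vertices. *)
Lemma no_closed4P : (forall q, ~~ closed4 e q) <->
  #|triangles e| = (\sum_(d < #|V|) (#|level e d| == 3%N))%N.
Proof.
rewrite -card_set_sum; set K := [set d : 'I_#|V| | _].
have KP (d : 'I_#|V|) : d \in K -> exists u v, [/\ u != v, u \in level e d & v \in level e d].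
  rewrite finset.inE => /eqP/set3P[a [b [c [ab _ _ ->]]]].
  by exists a, b; rewrite !finset.inE !eqxx orbT.
split=> [no|E q].
  rewrite (_ : triangles e = (fun d : 'I_#|V| => level e d) @: K).
    rewrite card_in_imset // => d d' /KP[u [v [_ ud _]]] _ E; move: (ud).
    rewrite E; move: ud; rewrite !finset.inE => /eqP ud /eqP ud'; apply/val_inj.
    by rewrite /= -ud -ud'.
  apply/setP => S; apply/idP/imsetP => [ST|[d dK ->]].
    have /(trianglesP te)[a [b [c [C ES]]]] := ST.
    have aS : a \in S by rewrite ES !finset.inE eqxx.
    have L := @triangle_level _ _ te S _ no ST (ex_intro2 _ _ a aS erefl).
    by exists (Ordinal (out_lt a)) => //; rewrite finset.inE /= -L (card_triangle ST).
  have [u [v [uv]]] := KP d dK; rewrite !finset.inE => /eqP ud /eqP vd.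
  have [S1 [S1T uS vS]] := equal_out_triangle te uv (etrans ud (esym vd)).
  have := S1T; rewrite finset.inE.
  by rewrite (@triangle_level _ _ te S1 d no S1T (ex_intro2 _ _ u uS ud)).
apply/negP => C.
(* Each level of size three selects a 3-cycle with at least two vertices in it. Two such parts of a
   3-set meet, so the selection is injective; the equality of cardinals then makes it onto. *)
pose good d S := (S \in triangles e) && (1 < #|S :&: level e d|)%N.
pose phi (d : 'I_#|V|) := odflt finset.set0 [pick S | good d S].
have goodI (d0 : 'I_#|V|) (S : {set V}) u v : S \in triangles e -> u != v -> u \in S -> v \in S ->
    u \in level e d0 -> v \in level e d0 -> good d0 S.
  move=> ST uv uS vS ud vd; rewrite /good ST /=.
  apply: leq_trans (subset_leq_card (_ : [set u; v] \subset _)); first by rewrite cards2 uv.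
  by apply/fintype.subsetP => x /set2P[] ->; rewrite finset.in_setI ?uS ?vS.
have phiP d : d \in K -> good d (phi d).
  move=> dK; rewrite /phi; case: pickP => //= none.
  have [u [v [uv ud vd]]] := KP d dK.
  have [S [ST uS vS]] := equal_out_triangle te uv
     (etrans (eqP (etrans (esym (finset.in_set _ _)) ud)) (esym (eqP (etrans (esym (finset.in_set _ _)) vd)))).
  by have := none S; rewrite (goodI d S u v).
have good_inj (d d' : 'I_#|V|) S : good d S -> good d' S -> d = d'.
  move=> /andP[ST g] /andP[_ g'].
  have : (0 < #|(S :&: level e d) :&: (S :&: level e d')|)%N.
    have := cardsUI (S :&: level e d) (S :&: level e d').
    have : (#|(S :&: level e d) :|: (S :&: level e d')| <= 3)%N.
      rewrite -(card_triangle ST); apply: subset_leq_card.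
      by rewrite -finset.setIUr finset.subsetIl.
    by lia.
  rewrite card_gt0 => /set0Pn[u]; rewrite !finset.inE => /andP[/andP[_ /eqP ud] /andP[_ /eqP ud']].
  by apply/val_inj; rewrite /= -ud -ud'.
have phi_onto S : S \in triangles e -> exists2 d, d \in K & S = phi d.
  move=> ST; suff /eqP E' : phi @: K == triangles e.
    by move: ST; rewrite -E' => /imsetP.
  rewrite eqEcard E card_in_imset ?leqnn ?andbT.
    by apply/fintype.subsetP => _ /imsetP[d dK ->]; have /andP[] := phiP d dK.
  by move=> d d' dK dK' E'; apply: good_inj (phiP d dK) _; rewrite E'; exact: phiP.
have uniq d S : d \in K -> good d S -> S = phi d.
  move=> dK g; have /andP[ST _] := g; have [d' dK' E'] := phi_onto S ST.
  by rewrite E'; congr phi; apply: good_inj g; rewrite E'; exact: phiP.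
(* Any two vertices of the level lie on a 3-cycle that is good for [d], and this can only be
   [phi d]. *)
have phi_level d : d \in K -> phi d = level e d.
  move=> dK; have /andP[T _] := phiP d dK; apply/esym/eqP.
  have d3 : #|level e d| = 3%N by move: dK; rewrite finset.inE => /eqP.
  rewrite eqEcard (card_triangle T) d3 leqnn andbT.
  apply/fintype.subsetP => u ud.
  have /set0Pn[v] : level e d :\ u != finset.set0.
    by rewrite -card_gt0; move: d3; rewrite (cardsD1 u) ud; lia.
  rewrite finset.in_setD1 => /andP[vu vd].
  have [S [ST vS uS]] := equal_out_triangle te vu
     (etrans (eqP (etrans (esym (finset.in_set _ _)) vd)) (esym (eqP (etrans (esym (finset.in_set _ _)) ud)))).
  by rewrite -(uniq d S dK) //; apply: goodI vu _ _ _ _.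
have [S [S' [u [v [ST ST' SS' uv [uS vS uS' vS']]]]]] := closed4_triangles C.
have [d dK E1] := phi_onto S ST; have [d' dK' E2] := phi_onto S' ST'.
have dd' : d = d'.
  move: uS uS'; rewrite E1 E2 !phi_level // !finset.inE => /eqP ud /eqP ud'.
  by apply/val_inj; rewrite /= -ud -ud'.
by move/eqP: SS'; apply; rewrite E1 E2 dd'.
Qed.
End Strong.

(** * Avoiding a vertex that dominates a 3-cycle *)

Section Dominated.
Variables (V : finType) (e : rel V).
Hypothesis te : tour e.

Definition dominates_triangle v a b c := [&& e v a, e v b, e v c & cyclic3 e a b c].

Lemma dominated_triangleP : (0 < card_type e (true, false))%N <->
  exists v a b c, dominates_triangle v a b c.
Proof.
rewrite (_ : (true, false) = type4 [:: true; true; true; true; false; true]) //.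
rewrite (card_type_pattern te) //.
split=> [[v [a [b [c [[va vb vc] [ab ca bc]]]]]]|[v [a [b [c /and5P[va vb vc ab /andP[bc ca]]]]]]];
  exists v, a, b, c; last by [].
by apply/and5P; split=> //; apply/andP.
Qed.

Variable tau : nat.
Hypothesis attained : forall j, (j < tau)%N -> exists v, #|out e v| = j.
Hypothesis not_attained : forall v, #|out e v| != tau.

Definition low j : {set V} := [set v | (#|out e v| < j)%N].

(** By induction, if [low j] has j vertices and is dominated by all others, a vertex of score j
    beats exactly [low j]. Two such vertices would have no arc between them, so there is just one,
    and it extends the tail. *)
Lemma low_dominated j : (j <= tau)%N ->
  #|low j| = j /\ forall v x, v \in low j -> x \notin low j -> e x v.
Proof.
elim: j => [|j IH] jt.
  have -> : low 0 = finset.set0 by apply/setP => v; rewrite !finset.inE.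
  by rewrite cards0; split=> // v x; rewrite finset.inE.
have [cj dj] := IH (ltnW jt).
have outj v : #|out e v| = j -> out e v = low j.
  move=> vj; apply/eqP; rewrite eq_sym eqEcard cj vj leqnn andbT.
  apply/fintype.subsetP => x xj; rewrite finset.inE; apply: dj => //.
  by rewrite finset.inE vj ltnn.
have [t tj] := attained jt.
have lowS : low j.+1 = t |: low j.
  apply/setP => v; rewrite !finset.inE ltnS leq_eqVlt; congr orb.
  apply/eqP/eqP => [vj|->//]; apply/eqP/negPn/negP => ne.
  have : ~~ e v t && ~~ e t v.
    have nin u : #|out e u| = j -> u \notin low j by move=> uj; rewrite finset.inE uj ltnn.
    by have := nin v vj; have := nin t tj; rewrite -{1}(outj v vj) -(outj t tj) !finset.inE => -> ->.
  by rewrite (te.2 _ _ ne); case: (e v t).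
rewrite lowS finset.cardsU1 cj finset.inE tj ltnn; split=> // v x.
rewrite !finset.in_setU1 negb_or => /orP[/eqP ->|vj] /andP[xt xj]; last exact: dj.
rewrite te.2 1?eq_sym //; apply: contra xj; rewrite -(outj t tj) finset.inE //.
Qed.

Lemma low_out v : (#|out e v| < tau)%N -> out e v = low #|out e v|.
Proof.
move=> lt; have [c d] := low_dominated (ltnW lt).
apply/eqP; rewrite eq_sym eqEcard c leqnn andbT.
apply/fintype.subsetP => x xj; rewrite finset.inE; apply: d => //.
by rewrite finset.inE ltnn.
Qed.

Lemma low_lt v x : (#|out e v| < tau)%N -> e v x -> (#|out e x| < #|out e v|)%N.
Proof.
by move=> lt vx; have vo : x \in out e v by [rewrite finset.inE]; move: vo; rewrite {1}(low_out lt) finset.inE.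
Qed.

(** Along a 3-cycle that meets the tail the scores would decrease strictly. *)
Lemma low_acyclic a b c : (#|out e a| < tau)%N -> ~~ cyclic3 e a b c.
Proof.
move=> lt; apply/negP => /and3P[ab bc ca].
have l1 := low_lt lt ab; have l2 := low_lt (ltn_trans l1 lt) bc.
have l3 := low_lt (ltn_trans l2 (ltn_trans l1 lt)) ca; lia.
Qed.

Definition high : {set V} := [set v | (tau < #|out e v|)%N].

Lemma not_high v : v \notin high -> (#|out e v| < tau)%N.
Proof. by rewrite finset.inE -leqNgt leq_eqVlt (negbTE (not_attained v)). Qed.

Lemma card_high : #|high| = (#|V| - tau)%N.
Proof.
have [c _] := low_dominated (leqnn tau).
have <- : ~: low tau = high.
  apply/setP => v; rewrite !finset.inE -leqNgt leq_eqVlt eq_sym.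
  by rewrite (negbTE (not_attained v)).
by have := cardsC (low tau); rewrite c; lia.
Qed.

Lemma not_dominated_low : high = finset.set0 -> card_type e (true, false) = 0%N.
Proof.
move=> H0; apply/eqP; rewrite -leqn0 leqNgt; apply/negP => /dominated_triangleP.
move=> [v [a [b [c /and4P[_ _ _ C]]]]].
by have := @low_acyclic a b c (not_high _); rewrite C H0 finset.inE => /(_ isT).
Qed.

Variable s : V -> V.
Hypothesis s_out : forall v, v \in high -> e v (s v).

Definition source_fun := forall v u, v \in high -> e v u -> u != s v -> e (s v) u.

(** A remaining [x] has more than [tau] out-neighbours, hence one, [y], outside the tail of [tau]
    vertices. If [s x] were in the tail, its arc to [y] would force [y] into the tail as well. *)
Lemma iter_high v j : source_fun -> v \in high -> iter j s v \in high.
Proof.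
move=> src vH; elim: j => //= j; set x := iter j s v => xH.
apply/negPn/negP => /not_high lt.
have [y yH xy] : exists2 y, y \in high & e x y.
  apply/exists_inP; rewrite -[[exists _ in _, _]]negbK negb_exists_in; apply/negP => /forall_inP no.
  have : (#|out e x| <= #|low tau|)%N.
    apply: subset_leq_card; apply/fintype.subsetP => y; rewrite finset.inE => xy.
    rewrite finset.inE; apply: not_high; apply/negP => /no; by rewrite xy.
  rewrite (low_dominated (leqnn tau)).1 leqNgt; move: xH.
  by rewrite finset.inE => ->.
have : e (s x) y.
  by apply: src => //; apply: contraTneq yH => ->; rewrite finset.inE -leqNgt ltnW.
move/(low_lt lt) => lt2; move: yH; rewrite finset.inE => yH; lia.
Qed.

Section Orbit.
Variables (v0 : V) (m : nat).
Hypotheses (v0H : v0 \in high) (src : source_fun) (mE : #|high| = m).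
Hypotheses (ret : iter m s v0 = v0).
Hypotheses (first_ret : forall j, (0 < j < m)%N -> iter j s v0 <> v0).

Lemma orbit_high v : v \in high -> exists2 j, (j < m)%N & v = iter j s v0.
Proof.
pose f (j : 'I_m) := iter j s v0.
have inj_aux i j : (i < j)%N -> (j < m)%N -> iter i s v0 <> iter j s v0.
  move=> ij jm E; apply: (first_ret (j := (m - j + i)%N)); first by lia.
  by rewrite iterD E -iterD subnK // ltnW.
have injf : injective f.
  move=> i j E; apply/val_inj; case: (ltngtP i j) => //= lt.
    by case: (inj_aux i j lt (ltn_ord j)).
  by case: (inj_aux j i lt (ltn_ord i)).
have E : f @: [set: 'I_m] = high.
  apply/eqP; rewrite eqEcard card_imset // cardsT card_ord mE leqnn andbT.
  by apply/fintype.subsetP => _ /imsetP[j _ ->]; exact: iter_high.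
by rewrite -E => /imsetP[j _ ->]; exists (val j); rewrite ?ltn_ord.
Qed.

(* If [v] dominates a 3-cycle then so does [s v], hence so does every vertex of the
   orbit, including those of the 3-cycle itself. *)
Lemma orbit_not_dominated : card_type e (true, false) = 0%N.
Proof.
apply/eqP; rewrite -leqn0 leqNgt; apply/negP => /dominated_triangleP.
move=> [v [a [b [c D]]]].
have hi x y z : cyclic3 e x y z -> x \in high.
  by move=> C; apply/negPn/negP => /not_high /low_acyclic /negP; apply; exact: C.
have dom_s x : x \in high -> dominates_triangle x a b c -> dominates_triangle (s x) a b c.
  move=> xH /and4P[xa xb xc C]; have /and3P[ab bc ca] := C.
  have ns p q : e x p -> e x q -> e p q -> q != s x.
    move=> xp xq pq; apply/eqP => E; have := src xH xp; rewrite -E (tour_neq te pq).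
    by rewrite (tour_asym te pq) => /(_ isT).
  by apply/and4P; split=> //; apply: src => //; [exact: ns ca|exact: ns ab|exact: ns bc].
have /and4P[va _ _ C] := D.
have aH := hi _ _ _ C.
have vH : v \in high.
  apply/negPn/negP => /not_high lt; have := low_lt lt va.
  move: aH; rewrite finset.inE => aH; lia.
have [i im vE] := orbit_high vH; have [j jm aE] := orbit_high aH.
have dom k : dominates_triangle (iter k s v) a b c.
  by elim: k => //= k IH; apply: dom_s => //; exact: iter_high.
have /and4P[] := dom (j + (m - i))%N.
by rewrite iterD {1}vE -[iter (m - i) _ _]iterD subnK ?(ltnW im) // ret -aE te.1.
Qed.
End Orbit.

(** Takes a vertex with most out-neighbours in [N]. If [y] beat it, then for lack of 3-cycles [y]
    would beat all those out-neighbours too and have one more. *)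
Lemma acyclic_source (N : {set V}) : N != finset.set0 ->
  (forall a b c, a \in N -> b \in N -> c \in N -> ~~ cyclic3 e a b c) ->
  exists x, source_in e N x.
Proof.
move=> /set0Pn[x0 x0N] no.
case: (arg_maxnP (fun x => #|out e x :&: N|) x0N) => x xN max.
exists x; apply/andP; split=> //; apply/forall_inP => y yN; apply/implyP => ne.
rewrite te.2 //; apply/negP => yx; have /= := max y yN; apply/negP; rewrite -ltnNge.
apply: proper_card; apply/properP; split; last first.
  by exists x; rewrite !finset.inE ?te.1 // yx.
apply/fintype.subsetP => z; rewrite !finset.inE => /andP[xz zN]; rewrite zN andbT.
rewrite te.2; first by apply: contra (no y x z yN xN zN) => zy; rewrite /cyclic3 yx xz zy.
by apply: contraTneq xz => ->; rewrite (tour_asym te yx).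
Qed.

Hypothesis s_source : forall v y, v \in high -> source_in e (out e v) y -> y = s v.
Hypothesis free : card_type e (true, false) = 0%N.

Lemma free_acyclic v a b c : a \in out e v -> b \in out e v -> c \in out e v ->
  ~~ cyclic3 e a b c.
Proof.
rewrite !finset.inE => va vb vc; apply/negP => C.
have : (0 < card_type e (true, false))%N by apply/dominated_triangleP; exists v, a, b, c; apply/and4P.
by rewrite free.
Qed.

Lemma free_source : source_fun.
Proof.
move=> v u vH vu ne.
have [y sy] : exists y, source_in e (out e v) y.
  by apply: acyclic_source; [apply/set0Pn; exists u; rewrite finset.inE | exact: free_acyclic].
have /andP[_ /forall_inP H] := sy; have := H u; rewrite finset.inE => /(_ vu).
by rewrite (s_source vH sy) ne.
Qed.

(** An arc from one vertex of the cycle to [y] is inherited by the next one, the source of its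
    out-neighbourhood, and so goes all around. Otherwise [y] beats the whole cycle, which then
    contains no 3-cycle and has a source; yet each of its vertices is beaten by its predecessor. *)
Lemma cycle_dominates x p y : x \in high -> (0 < p)%N -> iter p s x = x ->
  (forall j, y <> iter j s x) -> forall j, e (iter j s x) y.
Proof.
move=> xH p0 per ny j.
have xHi i := @iter_high x i free_source xH.
have step i k : e (iter i s x) y -> e (iter (k + i) s x) y.
  move=> H; elim: k => //= k IH; apply: free_source => //; apply/eqP => E.
  exact: (ny (k + i).+1).
have perM q i : iter (q * p + i) s x = iter i s x.
  by elim: q => // q IH; rewrite (_ : q.+1 * p + i = (q * p + i) + p)%N; [rewrite iterD per | lia].
have all i k : e (iter i s x) y -> e (iter k s x) y.
  move=> H; rewrite -(perM i k) (_ : i * p + k = (i * p + k - i) + i)%N; last by nia.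
  exact: step.
suff [i Hi] : exists i, e (iter i s x) y by exact: all Hi.
apply: contrapT => no.
have yi i : e y (iter i s x).
  rewrite te.2; first by apply/negP => H; apply: no; exists i.
  by apply/eqP => E; exact: (ny i).
pose K := [set iter (val j) s x | j : 'I_p].
have KP i : iter i s x \in K.
  apply/imsetP; exists (Ordinal (ltn_pmod i p0)) => //=.
  by rewrite {1}(divn_eq i p) perM.
have [z /andP[/imsetP[k _ zE] /forall_inP src]] : exists z, source_in e K z.
  apply: acyclic_source; first by apply/set0Pn; exists x; exact: (KP 0%N).
  move=> a b c /imsetP[ja _ ->] /imsetP[jb _ ->] /imsetP[jc _ ->].
  by apply: (@free_acyclic y); rewrite finset.inE.
pose w := iter (p.-1 + k) s x.
have wz : e w z.
  rewrite zE (_ : iter k s x = s w); first by apply: s_out; exact: xHi.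
  by rewrite /w -iterS (_ : (p.-1 + k).+1 = 1 * p + k)%N ?perM //; lia.
have := src w (KP _); rewrite (tour_neq te wz).
by rewrite (tour_asym te wz).
Qed.

Lemma eventually_periodic y : exists i p, (0 < p)%N /\ iter p s (iter i s y) = iter i s y.
Proof.
have : ~~ injectiveb (fun j : 'I_#|V|.+1 => iter j s y).
  by apply/negP => /injectiveP /leq_card; rewrite card_ord ltnn.
move=> /injectivePn[i [j ne E]].
wlog lt : i j ne E / (i < j)%N.
  move=> H; case: (ltngtP i j) => [|ji|/val_inj Eij]; first exact: H.
    by apply: (H j i) => //; rewrite eq_sym.
  by rewrite Eij eqxx in ne.
exists (val i), (j - i)%N; rewrite subn_gt0; split=> //.
by rewrite -iterD subnK ?(ltnW lt).
Qed.

(** If [y] were off the cycle of [x], this cycle would dominate the whole orbit of [y]. That orbit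
    ends in a cycle which misses [x] and so, by [cycle_dominates] again, dominates [x], contrary to
    the direction of those arcs. *)
Lemma cycle_full x p y : x \in high -> (0 < p)%N -> iter p s x = x -> y \in high ->
  exists j, y = iter j s x.
Proof.
move=> xH p0 per yH; apply: contrapT => /forallNP ny.
have dom := cycle_dominates xH p0 per ny.
have hi i := @iter_high y i free_source yH.
have out_x i j : iter i s y <> iter j s x /\ e (iter j s x) (iter i s y).
  elim: i j => [|i IH] j; first by split; [exact: ny | exact: dom].
  have ny' k : iter i.+1 s y <> iter k s x.
    move=> E; have := s_out (hi i); rewrite -iterS E.
    by rewrite (tour_asym te) // (IH k).2.
  by split; [exact: ny' | exact: cycle_dominates xH p0 per ny' j].
have [i [q [q0 per']]] := eventually_periodic y.
have nx j : x <> iter j s (iter i s y).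
  by rewrite -iterD => E; have [] := out_x (j + i)%N 0%N; rewrite -E.
have := cycle_dominates (hi i) q0 per' nx 0%N.
by rewrite /= (tour_asym te (out_x i 0%N).2).
Qed.

(** By [cycle_full] all remaining vertices lie on one cycle of [s], so its least period is their
    number. *)
Lemma free_orbit v0 : v0 \in high ->
  iter #|high| s v0 = v0 /\ (forall j, (0 < j < #|high|)%N -> iter j s v0 <> v0).
Proof.
move=> v0H; have [i [q [q0 per]]] := eventually_periodic v0.
have [k v0E] := cycle_full (@iter_high v0 i free_source v0H) q0 per v0H.
have per0 : iter q s v0 = v0.
  by rewrite {1}v0E -iterD addnC iterD per -v0E.
have ex : exists p, (0 < p)%N && (iter p s v0 == v0) by exists q; rewrite q0 per0 eqxx.
case: (ex_minnP ex) => p /andP[p0 /eqP pE] min.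
have first_ret j : (0 < j < p)%N -> iter j s v0 <> v0.
  move=> /andP[j0 jp] E; have := min j; rewrite j0 E eqxx => /(_ isT); lia.
have cH : #|high| = p; last by rewrite cH.
have injf : injective (fun j : 'I_p => iter j s v0).
  have aux a b : (a < b)%N -> (b < p)%N -> iter a s v0 <> iter b s v0.
    move=> ab bp E; apply: (first_ret (p - b + a)%N); first by lia.
    by rewrite iterD E -iterD subnK // ltnW.
  move=> a b E; apply/val_inj; case: (ltngtP a b) => //= lt.
    by case: (aux a b lt (ltn_ord b)).
  by case: (aux b a lt (ltn_ord a)).
rewrite -[p]card_ord -cardsT -(card_imset _ injf); apply: eq_card => y.
apply/idP/imsetP => [yH|[j _ ->]]; last exact: iter_high free_source v0H.
have [j ->] := cycle_full v0H p0 pE yH.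
exists (Ordinal (ltn_pmod j p0)) => //=.
rewrite {1}(divn_eq j p) addnC iterD; congr iter.
by elim: (j %/ p)%N => // t IH; rewrite mulSn iterD IH.
Qed.

End Dominated.

(** * Detection programs *)

Notation "a '+ b" := (Bin OpAdd a b) (at level 50, left associativity).
Notation "a '- b" := (Bin OpSub a b) (at level 50, left associativity).
Notation "a '* b" := (Bin OpMul a b) (at level 40, left associativity).
Notation "a '/ b" := (Bin OpDiv a b) (at level 40, left associativity).
Notation "x <-- e" := (Set_ x e) (at level 60).
Notation "c1 ;; c2" := (Seq c1 c2) (at level 65, right associativity).
Notation "'$' x" := (Var x) (at level 5, format "'$' x").
Notation "'#' z" := (Cst z) (at level 5, format "'#' z").

Definition IfEq e1 e2 c1 c2 := IfLe e1 e2 (IfLe e2 e1 c1 c2) c2.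

Lemma trip_ifeq B inp e1 e2 c1 c2 s T1 T2 Q : eok B inp e1 s -> eok B inp e2 s ->
  (ev inp e1 s = ev inp e2 s -> trip B inp c1 s T1 Q) ->
  (ev inp e2 s <> ev inp e1 s -> trip B inp c2 s T2 Q) ->
  trip B inp (IfEq e1 e2 c1 c2) s (2 * (esize e1 + esize e2) + maxn T1 T2 + 4) Q.
Proof.
move=> ok1 ok2 H1 H2; apply: trip_weaken.
- apply: trip_if => // [le12|lt21]; last by apply: H2; lia.
  by apply: trip_if => // [le21|lt12]; [apply: H1 | apply: H2]; lia.
- lia.
- by [].
Qed.

(** The flag [rev] exchanges the ends of the arc that is read, so the same code treats the converse
    tournament. Variable 0 must still hold n, the row length. *)
Definition arc_expr (rev : bool) (u v : nat) : expr :=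
  if rev then Inp ($v '* $0 '+ $u) else Inp ($u '* $0 '+ $v).

Definition rel_of (a : nat -> nat -> bool) (rev : bool) u v := if rev then a v u else a u v.

(* Memory layout of the detection programs: variable 0 holds n, then the answer;
   array 0 holds the scores, array 1 the number of vertices of each score, array 2
   the sources s(v).  In [dominated_cmd], variable 4 holds the least missing score,
   5 the verdict that no copy exists, 6 a start vertex and 11 its iterates. *)
Definition degrees_cmd rev : cmd :=
  For 1 $0
   (3 <-- #0 ;;
    For 2 $0 (3 <-- $3 '+ arc_expr rev 1 2) ;;
    Store 0 $1 $3).

Definition histogram_cmd : cmd :=
  For 1 $0 (Store 1 (Arr 0 $1) (Arr 1 (Arr 0 $1) '+ #1)).

Section Programs.
Variables (B n : nat) (inp : int -> int) (a : nat -> nat -> bool) (rev : bool).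
Hypothesis B_ge : (16 * (n + 2) ^ 4 <= B)%N.
Hypothesis inpE : forall u v, (u < n)%N -> (v < n)%N ->
  inp (u%:Z * n%:Z + v%:Z) = a u v.
Local Notation r := (rel_of a rev).

(** The factor 16 in the word bound pays for array addresses, the fourth power for quantities of the
    size of the number of quadruples of vertices. *)
Lemma linear_fits : (16 * n + 32 <= B)%N.
Proof. apply: leq_trans B_ge; rewrite !expnS expn0; nia. Qed.
Lemma square_fits : (n * n <= B)%N.
Proof. apply: leq_trans B_ge; rewrite !expnS expn0; nia. Qed.
Lemma cube_fits : (16 * (n * n * n) <= B)%N.
Proof. apply: leq_trans B_ge; rewrite !expnS expn0; nia. Qed.
Lemma fourth_power_fits : (16 * (n * n * n * n) <= B)%N.
Proof.
apply: leq_trans B_ge; rewrite leq_mul2l /= (_ : n * n * n * n = n ^ 4)%N.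
  by rewrite leq_exp2r // leq_addr.
by rewrite !expnS expn0 muln1 !mulnA.
Qed.

Lemma index_lt u v : (u < n)%N -> (v < n)%N -> (u * n + v < n * n)%N.
Proof. nia. Qed.

Lemma eok_arc u v s i j : (i < n)%N -> (j < n)%N -> var s 0 = n%:Z ->
  var s u = i%:Z -> var s v = j%:Z -> eok B inp (arc_expr rev u v) s.
Proof.
move=> Hi Hj s0 su sv; have := square_fits; have := index_lt Hi Hj; have := index_lt Hj Hi.
by case: rev; rewrite /= s0 su sv /small /=; repeat split; lia.
Qed.

Lemma ev_arc u v s i j : (i < n)%N -> (j < n)%N -> var s 0 = n%:Z ->
  var s u = i%:Z -> var s v = j%:Z -> ev inp (arc_expr rev u v) s = r i j.
Proof.
by move=> Hi Hj s0 su sv; rewrite /rel_of; case: rev; rewrite /= s0 su sv inpE.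
Qed.

Definition degree v := (\sum_(u < n) r v u)%N.

Lemma sum_bool_le (P : nat -> bool) k : (\sum_(u < k) P u <= k)%N.
Proof.
by rewrite -[X in (_ <= X)%N]card_ord -sum1_card leq_sum // => i _; case: (P i).
Qed.

Lemma degree_le v : (degree v <= n)%N.
Proof. exact: sum_bool_le. Qed.

Lemma degrees_spec s : var s 0 = n%:Z ->
   trip B inp (degrees_cmd rev) s (100 * n.+1 ^ 2)
     (fun s' => forall v, (v < n)%N -> arr s' 0 v = (degree v)%:Z).
Proof.
have HB := linear_fits.
move=> s0; apply: trip_weaken.
- apply: (@trip_for _ _ _ _ _ _ _ n (fun k s' => forall v, (v < k)%N -> arr s' 0 v = (degree v)%:Z)) => //=.
  move=> v s1 vn I1 K1.
  have s10 := K1.1 0 isT; rewrite s0 in s10.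
  apply: trip_seq; apply: trip_set => //=.
  apply: trip_seq; apply: trip_weaken.
  + apply: (@trip_for _ _ _ _ _ _ _ n (fun k s' => var s' 3 = (\sum_(u < k) r v u)%N)) => //=.
      by rewrite big_ord0.
    move=> u s2 un I2 K2.
    have /= s20 := K2.1 0 isT; rewrite s10 in s20.
    have /= s21 := K2.1 1 isT.
    have E : ev inp (arc_expr rev 1 2) (setv s2 2 u%:Z) = r v u by apply: ev_arc.
    have le := sum_bool_le (r v) u.
    apply: trip_set => /=; last by rewrite E I2 big_ord_recr.
    split=> //; first exact: (@eok_arc _ _ _ v u).
    rewrite E I2 /small; move: (\sum_(_ < u) _)%N le => S le. case: (r v u) => /=; lia.
  + exact: leqnn.
  + move=> s2 K2 I2; apply: trip_store => //=.
      have /= s21 := K2.1 1 isT; rewrite s21 /small; split=> //; lia.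
    move=> w wv; have /= s21 := K2.1 1 isT; rewrite I2 s21 /=.
    case: eqP => [-> //|ne].
    by have /= -> := K2.2 0 w isT; apply: I1; lia.
- have E : esize (arc_expr rev 1 2) = 9%N by rewrite /arc_expr; case: rev.
  by rewrite /= E !expnS expn0; nia.
- by [].
Qed.

Lemma histogram_spec s : var s 0 = n%:Z -> (forall i, arr s 1 i = 0) ->
  (forall v, (v < n)%N -> arr s 0 v = (degree v)%:Z) ->
   trip B inp histogram_cmd s (100 * n.+1)
     (fun s' => forall j, arr s' 1 j = (\sum_(v < n) (degree v == j))%N).
Proof.
have HB := linear_fits.
move=> s0 h0 d0; apply: trip_weaken.
- apply: (@trip_for _ _ _ _ _ _ _ n (fun k s' => forall j, arr s' 1 j = (\sum_(v < k) (degree v == j))%N)) => //=.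
    by move=> j; rewrite h0 big_ord0.
  move=> v s1 vn I1 K1.
  have s10 := K1.1 0 isT; rewrite s0 in s10.
  have s1v := K1.2 0 v isT; rewrite d0 // in s1v.
  have le := degree_le v.
  have le' : forall j, (\sum_(u < v) (degree u == j) <= v)%N.
    by move=> j; apply: (sum_bool_le (fun u => degree u == j)).
  apply: trip_store => /=.
  + by rewrite s1v /small; repeat split=> //; lia.
  + rewrite s1v I1 /small /=; have := le' (degree v); move: (\sum_(_ < _) _)%N => S leS.
    by repeat split=> //; lia.
  + move=> j; rewrite s1v big_ord_recr /=.
    case: (eqVneq j (degree v)) => [->|ne]; first by rewrite I1 PoszD.
    by rewrite addn0 I1.
- by rewrite /=; lia.
- by [].
Qed.
End Programs.

(** The programs compute falling factorials; over the integers these identities hold for small [d]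
    too. *)
Lemma bin2E d : d%:Z * (d%:Z - 1) = 2 * 'C(d, 2)%:Z.
Proof. by elim: d => // d IH; rewrite binS bin1; lia. Qed.

Lemma bin3E d : d%:Z * (d%:Z - 1) * (d%:Z - 2) = 6 * 'C(d, 3)%:Z.
Proof. by elim: d => // d IH; rewrite binS; have := bin2E d; nia. Qed.

Lemma bin4E d : d%:Z * (d%:Z - 1) * (d%:Z - 2) * (d%:Z - 3) = 24 * 'C(d, 4)%:Z.
Proof. by elim: d => // d IH; rewrite binS; have := bin3E d; nia. Qed.

Lemma sum_le_const (F : nat -> nat) k M : (forall u, F u <= M)%N ->
  (\sum_(u < k) F u <= k * M)%N.
Proof. by move=> H; rewrite -[X in (X * M)%N]card_ord -sum_nat_const leq_sum. Qed.

(** The number tested is six times the difference between the number of 3-cycles and the number of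
    scores attained three times, as n(n-1)(n-2) = 6 C(n,3) and the sum of d(d-1) is twice the sum of
    C(d,2). *)
Definition strong_tail_cmd : cmd :=
  4 <-- #0 ;;
  For 1 $0 (IfEq (Arr 1 $1) #3 (4 <-- $4 '+ #1) Skip) ;;
  5 <-- #0 ;;
  For 1 $0 (5 <-- $5 '+ Arr 0 $1 '* (Arr 0 $1 '- #1)) ;;
  6 <-- $0 '* ($0 '- #1) '* ($0 '- #2) '- #3 '* $5 '- #6 '* $4 ;;
  IfEq $6 #0 (0 <-- #0) (0 <-- #1).

Definition strong_cmd : cmd := degrees_cmd false ;; histogram_cmd ;; strong_tail_cmd.

(** The quadruple loop is entered only for n < 8, so this program takes bounded time. *)
Definition transitive_cmd : cmd :=
  4 <-- #0 ;;
  IfLe #8 $0 (0 <-- #1)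
   (For 1 $0 (For 2 $0 (For 3 $0 (For 5 $0
     (IfLe #1 (arc_expr false 1 2 '* arc_expr false 1 3 '* arc_expr false 1 5 '*
          arc_expr false 2 3 '* arc_expr false 2 5 '* arc_expr false 3 5)
        (4 <-- #1) Skip)))) ;;
    0 <-- $4).

Section Programs.
Variables (B n : nat) (inp : int -> int) (a : nat -> nat -> bool).
Hypothesis B_ge : (16 * (n + 2) ^ 4 <= B)%N.
Hypothesis inpE : forall u v, (u < n)%N -> (v < n)%N ->
  inp (u%:Z * n%:Z + v%:Z) = a u v.
Local Notation degree := (degree n a).

Lemma strong_spec s : var s 0 = n%:Z -> (forall i, arr s 1 i = 0) ->
   trip B inp strong_cmd s (600 * n.+1 ^ 2)
     (fun s' => var s' 0 = Posz (n%:Z * (n%:Z - 1) * (n%:Z - 2)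
        - 3 * (\sum_(v < n) 2 * 'C(degree false v, 2))%N%:Z
        - 6 * (\sum_(d < n) ((\sum_(v < n) (degree false v == d)) == 3))%N%:Z != 0)).
Proof.
have [HB1 HB2 HB3 HB4] := And4 (linear_fits B_ge) (square_fits B_ge) (cube_fits B_ge) (fourth_power_fits B_ge).
move=> s0 h0; apply: trip_le.
- apply: trip_seq; apply: trip_weaken; first exact: (degrees_spec B_ge inpE).
    exact: leqnn.
  move=> s1 K1 D1; have s10 := K1.1 0 isT; rewrite s0 in s10.
  apply: trip_seq; apply: trip_weaken.
    apply: (histogram_spec B_ge s10 _ D1) => i.
    by rewrite (K1.2 1 i isT).
    exact: leqnn.
  move=> s2 K2 H2; have s20 := K2.1 0 isT; rewrite s10 in s20.
  have {}D1 v : (v < n)%N -> arr s2 0 v = (degree false v)%:Z by move=> vn; rewrite (K2.2 0 v isT) D1.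
  apply: trip_seq; apply: trip_set => //=.
  apply: trip_seq; apply: trip_weaken.
    apply: (@trip_for _ _ _ _ _ _ _ n (fun k s' => var s' 4 = (\sum_(d < k) ((\sum_(v < n) (degree false v == d)) == 3))%N)) => //=; first by rewrite big_ord0.
    move=> d s3 dn I3 K3; have /= s31 := K3.2 1 d isT; rewrite H2 in s31.
    have le := sum_bool_le (fun d => (\sum_(v < n) (degree false v == d) == 3)%N) d.
    have le' := sum_bool_le (fun v => degree false v == d) n.
    apply: trip_ifeq => /=.
    + by rewrite /small; split=> //; lia.
    + by rewrite /small; lia.
    + rewrite s31 => E; apply: trip_set => /=.
        rewrite I3 /small; move: (\sum_(_ < d) _)%N le => S leS; split=> //; lia.
      rewrite big_ord_recr /= I3.
      by have -> : (\sum_(v < n) (degree false v == d) = 3)%N by case: E.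
    + rewrite s31 => E; apply: trip_skip; rewrite big_ord_recr /= I3.
      by case: eqP => [E'|]; rewrite ?addn0 //; case: E; rewrite E'.
    exact: leqnn.
  move=> s3 K3 I3; have s30 := K3.1 0 isT; rewrite /= s20 in s30.
  apply: trip_seq; apply: trip_set => //=.
  apply: trip_seq; apply: trip_weaken.
    apply: (@trip_for _ _ _ _ _ _ _ n (fun k s' => var s' 5 = (\sum_(v < k) 2 * 'C(degree false v, 2))%N)) => //=; first by rewrite big_ord0.
    move=> v s4 vn I4 K4; have /= s40 := K4.2 0 v isT; rewrite (K3.2 0 v isT) /= D1 // in s40.
    have le : (\sum_(u < v) 2 * 'C(degree false u, 2) <= v * (n * n))%N.
      apply: (@sum_le_const (fun u => 2 * 'C(degree false u, 2))%N) => u.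
      have := bin2E (degree false u); have := degree_le n a false u; nia.
    have := bin2E (degree false v); have := degree_le n a false v => le1 le2.
    apply: trip_set => /=; rewrite s40.
      move: I4 le; move: (\sum_(_ < v) _)%N => S -> le.
      by rewrite /small; repeat split=> //; nia.
    by rewrite big_ord_recr /= I4 le2; lia.
    exact: leqnn.
  move=> s4 K4 I4; have s40 := K4.1 0 isT; rewrite /= s30 in s40.
  have s44 := K4.1 4 isT; rewrite /= I3 in s44.
  have le4 := sum_bool_le (fun d => (\sum_(v < n) (degree false v == d) == 3)%N) n.
  have le5 : (\sum_(u < n) 2 * 'C(degree false u, 2) <= n * (n * n))%N.
    apply: (@sum_le_const (fun u => 2 * 'C(degree false u, 2))%N) => u.
    have := bin2E (degree false u); have := degree_le n a false u; nia.
  apply: trip_seq; apply: trip_set.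
    rewrite /= s40 s44 I4; move: (\sum_(_ < n) _)%N (\sum_(_ < n) _)%N le4 le5 => S S' le4 le5.
    have b3 : (n * (n - 1) * (n - 2) <= n * n * n)%N by rewrite !leq_mul // leq_subr.
    have b2 : (n * (n - 1) <= n * n)%N by rewrite !leq_mul // leq_subr.
    have E1 : n%:Z * (n%:Z - 1) = (n * (n - 1))%N by case: (n) => // k; lia.
    have E2 : n%:Z * (n%:Z - 1) * (n%:Z - 2) = (n * (n - 1) * (n - 2))%N.
      by rewrite E1; case: (n) => // -[|k] //; lia.
    rewrite E2 E1 /small; move: (n * (n - 1) * (n - 2))%N (n * (n - 1))%N b3 b2 => P3 P2 b3 b2.
    by repeat split=> //; lia.
  apply: trip_ifeq => //=; try by rewrite /small; lia.
  + rewrite s40 s44 I4 => E; apply: trip_set => //=.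
    by rewrite E eqxx.
  + rewrite s40 s44 I4 => E; apply: trip_set => /=; first by rewrite /small; lia.
    by case: eqP => // E'; case: E.
- by rewrite /= !expnS expn0; nia.
Qed.
End Programs.

Section Programs.
Variables (B n : nat) (inp : int -> int) (a : nat -> nat -> bool).
Hypothesis B_ge : (16 * (n + 2) ^ 4 <= B)%N.
Hypothesis inpE : forall u v, (u < n)%N -> (v < n)%N ->
  inp (u%:Z * n%:Z + v%:Z) = a u v.

Lemma trip_search acc x e c s T N (P : nat -> bool) (b : bool) :
  eok B inp e s -> ev inp e s = N%:Z -> var s acc = b ->
  (forall k s' (b' : bool), (k < N)%N -> keeps (For x e c) s s' -> var s' acc = b' ->
     trip B inp c (setv s' x k%:Z) T (fun s'' => var s'' acc = b' || P k)) ->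
  trip B inp (For x e c) s (esize e + 4 + N * (T + 6))
    (fun s' => var s' acc = b || has P (iota 0 N)).
Proof.
move=> ok eE sb H.
apply: (@trip_for _ _ _ _ _ _ _ N (fun k s' => var s' acc = b || has P (iota 0 k))) => //.
  by rewrite /= orbF.
move=> k s' kN I K; apply: trip_le; last exact: leqnn.
apply: trip_weaken; first exact: H K I.
  exact: leqnn.
have E : has P (iota 0 k.+1) = has P (iota 0 k) || P k by rewrite -addn1 iotaD has_cat /= orbF.
by move=> s'' _ E1; cbv beta; rewrite E1 E orbA.
Qed.

Definition transitive4 w x y z := [&& a w x, a w y, a w z, a x y, a x z & a y z].

Lemma transitive_spec s : var s 0 = n%:Z ->
   trip B inp transitive_cmd s (1000 * 9 ^ 4)
     (fun s' => var s' 0 = (8 <= n)%N ||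
        has (fun w => has (fun x => has (fun y => has (fun z => transitive4 w x y z)
          (iota 0 n)) (iota 0 n)) (iota 0 n)) (iota 0 n)).
Proof.
have [HB1 HB2 HB3 HB4] := And4 (linear_fits B_ge) (square_fits B_ge) (cube_fits B_ge) (fourth_power_fits B_ge).
have small1 : small B 1 by rewrite /small; lia.
move=> s0; apply: trip_le.
- apply: trip_seq; apply: trip_set => //=.
  apply: (@trip_if _ _ _ _ _ _ _ 3 (900 * 9 ^ 4)) => /=.
  + by rewrite /small; lia.
  + by [].
  + rewrite s0 => le; apply: trip_set => /=; first by rewrite /small; lia.
    by rewrite (_ : (8 <= n)%N).
  rewrite s0 => lt; have {}lt : (n < 8)%N by lia.
  have -> : (8 <= n)%N = false by lia.
  apply: trip_le.
  apply: trip_seq; apply: trip_weaken.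
    apply: (@trip_search 4 _ _ _ _ (900 * 9 ^ 3 + 100) n (fun w => has (fun x => has (fun y => has (fun z => transitive4 w x y z) (iota 0 n)) (iota 0 n)) (iota 0 n)) false) => // w s1 b1 wn K1 s14.
    have s10 := K1.1 0 isT; rewrite /= s0 in s10.
    apply: trip_le.
      apply: (@trip_search 4 _ _ _ _ (900 * 9 ^ 2 + 100) n (fun x => has (fun y => has (fun z => transitive4 w x y z) (iota 0 n)) (iota 0 n))) => // x s2 b2 xn K2 s24.
      have s20 := K2.1 0 isT; rewrite /= s10 in s20.
      have /= s21 := K2.1 1 isT.
      apply: trip_le.
        apply: (@trip_search 4 _ _ _ _ (900 * 9 + 100) n (fun y => has (fun z => transitive4 w x y z) (iota 0 n))) => // y s3 b3 yn K3 s34.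
        have s30 := K3.1 0 isT; rewrite /= s20 in s30.
        have s31 := K3.1 1 isT; rewrite /= s21 in s31.
        have /= s32 := K3.1 2 isT.
        apply: trip_le.
          apply: (@trip_search 4 _ _ _ _ 200 n (transitive4 w x y)) => // z s4 b4 zn K4 s44.
          have s40 := K4.1 0 isT; rewrite /= s30 in s40.
          have s41 := K4.1 1 isT; rewrite /= s31 in s41.
          have s42 := K4.1 2 isT; rewrite /= s32 in s42.
          have /= s43 := K4.1 3 isT.
          have ar i j p q : (i < n)%N -> (j < n)%N ->
             var (setv s4 5 z%:Z) p = i%:Z -> var (setv s4 5 z%:Z) q = j%:Z ->
             eok B inp (arc_expr false p q) (setv s4 5 z%:Z) /\
             ev inp (arc_expr false p q) (setv s4 5 z%:Z) = a i j.
            by move=> Hi Hj Ep Eq; split; [exact: (eok_arc inp false B_ge Hi Hj) | exact: (ev_arc false inpE Hi Hj)].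
          have [k12 e12] := ar w x 1%N 2%N wn xn s41 s42.
          have [k13 e13] := ar w y 1%N 3%N wn yn s41 s43.
          have [k15 e15] := ar w z 1%N 5%N wn zn s41 erefl.
          have [k23 e23] := ar x y 2%N 3%N xn yn s42 s43.
          have [k25 e25] := ar x z 2%N 5%N xn zn s42 erefl.
          have [k35 e35] := ar y z 3%N 5%N yn zn s43 erefl.
          have sm (b b' : bool) : small B (b%:Z * b'%:Z) /\ b%:Z * b'%:Z = (b && b')%:Z.
            by case: b; case: b'; rewrite /small; split=> //; lia.
          have evE : forall e1 e2 (b b' : bool), ev inp e1 (setv s4 5 z%:Z) = b%:Z -> ev inp e2 (setv s4 5 z%:Z) = b'%:Z ->
             eok B inp e1 (setv s4 5 z%:Z) -> eok B inp e2 (setv s4 5 z%:Z) ->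
             eok B inp (e1 '* e2) (setv s4 5 z%:Z) /\ ev inp (e1 '* e2) (setv s4 5 z%:Z) = (b && b')%:Z.
            by move=> e1 e2 b b' E1 E2 k1 k2 /=; rewrite E1 E2; have [] := sm b b'.
          have [p1 q1] := evE _ _ _ _ e12 e13 k12 k13.
          have [p2 q2] := evE _ _ _ _ q1 e15 p1 k15.
          have [p3 q3] := evE _ _ _ _ q2 e23 p2 k23.
          have [p4 q4] := evE _ _ _ _ q3 e25 p3 k25.
          have [p5 q5] := evE _ _ _ _ q4 e35 p4 k35.
          have tE : transitive4 w x y z = (a w x && a w y && a w z && a x y && a x z && a y z).
            by rewrite /transitive4 !andbA.
          apply: trip_le.
            apply: trip_if.
            - exact: small1.
            - exact: p5.
            - rewrite q5 -tE => le; apply: trip_set => //=.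
              by case: (transitive4 w x y z) le => // _; rewrite orbT.
            - rewrite q5 -tE => gt; apply: trip_skip => /=; rewrite s44.
              by case: (transitive4 w x y z) gt => // _; rewrite orbF.
          by [].  
        by rewrite /=; nia.
      by rewrite /=; nia.
    by rewrite /=; nia.
    exact: leqnn.
  move=> s1 K1 I1; apply: trip_set => //=; exact: I1.
  by rewrite /=; nia.
- by rewrite /=; lia.
Qed.
End Programs.

(** * Deciding whether some vertex dominates a 3-cycle *)

Definition threshold_cmd : cmd :=
  4 <-- #0 ;; For 1 $0 (IfLe #1 (Arr 1 $4) (4 <-- $4 '+ #1) Skip).

(** A knock-out: the candidate in variable 7 (-1 for none) gives way to any later out-neighbour that
    beats it. The survivor need not be a source of the out-neighbourhood, but nothing else can be
    one; [check_source_cmd] decides. *)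
Definition scan_cmd rev : cmd :=
  For 2 $0
   (8 <-- arc_expr rev 1 2 ;;
    IfLe #1 $8
     (IfLe $7 #(-1) (7 <-- $2)
       (9 <-- arc_expr rev 2 7 ;; IfLe #1 $9 (7 <-- $2) Skip)) Skip).

Definition check_source_cmd rev : cmd :=
  For 2 $0
   (8 <-- arc_expr rev 1 2 ;;
    IfLe #1 $8
     (9 <-- arc_expr rev 7 2 ;;
      IfLe #1 $9 Skip (IfEq $7 $2 Skip (5 <-- #0))) Skip).

Definition sources_cmd rev : cmd :=
  For 1 $0
   (IfLe (Arr 0 $1) $4 Skip
     (6 <-- $1 ;; 7 <-- #(-1) ;; scan_cmd rev ;; Store 2 $1 $7 ;; check_source_cmd rev)).

(** Variable 10 is the number of remaining vertices. The verdict survives only if the first return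
    to the start vertex happens in the last round; when no vertex remains the loop is empty. *)
Definition orbit_cmd : cmd :=
  10 <-- $0 '- $4 ;; 11 <-- $6 ;;
  For 1 $10
   (11 <-- Arr 2 $11 ;;
    IfEq $11 $6 (IfLe $10 ($1 '+ #1) Skip (5 <-- #0))
                (IfLe $10 ($1 '+ #1) (5 <-- #0) Skip)).

Definition dominated_cmd rev : cmd :=
  degrees_cmd rev ;; histogram_cmd ;; threshold_cmd ;; 5 <-- #1 ;; sources_cmd rev ;;
  orbit_cmd ;; 0 <-- #1 '- $5.

Section Programs.
Variables (B n : nat) (inp : int -> int) (a : nat -> nat -> bool) (rev : bool).
Hypothesis B_ge : (16 * (n + 2) ^ 4 <= B)%N.
Hypothesis inpE : forall u v, (u < n)%N -> (v < n)%N ->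
  inp (u%:Z * n%:Z + v%:Z) = a u v.
Hypothesis asym : forall u v, (u < n)%N -> (v < n)%N -> a u v -> ~~ a v u.
Local Notation r := (rel_of a rev).
Local Notation degree := (degree n a rev).

Lemma trip_check acc x e c s T N (P : nat -> bool) (b : bool) :
  eok B inp e s -> ev inp e s = N%:Z -> var s acc = b ->
  (forall k s' (b' : bool), (k < N)%N -> keeps (For x e c) s s' -> var s' acc = b' ->
     trip B inp c (setv s' x k%:Z) T (fun s'' => var s'' acc = b' && P k)) ->
  trip B inp (For x e c) s (esize e + 4 + N * (T + 6))
    (fun s' => var s' acc = b && all P (iota 0 N)).
Proof.
move=> ok eE sb H.
apply: (@trip_for _ _ _ _ _ _ _ N (fun k s' => var s' acc = b && all P (iota 0 k))) => //.
  by rewrite /= andbT.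
move=> k s' kN I K; apply: trip_weaken; first exact: H K I.
  exact: leqnn.
have E : all P (iota 0 k.+1) = all P (iota 0 k) && P k by rewrite -addn1 iotaD all_cat /= andbT.
by move=> s'' _ E1; cbv beta; rewrite E1 E andbA.
Qed.

Lemma rel_asym u v : (u < n)%N -> (v < n)%N -> r u v -> ~~ r v u.
Proof. by rewrite /rel_of; case: rev => un vn; apply: asym. Qed.

Definition source_of v y := r v y /\ forall u, (u < n)%N -> r v u -> u != y -> r y u.

Definition scanned v k (z : int) :=
  (z = -1 /\ forall u, (u < k)%N -> ~~ r v u) \/
  exists w : nat, [/\ z = w%:Z, (w < n)%N, r v w &
    forall y, (y < k)%N -> source_of v y -> y = w].

Lemma arc_sizeE u v : esize (arc_expr rev u v) = 9%N.
Proof. by rewrite /arc_expr; case: rev. Qed.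

Lemma small_bool (b : bool) : small B b.
Proof. by have := linear_fits B_ge; rewrite /small; case: b => /=; lia. Qed.

Lemma scan_spec s v : (v < n)%N -> var s 0 = n%:Z -> var s 1 = v%:Z -> var s 7 = -1 ->
  trip B inp (scan_cmd rev) s (100 * n.+1) (fun s' => scanned v n (var s' 7)).
Proof.
have smm : small B (-1) by have := linear_fits B_ge; rewrite /small; lia.
have sm1 : small B 1 := small_bool true.
have sm0 : small B 0 := small_bool false.
move=> vn s0 s1 s7; apply: trip_le.
  apply: (@trip_for _ _ _ _ _ _ _ n (fun k s' => scanned v k (var s' 7))) => //=.
    by left.
  move=> u s' un I K.
  have /= s'0 := K.1 0 isT; rewrite s0 in s'0.
  have /= s'1 := K.1 1 isT; rewrite s1 in s'1.
  have E12 : ev inp (arc_expr rev 1 2) (setv s' 2 u%:Z) = r v u by exact: (ev_arc rev inpE).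
  apply: trip_seq; apply: trip_set.
    exact: (@eok_arc _ _ inp rev B_ge _ _ _ v u).
  rewrite E12; apply: trip_if => //=; last first.
    move=> lt; apply: trip_skip => /=; have nvu : ~~ r v u by case: (r v u) lt.
    case: I => [[z no]|[w [z wn vw uniq]]]; [left|right].
      by split=> // x; rewrite ltnS leq_eqVlt => /orP[/eqP ->|/no].
    exists w; split=> // y; rewrite ltnS leq_eqVlt => /orP[/eqP ->|]; last exact: uniq.
    by case; rewrite (negbTE nvu).
  move=> le; have vu : r v u by case: (r v u) le.
  apply: trip_if => //=.
    move=> lem; apply: trip_set => //=; right; exists u; split=> //.
    case: I => [[_ no] y yu [vy _]|[w [z]]]; last by rewrite z in lem.
    by move: yu; rewrite ltnS leq_eqVlt => /orP[/eqP //|/no]; rewrite vy.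
  move=> gt; case: I => [[z]|[w [z wn vw uniq]]]; first by rewrite z in gt.
  apply: trip_seq; apply: trip_set.
    by apply: (@eok_arc _ _ inp rev B_ge _ _ _ u w).
  rewrite (ev_arc (i := u) (j := w) rev inpE) //.
  apply: trip_if => //=.
    move=> le2; have uw : r u w by case: (r u w) le2.
    apply: trip_set => //=; right; exists u; split=> // y.
    (* A source met before could only be [w], which has just lost to [u]. *)
    rewrite ltnS leq_eqVlt => /orP[/eqP //|yu] sy; case: (uniq y yu sy) => E.
    have ne : u != w by apply: contraTneq uw => ->; apply/negP => ww; have := rel_asym wn wn ww; rewrite ww.
    by have := rel_asym un wn uw; rewrite -E (sy.2 u un vu) // E.
  move=> lt2; have uw : ~~ r u w by case: (r u w) lt2.
  apply: trip_skip => /=; right; exists w; split=> // y.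
  rewrite ltnS leq_eqVlt => /orP[/eqP -> sy|]; last exact: uniq.
  apply/eqP/negPn/negP => ne; move: uw; rewrite (sy.2 w wn vw) //.
  by rewrite eq_sym.
by rewrite !arc_sizeE /= /maxn /=; lia.
Qed.

Definition source_check (w : nat -> nat) v :=
  all (fun u => r v u ==> (r (w v) u || (u == w v))) (iota 0 n).

Lemma check_source_spec s v w (b : bool) : (v < n)%N -> (w v < n)%N -> var s 0 = n%:Z ->
  var s 1 = v%:Z -> var s 7 = (w v)%:Z -> var s 5 = b ->
  trip B inp (check_source_cmd rev) s (100 * n.+1)
    (fun s' => var s' 5 = b && source_check w v).
Proof.
have sm1 : small B 1 := small_bool true.
have sm0 : small B 0 := small_bool false.
move=> vn wn s0 s1 s7 s5; apply: trip_le.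
  apply: trip_check => //=.
  move=> u s' b' un K s'5.
  have /= s'0 := K.1 0 isT; rewrite s0 in s'0.
  have /= s'1 := K.1 1 isT; rewrite s1 in s'1.
  have /= s'7 := K.1 7 isT; rewrite s7 in s'7.
  have E12 : ev inp (arc_expr rev 1 2) (setv s' 2 u%:Z) = r v u by exact: (ev_arc rev inpE).
  apply: trip_seq; apply: trip_set.
    exact: (@eok_arc _ _ inp rev B_ge _ _ _ v u).
  rewrite E12; apply: trip_if => //=; last first.
    move=> lt; apply: trip_skip => /=; have /negbTE -> : ~~ r v u by case: (r v u) lt.
    by rewrite andbT.
  move=> le; have -> : r v u by case: (r v u) le.
  apply: trip_seq; apply: trip_set.
    by apply: (@eok_arc _ _ inp rev B_ge _ _ _ (w v) u).
  rewrite (ev_arc (i := w v) (j := u) rev inpE) //.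
  apply: trip_if => //=.
    move=> le2; have -> : r (w v) u by case: (r (w v) u) le2.
    by apply: trip_skip; rewrite /= andbT.
  move=> lt2; have /negbTE -> : ~~ r (w v) u by case: (r (w v) u) lt2.
  apply: trip_ifeq => //=; rewrite s'7 => E.
    by apply: trip_skip; rewrite /= s'5; move: E => [->]; rewrite eqxx andbT.
  apply: trip_set => //=; have /negbTE -> : u != w v by apply: contra_notN E => /eqP <-.
  by rewrite andbF.
by rewrite !arc_sizeE /= /maxn /=; lia.
Qed.

(** All n rounds are always made: either every round so far has advanced the threshold, or the
    search is stuck at the first empty score. The outcome tau = n is harmless, as no vertex has
    score n. *)
Lemma threshold_spec s : var s 0 = n%:Z ->
  (forall j, arr s 1 j = (\sum_(v < n) (degree v == j))%N) ->
  trip B inp threshold_cmd s (100 * n.+1)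
    (fun s' => exists tau : nat, [/\ var s' 4 = tau%:Z, (tau <= n)%N,
       forall j, (j < tau)%N -> arr s 1 j <> 0 & tau = n \/ arr s 1 tau = 0]).
Proof.
have HB1 := linear_fits B_ge; have sm0 := small_bool false; have sm1 := small_bool true.
move=> s0 s1; apply: trip_le.
  apply: trip_seq; apply: trip_set => //=; apply: trip_le.
  - apply: (@trip_for _ _ _ _ _ _ _ n (fun k s' =>
      exists tau : nat, [/\ var s' 4 = tau%:Z, (tau <= k)%N,
       forall j, (j < tau)%N -> arr s 1 j <> 0 & tau = k \/ arr s 1 tau = 0])) => //=.
      by exists 0%N; split=> //; left.
    move=> k s' kn [tau [s4 tk low alt]] K.
    have s'1 : arr s' 1 tau = arr s 1 tau by rewrite (K.2 1 tau isT).
    apply: trip_if => //=.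
    + by rewrite s4 /small; split=> //; lia.
    + rewrite s4 s'1 => pos; have ne : arr s 1 tau <> 0 by move=> E; rewrite E in pos.
      case: alt => [Et|//]; apply: trip_set => /=; first by rewrite s4 /small; split=> //; lia.
      exists tau.+1; rewrite s4; split=> //; [lia| |by left; rewrite Et].
      by move=> j; rewrite ltnS leq_eqVlt => /orP[/eqP ->|/low].
    + rewrite s4 s'1 => neg; apply: trip_skip; exists tau; split=> //; first by lia.
      right; rewrite s1 in neg *; move: neg; move: (\sum_(_ < _) _)%N => [//|x]; lia.
  - exact: leqnn.
by rewrite /= /maxn /=; lia.
Qed.

Definition source_val s v := absz (arr s 2 v).

Definition sources_checked tau s k :=
  all (fun v => (tau < degree v)%N ==> source_check (source_val s) v) (iota 0 k).

(** The bounds on the whole of array 2 allow the orbit to be followed even when the verdict is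
    already negative. The last clause provides a start vertex as soon as some score exceeds
    [tau]. *)
Definition sources_inv tau k s :=
  [/\ forall v, (v < k)%N -> (tau < degree v)%N -> exists w : nat,
        [/\ arr s 2 v = w%:Z, (w < n)%N, r v w &
            forall y, (y < n)%N -> source_of v y -> y = w],
      forall v, (0 <= arr s 2 v <= n%:Z),
      var s 5 = sources_checked tau s k &
      (exists v, [/\ (v < n)%N, (tau < degree v)%N & var s 6 = v%:Z]) \/
      (var s 6 = 0 /\ forall v, (v < k)%N -> (degree v <= tau)%N)].

Lemma sources_spec s tau : var s 0 = n%:Z -> var s 4 = tau%:Z -> var s 5 = 1 -> var s 6 = 0 ->
  (forall v, (v < n)%N -> arr s 0 v = degree v) -> (forall i, arr s 2 i = 0) ->
  trip B inp (sources_cmd rev) s (500 * n.+1 ^ 2) (sources_inv tau n).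
Proof.
have HB1 := linear_fits B_ge; have sm0 := small_bool false; have sm1 := small_bool true.
have smm : small B (-1) by rewrite /small; lia.
move=> s0 s4 s5 s6 sd s2; apply: trip_le.
  apply: (@trip_for _ _ _ _ _ _ _ n (sources_inv tau)) => //=.
    split=> //; last by right.
    by move=> v; rewrite s2; lia.
  move=> v s' vn [J1 J2 J3 J4] K.
  have s'0 := K.1 0 isT; rewrite s0 in s'0.
  have s'4 := K.1 4 isT; rewrite s4 in s'4.
  have s'd := K.2 0 v isT; rewrite sd // in s'd.
  have chk s'' : sources_checked tau s'' v.+1 = sources_checked tau s'' v &&
      ((tau < degree v)%N ==> source_check (source_val s'') v).
    by rewrite /sources_checked -[in iota 0 v.+1](addn1 v) iotaD all_cat /= andbT.
  apply: trip_if => //=.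
  - by rewrite /small; split=> //; lia.
  - rewrite s'd s'4 lez_nat => le; apply: trip_skip; split=> //=.
    + move=> u; rewrite ltnS leq_eqVlt => /orP[/eqP ->|]; last exact: J1.
      by rewrite ltnNge le.
    + by rewrite chk ltnNge le andbT.
    + case: J4 => [J4|[J6 J4]]; [by left|right; split=> // u].
      by rewrite ltnS leq_eqVlt => /orP[/eqP ->|/J4].
  - rewrite s'd s'4 ltz_nat => gt.
    apply: trip_seq; apply: trip_set => //=.
    apply: trip_seq; apply: trip_set => //=.
    apply: trip_seq; apply: trip_weaken; first exact: (scan_spec vn).
      exact: leqnn.
    move=> t1 L1 sc.
    have t10 := L1.1 0 isT; rewrite /= s'0 in t10.
    have /= t11 := L1.1 1 isT.
    have [w [t17 wn vw uniq]] : exists w : nat, [/\ var t1 7 = w%:Z, (w < n)%N, r v w &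
            forall y, (y < n)%N -> source_of v y -> y = w].
      case: sc => [[_ no]|//]; suff : degree v = 0%N by move=> E; rewrite E in gt.
      by rewrite /degree big1 // => u _; rewrite (negbTE (no u (ltn_ord u))).
    apply: trip_seq; apply: trip_store => //=.
      by rewrite t11 /small; split=> //; lia.
    rewrite t11 t17 /=; set t2 := seta _ _ _ _.
    have w2 : source_val t2 v = w by rewrite /source_val /= eqxx.
    apply: trip_weaken.
    + apply: (@check_source_spec _ v (source_val t2) (sources_checked tau s' v)) => //=.
      * by rewrite w2.
      * by rewrite w2.
      * by have /= -> := L1.1 5 isT.
    + exact: leqnn.
    move=> t3 L3 t35.
    have t3a i : arr t3 2 i = if i == v then w%:Z else arr s' 2 i.
      by have /= -> := L3.2 2 i isT; have /= -> := L1.2 2 i isT.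
    have val3 i : source_val t3 i = source_val t2 i.
      by rewrite /source_val; have -> := L3.2 2 i isT.
    split.
    + move=> u; rewrite ltnS leq_eqVlt t3a => /orP[/eqP ->|uv du].
        by rewrite eqxx => _; exists w.
      by rewrite ltn_eqF //; exact: J1.
    + by move=> u; rewrite t3a; case: eqP => // _; lia.
    + rewrite t35 chk gt; congr (_ && _ : nat)%:Z; last first.
        by apply: eq_all => u; rewrite val3.
      apply: eq_in_all => u; rewrite mem_iota => /andP[_ uv].
      congr (_ ==> _); apply: eq_all => x; rewrite /source_val t3a.
      by rewrite (ltn_eqF uv).
    + left; exists v; split=> //.
      by rewrite (L3.1 6 isT) /t2 /= (L1.1 6 isT).
by rewrite /= !expnS expn0; nia.
Qed.

Definition orbit_check s v0 m k :=
  all (fun i => (iter i.+1 (source_val s) v0 == v0) == (m <= i.+1)%N) (iota 0 k).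

Lemma orbit_checkS s v0 m k : orbit_check s v0 m k.+1 =
  orbit_check s v0 m k && ((iter k.+1 (source_val s) v0 == v0) == (m <= k.+1)%N).
Proof. by rewrite /orbit_check -[in iota 0 k.+1](addn1 k) iotaD all_cat /= andbT. Qed.

Lemma orbit_spec s tau v0 (b : bool) : (tau <= n)%N -> (v0 <= n)%N ->
  var s 0 = n%:Z -> var s 4 = tau%:Z -> var s 5 = b -> var s 6 = v0%:Z ->
  (forall v, (0 <= arr s 2 v <= n%:Z)) ->
  trip B inp orbit_cmd s (100 * n.+1)
   (fun s' => var s' 5 = b && orbit_check s v0 (n - tau) (n - tau)).
Proof.
have HB1 := linear_fits B_ge; have sm0 := small_bool false; have sm1 := small_bool true.
move=> tn vn s0 s4 s5 s6 s2; apply: trip_le.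
  have mE : var s 0 - var s 4 = (n - tau)%N by rewrite s0 s4; lia.
  apply: trip_seq; apply: trip_set; first by rewrite /= mE /small; split=> //; lia.
  apply: trip_seq; apply: trip_set => //=.
  rewrite mE; set m := (n - tau)%N; apply: trip_weaken.
  - apply: (@trip_for _ _ _ _ _ _ _ m (fun k s' => var s' 11 = (iter k (source_val s) v0)%:Z /\
      var s' 5 = b && orbit_check s v0 m k)) => //.
      by rewrite /= andbT.
    move=> k s' km [x5 x11] K.
    have s'10 := K.1 10 isT; rewrite /= in s'10.
    have s'6 := K.1 6 isT; rewrite /= s6 in s'6.
    have s'2 i : arr s' 2 i = arr s 2 i by rewrite (K.2 2 i isT).
    have valE i : arr s 2 i = (source_val s i)%:Z by rewrite /source_val gez0_abs //; have /andP[] := s2 i.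
    have itn i : (iter i (source_val s) v0 <= n)%N.
      by case: i => [//|i]; rewrite iterS; have := s2 (iter i (source_val s) v0); rewrite valE; lia.
    apply: trip_seq; apply: trip_set.
      by rewrite /= x5 /small; have := itn k; split=> //; lia.
    rewrite /= x5 s'2 valE -iterS.
    have sk1 : small B (k%:Z + 1) by rewrite /small; lia.
    have lastS := orbit_checkS s v0 m k.
    set w1 := iter k.+1 (source_val s) v0 in lastS *.
    apply: trip_ifeq => //.
    + rewrite [ev _ _ _]/= [ev _ $6 _]/= s'6 => -[E].
      rewrite E eqxx in lastS.
      apply: trip_if => //.
      * rewrite /= s'10 => le; apply: trip_skip; split; first by [].
        by rewrite /= x11 lastS (_ : m <= k.+1)%N ?andbT //; lia.
      * rewrite /= s'10 => lt; apply: trip_set => //; split; first by [].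
        by rewrite /= lastS (_ : (m <= k.+1)%N = false) ?andbF //; lia.
    + rewrite [ev _ _ _]/= [ev _ $11 _]/= s'6 => NE.
      have {}NE : (w1 == v0) = false by apply/eqP => E; apply: NE; rewrite E.
      rewrite NE in lastS.
      apply: trip_if => //.
      * rewrite /= s'10 => le; apply: trip_set => //; split; first by [].
        by rewrite /= lastS (_ : m <= k.+1)%N ?andbF //; lia.
      * rewrite /= s'10 => lt; apply: trip_skip; split; first by [].
        by rewrite /= x11 lastS (_ : (m <= k.+1)%N = false) ?andbT //; lia.
  - exact: leqnn.
  - by move=> s' _ [].
by rewrite /= /maxn /=; lia.
Qed.
End Programs.

Section Link.
Variables (B n : nat) (inp : int -> int) (a : nat -> nat -> bool) (rev : bool).
Hypothesis B_ge : (16 * (n + 2) ^ 4 <= B)%N.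
Hypothesis inpE : forall u v, (u < n)%N -> (v < n)%N ->
  inp (u%:Z * n%:Z + v%:Z) = a u v.
Let e : rel 'I_n := fun x y => rel_of a rev x y.
Hypothesis te : tour e.
Local Notation degree := (degree n a rev).

Lemma degreeE (v : 'I_n) : degree v = #|out e v|.
Proof. by rewrite card_set_sum. Qed.

(** Ties the loops to the criterion: if both checks succeed, [orbit_not_dominated] applies; if there
    is no copy, the candidates are sources by [free_source] and the orbit is a full cycle by
    [free_orbit]. *)
Lemma orbit_inv_card tau s v0 :
  (forall j, (j < tau)%N -> exists v, #|out e v| = j) ->
  (forall v, #|out e v| != tau) -> (tau <= n)%N ->
  sources_inv n a rev tau n s -> var s 6 = v0%:Z ->
  sources_checked n a rev tau s n && orbit_check s v0 (n - tau) (n - tau) =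
    (card_type e (true, false) == 0)%N.
Proof.
move=> att natt tn [J1 J2 J3 J4] s6.
have ch := card_high te att natt; rewrite card_ord in ch.
case: (set_0Vmem (high e tau)) => [H0|[v1 v1H]].
  rewrite (not_dominated_low te att natt H0) eqxx -ch H0 cards0 /orbit_check andbT.
  apply/allP => v; rewrite mem_iota => /andP[_ vn].
  have : Ordinal vn \notin high e tau by rewrite H0 finset.inE.
  by rewrite finset.inE -degreeE /= => /negbTE ->.
case: J4 => [[v0' [v0n v0t v0E]]|[_ J4]]; last first.
  by move: v1H; rewrite finset.inE -degreeE ltnNge J4.
have E : v0' = v0 by move: v0E; rewrite s6 => -[].
rewrite {}E in v0n v0t.
pose V0 := Ordinal v0n.
have V0H : V0 \in high e tau by rewrite finset.inE -degreeE.
(* On the remaining vertices the entry is below n, so the default of [insubd] does not occur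
   there. *)
pose f (v : 'I_n) : 'I_n := insubd v (source_val s v).
have fE v : v \in high e tau -> [/\ val (f v) = source_val s v, e v (f v) &
    forall y, source_in e (out e v) y -> y = f v].
  rewrite finset.inE -degreeE => vt; have [w [wE wn vw uniq]] := J1 v (ltn_ord v) vt.
  have E : source_val s v = w by rewrite /source_val wE.
  have fE : val (f v) = w by rewrite /f val_insubd E wn.
  split; rewrite ?fE ?E //; first by rewrite /e fE.
  move=> y /andP[]; rewrite finset.inE => vy /forall_inP H; apply/val_inj; rewrite fE.
  apply: uniq; first exact: ltn_ord.
  split=> // u un vu ne; have := H (Ordinal un); rewrite finset.inE => /(_ vu).
  by rewrite -(inj_eq val_inj) /= ne.
have f_out v : v \in high e tau -> e v (f v) by case/fE.
have f_src v y : v \in high e tau -> source_in e (out e v) y -> y = f v.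
  by case/fE => _ _; apply.
have chk : sources_checked n a rev tau s n <-> source_fun e tau f.
  split=> [/allP H v u vH vu ne|H].
    have [fv _ _] := fE v vH.
    have := H v; rewrite mem_iota ltn_ord => /(_ isT); rewrite finset.inE -degreeE in vH.
    rewrite vH => /allP/(_ u); rewrite mem_iota ltn_ord => /(_ isT).
    rewrite [rel_of a rev v u]vu -fv.
    by rewrite (negbTE (_ : val u != val (f v))) ?orbF // (inj_eq val_inj).
  apply/allP => v; rewrite mem_iota => /andP[_ vn]; apply/implyP => vt.
  have vH : Ordinal vn \in high e tau by rewrite finset.inE -degreeE.
  apply/allP => u; rewrite mem_iota => /andP[_ un]; apply/implyP => vu.
  have /= [fv _ _] := fE _ vH; rewrite -fv.
  case: eqVneq => [|ne]; first by rewrite orbT.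
  by rewrite orbF; apply: (H _ (Ordinal un) vH vu); rewrite -(inj_eq val_inj).
have orb : source_fun e tau f -> orbit_check s v0 (n - tau) (n - tau) <->
    iter #|high e tau| f V0 = V0 /\
    (forall j, (0 < j < #|high e tau|)%N -> iter j f V0 <> V0).
  move=> src; rewrite -ch.
  have itE i : iter i (source_val s) v0 = iter i f V0.
    elim: i => //= i ->; have := iter_high te att natt i src V0H.
    by case/fE.
  have h0 : (0 < #|high e tau|)%N by rewrite card_gt0; apply/set0Pn; exists V0.
  split=> [/allP H|[ret first]].
    split=> [|j /andP[j0 jm] E].
      have := H #|high e tau|.-1; rewrite mem_iota prednK // leqnn => /(_ isT).
      by rewrite itE => /eqP/eqP E; apply: val_inj.
    have := H j.-1; rewrite mem_iota prednK // => /(_ (ltnW jm)).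
    by rewrite itE E eqxx leqNgt jm.
  apply/allP => i; rewrite mem_iota add0n => /andP[_ im]; rewrite itE.
  case: (ltngtP i.+1 #|high e tau|) => [lt|gt|E].
  - case: (eqVneq (nat_of_ord (iter i.+1 f V0)) v0) => [E|_]; last by [].
    by case: (first i.+1 lt); apply: val_inj.
  - by move: gt; rewrite ltnNge im.
  - by rewrite E ret eqxx.
apply/andP/eqP => [[/chk src /(orb src)[ret first]]|free].
  exact: (orbit_not_dominated te att natt V0H src erefl ret first).
have src := free_source te f_src free.
split; first exact/chk.
by apply/(orb src); exact: (free_orbit te att natt f_out f_src free V0H).
Qed.

Lemma dominated_spec s : var s 0 = n%:Z -> var s 6 = 0 -> (forall t i, arr s t i = 0) ->
  trip B inp (dominated_cmd rev) s (1500 * n.+1 ^ 2)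
    (fun s' => var s' 0 = (card_type e (true, false) != 0)%N).
Proof.
have HB1 := linear_fits B_ge; have sm0 := small_bool B_ge false; have sm1 := small_bool B_ge true.
have asym u v : (u < n)%N -> (v < n)%N -> a u v -> ~~ a v u.
  move=> un vn uv; apply/negP => vu.
  have e1 : e (Ordinal un) (Ordinal vn) by rewrite /e /rel_of; case: rev.
  have e2 : e (Ordinal vn) (Ordinal un) by rewrite /e /rel_of; case: rev.
  by rewrite (tour_asym te e1) in e2.
move=> s0 s6 sa; apply: trip_le.
- apply: trip_seq; apply: trip_weaken; [exact: (degrees_spec B_ge inpE)|exact: leqnn|].
  move=> s1 K1 D1; have s10 := K1.1 0 isT; rewrite s0 in s10.
  apply: trip_seq; apply: trip_weaken; [|exact: leqnn|].
    apply: (histogram_spec B_ge s10 _ D1) => i.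
    by rewrite (K1.2 1 i isT).
  move=> s2 K2 H2; have s20 := K2.1 0 isT; rewrite s10 in s20.
  apply: trip_seq; apply: trip_weaken; [exact: (threshold_spec B_ge s20 H2)|exact: leqnn|].
  move=> s3 K3 [tau [s34 tn low alt]]; have s30 := K3.1 0 isT; rewrite s20 in s30.
  apply: trip_seq; apply: trip_set => //.
  have s36 : var s3 6 = 0 by rewrite (K3.1 6 isT) (K2.1 6 isT) (K1.1 6 isT).
  have s3d v : (v < n)%N -> arr s3 0 v = degree v.
    by move=> vn; rewrite (K3.2 0 v isT) (K2.2 0 v isT) D1.
  have s32 i : arr s3 2 i = 0 by rewrite (K3.2 2 i isT) (K2.2 2 i isT) (K1.2 2 i isT).
  apply: trip_seq; apply: trip_weaken; [|exact: leqnn|].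
    exact: (sources_spec B_ge inpE asym (s := setv s3 5 1) s30 s34 erefl s36 s3d s32).
  move=> s4 K4 J; have s40 := K4.1 0 isT; rewrite /= s30 in s40.
  have s44 := K4.1 4 isT; rewrite /= s34 in s44.
  have [J1 J2 J3 J4] := J.
  have [v0 s46 v0n] : exists2 v0 : nat, var s4 6 = v0%:Z & (v0 <= n)%N.
    case: J4 => [[v [vn _ E]]|[E _]]; [exists v => //; exact: ltnW | by exists 0%N].
  apply: trip_seq; apply: trip_weaken; [|exact: leqnn|].
    exact: (orbit_spec B_ge tn v0n s40 s44 J3 s46 J2).
  move=> s5 K5 s55; have {}s55 : var s5 5 = (card_type e (true, false) == 0)%N.
    rewrite s55 -(@orbit_inv_card tau s4 v0) //.
      move=> j jt; have := low j jt; rewrite H2 => H.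
      apply: contrapT => no; apply: H; congr Posz; apply: big1 => v _.
      by rewrite degreeE; case: eqP => // E; case: no; exists v.
    move=> v; case: alt => [->|E].
      by have := out_lt te v; rewrite card_ord; lia.
    apply/eqP => Ev; move: E; rewrite H2 (bigD1 v) //= degreeE Ev eqxx; lia.
  apply: trip_set => /=; rewrite s55.
    by split=> //; rewrite /small; case: (_ == 0)%N => /=; lia.
  by case: (_ == 0)%N.
- by rewrite /= !expnS expn0; nia.
Qed.
End Link.

Lemma bigO_powerP (R : realType) (m : nat -> nat) (t : R) :
  bigO_power m t <->
  exists (C : R) (N : nat), forall n, (N <= n)%N -> (m n)%:R <= C * n%:R `^ t.
Proof.
split=> [/eqO_exP[C C0 [N _ H]]|[C [N H]]].
  exists C, N => n Nn; have := H n Nn.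
  by rewrite /= ger0_norm // ger0_norm // powR_ge0.
apply/eqO_exP; exists (Num.max 1 C); first by rewrite lt_max ltr01.
exists N => // n /= Nn; rewrite ger0_norm // ger0_norm ?powR_ge0 //.
apply: le_trans (H n Nn) _; rewrite ler_wpM2r ?powR_ge0 //.
by rewrite le_max lexx orbT.
Qed.

Lemma bigO_power_square (R : realType) k : bigO_power (fun n => (k * n.+1 ^ 2).+1) (2 : R).
Proof.
apply/bigO_powerP; exists (4 * k + 1)%:R, 1%N => n n1.
rewrite powR_mulrn // -natrX -natrM ler_nat !expnS expn0; nia.
Qed.

Definition adjacent n (G : digraph n) (u v : nat) : bool :=
  [exists x in G, (x.1 == u :> nat) && (x.2 == v :> nat)].

Lemma adjacentE n (G : digraph n) (u v : 'I_n) : adjacent G u v = arcs G u v.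
Proof.
apply/exists_inP/idP => [[[x y] xyG /andP[/eqP/val_inj <- /eqP/val_inj <-]] //|uv].
by exists (u, v) => //=; rewrite !eqxx.
Qed.

Lemma inputE n (G : digraph n) u v : (u < n)%N -> (v < n)%N ->
  input G (u%:Z * n%:Z + v%:Z) = adjacent G u v.
Proof.
move=> un vn; rewrite /input /= /adjacent; congr (nat_of_bool _)%:Z.
apply: eq_existsb => -[x y] /=; congr andb.
have -> : (u%:Z * n%:Z + v%:Z == (x * n + y)%N%:Z) = (u * n + v == x * n + y)%N by lia.
apply/eqP/andP => [E|[/eqP -> /eqP ->] //].
have := congr1 (fun k => (k %/ n)%N) E; have := congr1 (fun k => (k %% n)%N) E.
rewrite !modnMDl !modn_small // !divnMDl ?(leq_ltn_trans _ un) // !divn_small // !addn0.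
by move=> -> ->; rewrite !eqxx.
Qed.

Lemma bound_ge n : (16 * (n + 2) ^ 4 <= (n + 2) ^ 8)%N.
Proof.
by rewrite (expnD _ 4 4) leq_mul2r -[16%N]/(2 ^ 4)%N leq_exp2r // leq_addl orbT.
Qed.

Section Detection.
Variables (R : realType) (T : digraph 4).
Hypothesis tT : tournament T.
Local Notation type := (type_of (arcs T) [set: 'I_4]).

Lemma has_copy_type n (G : digraph n) : tournament G ->
  has_copy T G = (card_type (arcs G) type != 0)%N.
Proof. by move=> tG; rewrite has_copyE count_copiesE // lt0n. Qed.

(** Reversal turns a sink below a 3-cycle into a source above one, so the flag covers both types. *)
Lemma detect_dominated rev : type = (~~ rev, rev) -> solvable_in (@has_copy 4 T) (2 : R).
Proof.
move=> tyE; apply: (@trip_solvable _ _ _ (dominated_cmd rev) 8 _ isT (bigO_power_square R 1500)).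
move=> n G tG; apply: trip_weaken.
- apply: (@dominated_spec _ n _ (adjacent G) rev) => //.
  + exact: bound_ge.
  + exact: inputE.
  + have [irr tot] := tour_arcs tG; split=> [x|x y ne]; rewrite /rel_of !adjacentE ?if_same ?irr //.
    by case: rev {tyE}; rewrite tot // eq_sym.
- exact: leqnn.
- move=> s _ ->; rewrite has_copy_type // tyE; congr (_ != 0 : nat)%:Z.
  case: rev {tyE} => /=.
    rewrite -card_type_converse; apply: eq_card => S; rewrite !finset.inE; congr (_ && (_ == _)).
    by congr pair; apply: eq_existsb => x; congr andb; apply: eq_forallb => y;
       rewrite /rel_of /converse adjacentE.
  apply: eq_card => S; rewrite !finset.inE; congr (_ && (_ == _)).
  by congr pair; apply: eq_existsb => x; congr andb; apply: eq_forallb => y;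
     rewrite /rel_of adjacentE.
Qed.

Lemma detect_transitive : type = (true, true) -> solvable_in (@has_copy 4 T) (2 : R).
Proof.
move=> tyE.
have big : bigO_power (fun n => (1000 * 9 ^ 4).+1) (2 : R).
  apply/bigO_powerP; exists ((1000 * 9 ^ 4).+1)%:R, 1%N => n n1.
  rewrite powR_mulrn // -natrX -natrM ler_nat leq_pmulr // expn_gt0; lia.
apply: (@trip_solvable _ _ _ transitive_cmd 8 _ isT big) => n G tG.
apply: trip_weaken.
- apply: (@transitive_spec _ n _ (adjacent G)) => //.
  + exact: bound_ge.
  + exact: inputE.
- exact: leqnn.
- move=> s _ ->; rewrite has_copy_type // tyE; congr (nat_of_bool _)%:Z.
  have te := tour_arcs tG; rewrite -lt0n.
  case: leqP => [_|n8] /=; last by rewrite (transitive4_exists te) ?card_ord.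
  rewrite (_ : (true, true) = type4 (nseq 6 true)) //.
  apply/hasP/idP => [[w]|].
    rewrite mem_iota => /andP[_ wn] /hasP[x]; rewrite mem_iota => /andP[_ xn].
    move=> /hasP[y]; rewrite mem_iota => /andP[_ yn] /hasP[z]; rewrite mem_iota => /andP[_ zn].
    move=> /and5P[wx wy wz xy /andP[xz yz]]; apply/card_type_pattern => //.
    exists (Ordinal wn), (Ordinal xn), (Ordinal yn), (Ordinal zn).
    by split; split; rewrite /oriented /= -adjacentE.
  move=> /(card_type_pattern te)[] // w [x [y [z [[wx wy wz] [xy xz yz]]]]].
  exists (w : nat); first by rewrite mem_iota ltn_ord.
  apply/hasP; exists (x : nat); first by rewrite mem_iota ltn_ord.
  apply/hasP; exists (y : nat); first by rewrite mem_iota ltn_ord.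
  apply/hasP; exists (z : nat); first by rewrite mem_iota ltn_ord.
  by rewrite /transitive4 !adjacentE; apply/and5P; split=> //; apply/andP.
Qed.

Lemma detect_strong : type = (false, false) -> solvable_in (@has_copy 4 T) (2 : R).
Proof.
move=> tyE; apply: (@trip_solvable _ _ _ strong_cmd 8 _ isT (bigO_power_square R 600)).
move=> n G tG; apply: trip_weaken.
- apply: (@strong_spec _ n _ (adjacent G)) => //.
  + exact: bound_ge.
  + exact: inputE.
- exact: leqnn.
- move=> s _ ->; rewrite has_copy_type // tyE; congr (nat_of_bool _)%:Z.
  have te := tour_arcs tG.
  have dE (v : 'I_n) : degree n (adjacent G) false v = #|out (arcs G) v|.
    by rewrite card_set_sum; apply: eq_bigr => u _; rewrite /rel_of adjacentE.
  have lE d : (\sum_(v < n) (degree n (adjacent G) false v == d))%N = #|level (arcs G) d|.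
    by rewrite card_set_sum; apply: eq_bigr => u _; rewrite dE.
  have free : (card_type (arcs G) (false, false) == 0)%N <->
      #|triangles (arcs G)| = (\sum_(d < n) (#|level (arcs G) d| == 3))%N.
    have := no_closed4P te; rewrite card_ord => <-; split=> [/eqP E q|no].
      apply/negP => C; have := card_type_closed4 te; rewrite E (bigD1 q) //= C; lia.
    have := card_type_closed4 te; rewrite big1 => [|q _]; last by rewrite (negbTE (no q)).
    by move/eqP; rewrite eq_sym muln_eq0.
  have tri := card_triangles te; rewrite card_ord in tri.
  rewrite (bin3E n) (eq_bigr (fun v : 'I_n => 2 * 'C(#|out (arcs G) v|, 2))%N); last by move=> v _; rewrite dE.
  rewrite [X in _ - 6 * X%:Z](eq_bigr (fun d : 'I_n => (#|level (arcs G) d| == 3 : nat))); last first.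
    by move=> d _; rewrite lE.
  rewrite -big_distrr /=.
  move: free tri; move: (\sum_(_ < _) _)%N (\sum_(_ | _) _)%N => S1 S2 free tri.
  apply/idP/idP => H; apply: contra H.
    by move/free => E; apply/eqP; lia.
  by move/eqP => E; apply/free; lia.
Qed.

Lemma detect_upper : solvable_in (@has_copy 4 T) (2 : R).
Proof.
case E: type => [[] []]; [exact: detect_transitive|exact: (@detect_dominated false)|
  exact: (@detect_dominated true)|exact: detect_strong].
Qed.
End Detection.

(** * The quadratic lower bound for detection *)

(** If t < 2, some large n has n^(2-t) above K max(C, 0), against n^2 <= K C n^t. *)
Lemma bigO_power_ge2 (R : realType) (m : nat -> nat) (t : R) K N :
  bigO_power m t -> (forall n, (N <= n)%N -> (n * n <= K * m n)%N) -> 2 <= t.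
Proof.
move=> /bigO_powerP[C [N' H]] low; rewrite leNgt; apply/negP => t2.
have d0 : 0 < 2 - t by rewrite subr_gt0.
pose M := K%:R * Num.max C 0 + 1 : R.
have M0 : 0 < M by rewrite ltr_wpDl // mulr_ge0 // le_max lexx orbT.
pose x := M `^ (2 - t)^-1.
pose n := (maxn (maxn N N') (Num.bound x)).+1.
have nx : x <= n%:R.
  apply: ltW; apply: lt_le_trans (archi_boundP (powR_ge0 _ _)) _.
  by rewrite ler_nat /n ltnW // ltnS leq_max leqnn orbT.
have n0 : 0 < n%:R :> R by rewrite ltr0n.
have h1 := H n ltac:(rewrite /n; lia); have h2 := low n ltac:(rewrite /n; lia).
have : (n%:R `^ 2 : R) <= K%:R * Num.max C 0 * n%:R `^ t.
  rewrite powR_mulrn ?ler0n // -natrX expnS expn1.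
  apply: le_trans (_ : (K * m n)%:R <= _); first by rewrite ler_nat.
  rewrite natrM -mulrA ler_wpM2l ?ler0n //; apply: le_trans h1 _.
  by rewrite ler_wpM2r ?powR_ge0 // le_max lexx.
rewrite -{1}[2](subrK t) powRD; last by rewrite (gt_eqF n0) implybT.
rewrite ler_pM2r ?powR_gt0 // leNgt => /negP; apply.
apply: (@lt_le_trans _ _ M); first by rewrite /M ltrDl.
have -> : M = (M `^ (2 - t)^-1) `^ (2 - t).
  by rewrite -powRrM mulVf ?lt0r_neq0 // powRr1 // ltW.
by apply: ge0_ler_powR => //; rewrite ?nnegrE ?powR_ge0 // ltW.
Qed.

(** Vertex 0 dominates the 3-cycle 1 -> 2 -> 3 -> 1. *)
Definition dominated_digraph : digraph 4 :=
  [set x : 'I_4 * 'I_4 | rel4 [:: true; true; true; true; false; true] x.1 x.2].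

Lemma tournament_dominated : tournament dominated_digraph.
Proof.
apply/andP; split.
  by apply/forallP => -[[|[|[|[|//]]]] Hx]; rewrite finset.inE.
apply/forallP => -[[|[|[|[|//]]]] Hx]; apply/forallP => -[[|[|[|[|//]]]] Hy];
  by rewrite !finset.inE.
Qed.

Lemma type_dominated : type_of (arcs dominated_digraph) [set: 'I_4] = (true, false).
Proof.
have te := tour_arcs tournament_dominated.
have -> : [set: 'I_4] = id @: [set: 'I_4] by rewrite imset_id.
rewrite (type_of_bits te (@inj_id _)) /bits_of /pt /arcs.
by rewrite !finset.inE /= !inordK.
Qed.

Definition order_digraph n : digraph n := [set x : 'I_n * 'I_n | (x.1 < x.2)%N].

Definition flip_arc n (i j : 'I_n) : digraph n :=
  (j, i) |: (order_digraph n :\ (i, j)).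

Lemma tournament_order n : tournament (order_digraph n).
Proof.
apply/andP; split; first by apply/forallP => x; rewrite finset.inE ltnn.
apply/forallP => x; apply/forallP => y; apply/implyP => ne; rewrite !finset.inE /=.
by case: (ltngtP x y) => // /val_inj E; rewrite E eqxx in ne.
Qed.

Lemma tournament_flip n (i j : 'I_n) : (i < j)%N -> tournament (flip_arc i j).
Proof.
move=> ij; have nij : i != j by rewrite -(inj_eq val_inj) ltn_eqF.
apply/andP; split.
  apply/forallP => x; rewrite !finset.inE ltnn andbF orbF xpair_eqE.
  by apply/negP => /andP[/eqP -> /eqP E]; rewrite E eqxx in nij.
apply/forallP => x; apply/forallP => y; apply/implyP; rewrite !finset.inE /= !xpair_eqE.
rewrite -!(inj_eq val_inj) /=; move: (val x) (val y) (val i) (val j) ij => a b c d cd ab.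
by lia.
Qed.

Lemma order_free n : has_copy dominated_digraph (order_digraph n) = false.
Proof.
have te := tour_arcs (tournament_order n).
rewrite (has_copy_type tournament_dominated) ?tournament_order // type_dominated.
apply/eqP; apply/eqP; rewrite -leqn0 leqNgt; apply/negP.
move=> /(dominated_triangleP te)[v [a [b [c /and4P[_ _ _ /and3P[]]]]]].
by rewrite /arcs !finset.inE /=; lia.
Qed.

(** Vertex 0 dominates i -> i+1 -> j -> i; the hypotheses make these four vertices distinct. *)
Lemma flip_contains n (i j : 'I_n) : (0 < i)%N -> (i.+1 < j)%N ->
  has_copy dominated_digraph (flip_arc i j).
Proof.
move=> i0 ij; have lt := ltnW ij.
have te := tour_arcs (tournament_flip lt).
rewrite (has_copy_type tournament_dominated) ?tournament_flip // type_dominated -lt0n.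
apply/(dominated_triangleP te).
have n0 : (0 < n)%N by exact: leq_ltn_trans (ltn_ord i).
have kn : (i.+1 < n)%N by exact: ltn_trans (ltn_ord j).
have ltE (x y : 'I_n) : (x < y)%N -> (val x != i) || (val y != j) -> arcs (flip_arc i j) x y.
  rewrite /arcs !finset.inE /= !xpair_eqE -!(inj_eq val_inj) /=.
  by move: (val x) (val y) (val i) (val j) => a b c d; lia.
exists (Ordinal n0), i, (Ordinal kn), j.
apply/and4P; split; try (apply: ltE => /=; lia).
apply/and3P; split; try (apply: ltE => /=; lia).
by rewrite /arcs !finset.inE eqxx.
Qed.

Section Reads.
Variables (p : program) (n : nat) (i j : 'I_n).
Let st0 k := steps p k (init (order_digraph n)).
Let st1 k := steps p k (init (flip_arc i j)).

Definition read_address (st : state) : option int :=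
  if pc st is Some l then
    if nth Halt p l is Read _ a then Some (reg st a) else None
  else None.

Definition touches (z : int) := (z == (i * n + j)%N%:Z) || (z == (j * n + i)%N%:Z).

(** The inputs differ in two cells only. As long as neither is read, the registers agree, hence also
    the jumps and the addresses and values of writes, and the memories can differ in these two cells
    alone. *)
Lemma same_run t : (forall k, (k < t)%N -> forall z, read_address (st0 k) = Some z -> ~~ touches z) ->
  [/\ pc (st1 t) = pc (st0 t), reg (st1 t) =1 reg (st0 t) &
      forall z, ~~ touches z -> memory (st1 t) z = memory (st0 t) z].
Proof.
elim: t => [|t IH] H.
  split=> // z; rewrite /touches negb_or => /andP[n1 n2] /=; congr (nat_of_bool _)%:Z.
  apply: eq_existsb => -[x y]; rewrite !finset.inE /= !xpair_eqE.
  case: (eqVneq z (x * n + y)%N%:Z) => [E|]; rewrite ?andbF // !andbT.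
  have -> : (x == i) && (y == j) = false.
    by apply/negP => /andP[/eqP Ex /eqP Ey]; rewrite E Ex Ey eqxx in n1.
  have -> // : (x == j) && (y == i) = false.
  by apply/negP => /andP[/eqP Ex /eqP Ey]; rewrite E Ex Ey eqxx in n2.
have [] := IH (fun k kt => H k (ltnW kt)).
have Ht := H t (ltnSn t).
rewrite /st0 /st1 /steps !iterS -!/(steps _ _ _) -/(st0 t) -/(st1 t).
case: (st0 t) Ht => c0 r0 m0; case: (st1 t) => c1 r1 m1 /= Ht -> Er Em.
case: c0 Ht => [l|] Ht //=; rewrite /read_address /= in Ht.
case: (nth Halt p l) Ht => [d v|o d a b|d a|a b|a b l'|] Ht /=; split=> //.
- by move=> z; rewrite /upd Er.
- by move=> z; rewrite /upd !Er.
- by move=> z; rewrite /upd !Er; case: eqP => // _; apply: Em; exact: Ht.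
- by move=> z; rewrite /upd !Er => nz; case: eqP => // _; exact: Em.
- by rewrite !Er.
Qed.
End Reads.

Lemma detect_lower (R : realType) (t : R) :
  solvable_in (@has_copy 4 dominated_digraph) t -> 2 <= t.
Proof.
move=> [p [c [time [bigT H]]]]; apply: (bigO_power_ge2 (K := 16) (N := 8) bigT) => n n8.
(* The arcs i -> j with i in 1..h and j in h+2..2h+1 are flipped: the ranges are disjoint and i + 1
   < j. The constant 16 comes from n <= 4h. *)
pose h := (n./2).-1.
have hn : (2 * h + 2 <= n)%N by rewrite /h; have := odd_double_half n; lia.
have hn4 : (n <= 4 * h)%N by rewrite /h; have := odd_double_half n; lia.
suff : (h * h <= time n)%N by nia.
have Hi (x : 'I_h) : (x.+1 < n)%N by have := ltn_ord x; lia.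
have Hj (y : 'I_h) : (h + 2 + y < n)%N by have := ltn_ord y; lia.
pose I x : 'I_n := Ordinal (Hi x); pose J y : 'I_n := Ordinal (Hj y).
pose st k := steps p k (init (order_digraph n)).
(* Otherwise the program would answer alike on the transitive tournament and on the flipped one. *)
have read (x y : 'I_h) : exists k : 'I_(time n), exists2 z, read_address p (st k) = Some z &
    touches (I x) (J y) z.
  apply: contrapT => no.
  have [] := @same_run p n (I x) (J y) (time n).
    move=> k kt z E; apply/negP => tz; apply: no.
    by exists (Ordinal kt), z.
  move=> _ Er _; have xj : ((I x).+1 < J y)%N by have := ltn_ord x; rewrite /=; lia.
  have [_ [_ E0]] := H n (order_digraph n) (tournament_order n).
  have [_ [_ E1]] := H n (flip_arc (I x) (J y)) (tournament_flip (ltnW xj)).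
  by move: E1; rewrite Er E0 order_free flip_contains.
have [f fP] := choice (fun xy : 'I_h * 'I_h => read xy.1 xy.2).
(* A step reads a single cell, and the cell determines the arc because the ranges of i and j are
   disjoint. *)
have injf : injective f.
  move=> [x y] [x' y'] E; have [z rz tz] := fP (x, y); have [z' rz' tz'] := fP (x', y').
  move: rz'; rewrite -E rz => -[Ez]; move: tz'; rewrite -{}Ez.
  move: tz; rewrite /touches /= => tz tz'.
  have [lx ly lx' ly'] := And4 (ltn_ord x) (ltn_ord y) (ltn_ord x') (ltn_ord y').
  have inj a b a' b' : (b < n)%N -> (b' < n)%N -> (a * n + b = a' * n + b')%N -> a = a' /\ b = b'.
    move=> bn b'n E'; have := congr1 (fun k => (k %/ n)%N) E'; have := congr1 (fun k => (k %% n)%N) E'.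
    by rewrite !modnMDl !modn_small // !divnMDl ?(leq_ltn_trans _ bn) // !divn_small // !addn0.
  have Hb (k : nat) : (k < h)%N -> (k.+1 < n)%N /\ (h + 2 + k < n)%N by lia.
  have [[a1 a2] [a3 a4]] := (Hb _ lx, Hb _ ly); have [[a5 a6] [a7 a8]] := (Hb _ lx', Hb _ ly').
  have Exy : x = x' :> nat /\ y = y' :> nat.
    move/orP: tz => [] /eqP -> in tz' *; move/orP: tz' => [] /eqP [] /inj => /(_ ltac:(done) ltac:(done)) []; lia.
  by congr pair; apply: val_inj; case: Exy.
by have := leq_card f injf; rewrite card_prod !card_ord.
Qed.

(** * From straight-line programs to bilinear identities *)

Section LowDegree.
Variable n : nat.
Local Notation M := 'M[rat]_n.
Implicit Types (A B : M) (f g h : M -> M -> rat).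

Definition lin (l : M * M) A B : rat :=
  \sum_i \sum_j l.1 i j * A i j + \sum_i \sum_j l.2 i j * B i j.

Lemma linD l l' A B : lin (l.1 + l'.1, l.2 + l'.2) A B = lin l A B + lin l' A B.
Proof.
rewrite /lin /= [RHS]addrACA; congr (_ + _); rewrite -big_split; apply: eq_bigr => i _;
  by rewrite -big_split; apply: eq_bigr => j _; rewrite mxE mulrDl.
Qed.

Lemma linZ c l A B : lin (c *: l.1, c *: l.2) A B = c * lin l A B.
Proof.
rewrite /lin /= mulrDr !mulr_sumr; congr (_ + _); apply: eq_bigr => i _;
  by rewrite mulr_sumr; apply: eq_bigr => j _; rewrite mxE mulrA.
Qed.

Definition is_lin (h : M -> M -> rat) := exists l, forall A B, h A B = lin l A B.

Lemma is_linD h h' : is_lin h -> is_lin h' -> is_lin (fun A B => h A B + h' A B).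
Proof.
move=> [l E] [l' E']; exists (l.1 + l'.1, l.2 + l'.2) => A B.
by rewrite linD E E'.
Qed.

Lemma is_linZ c h : is_lin h -> is_lin (fun A B => c * h A B).
Proof. by move=> [l E]; exists (c *: l.1, c *: l.2) => A B; rewrite linZ E. Qed.

Lemma is_lin0 : is_lin (fun _ _ => 0).
Proof.
exists (0, 0) => A B; rewrite /lin !big1 ?addr0 // => i _;
  by rewrite big1 // => j _; rewrite mxE mul0r.
Qed.

Lemma lin_delta (C : M) i j : \sum_i' \sum_j' delta_mx i j i' j' * C i' j' = C i j.
Proof.
rewrite (bigD1 i) //= (bigD1 j) //= mxE !eqxx mul1r !big1 ?addr0 // => [i' ne|j' ne].
  by rewrite big1 // => j' _; rewrite mxE (negbTE ne) mul0r.
by rewrite mxE (negbTE ne) andbF mul0r.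
Qed.

Lemma is_lin_entA i j : is_lin (fun A _ => A i j).
Proof.
exists (delta_mx i j, 0) => A B; rewrite /lin /= lin_delta [X in _ + X]big1 ?addr0 // => i' _.
by rewrite big1 // => j' _; rewrite mxE mul0r.
Qed.

Lemma is_lin_entB i j : is_lin (fun _ B => B i j).
Proof.
exists (0, delta_mx i j) => A B; rewrite /lin /= lin_delta [X in X + _]big1 ?add0r // => i' _.
by rewrite big1 // => j' _; rewrite mxE mul0r.
Qed.

Definition products := seq ((M * M) * (M * M)).

Definition spanned (ps : products) g := exists c : nat -> rat, forall A B,
  g A B = \sum_(k < size ps) c k * (lin (nth 0 ps k).1 A B * lin (nth 0 ps k).2 A B).

Lemma spannedD ps g h : spanned ps g -> spanned ps h -> spanned ps (fun A B => g A B + h A B).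
Proof.
move=> [c E] [c' E']; exists (fun k => c k + c' k) => A B.
by rewrite E E' -big_split /=; apply: eq_bigr => k _; rewrite -mulrDl.
Qed.

Lemma spannedZ ps x g : spanned ps g -> spanned ps (fun A B => x * g A B).
Proof.
move=> [c E]; exists (fun k => x * c k) => A B.
by rewrite E mulr_sumr; apply: eq_bigr => k _; rewrite -[RHS]mulrA.
Qed.

Lemma spanned0 ps : spanned ps (fun _ _ => 0).
Proof. by exists (fun _ => 0) => A B; rewrite big1 // => k _; rewrite mul0r. Qed.

Lemma spanned_rcons ps x g : spanned ps g -> spanned (rcons ps x) g.
Proof.
move=> [c E]; exists (fun k => if (k < size ps)%N then c k else 0) => A B.
rewrite size_rcons big_ord_recr /= ltnn mul0r addr0 E; apply: eq_bigr => k _.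
by rewrite nth_rcons ltn_ord.
Qed.

Lemma spanned_product ps h h' : is_lin h -> is_lin h' -> exists x,
  spanned (rcons ps x) (fun A B => h A B * h' A B).
Proof.
move=> [l E] [l' E']; exists (l, l'); exists (fun k => (k == size ps)%:R) => A B.
rewrite size_rcons big_ord_recr /= nth_rcons ltnn eqxx mul1r /= E E' big1 ?add0r // => k _.
by rewrite ltn_eqF // mul0r.
Qed.

(* [f (s A) (s B)] is a fraction in [s] whose denominator never vanishes, with
   Taylor expansion [c + h A B s + g A B s^2] up to order 3. *)
Definition expands f c h g := forall A B, exists p q r : {poly rat},
  [/\ forall s, q.[s] != 0, forall s, f (s *: A) (s *: B) * q.[s] = p.[s] &
      p = q * (c%:P + (h A B)%:P * 'X + (g A B)%:P * 'X^2) + r * 'X^3].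

(** Only the coefficient of s^2 has to be expressed through products; below degree two a constant
    and a linear form suffice, and they cost nothing. *)
Definition expandable ps f := exists c h g, [/\ is_lin h, spanned ps g & expands f c h g].

Lemma expandable_rcons ps x f : expandable ps f -> expandable (rcons ps x) f.
Proof. by move=> [c [h [g [? ? ?]]]]; exists c, h, g; split=> //; exact: spanned_rcons. Qed.

Lemma expandable_lin ps c h : is_lin h -> expandable ps (fun A B => c + h A B).
Proof.
move=> [l E]; exists c, h, (fun _ _ => 0); split; [by exists l|exact: spanned0|].
move=> A B; exists (c%:P + (h A B)%:P * 'X), 1, 0; split=> [s|s|].
- by rewrite hornerE oner_eq0.
- rewrite !hornerE E E; congr (_ + _).
  rewrite /lin mulrDl !mulr_suml; congr (_ + _); apply: eq_bigr => i _;
    by rewrite mulr_suml; apply: eq_bigr => j _; rewrite mxE mulrCA [RHS]mulrC.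
- by rewrite polyC0; ring.
Qed.

Lemma expandable_add ps f f' : expandable ps f -> expandable ps f' ->
  expandable ps (fun A B => f A B + f' A B).
Proof.
move=> [c [h [g [lh sg e]]]] [c' [h' [g' [lh' sg' e']]]].
exists (c + c'), (fun A B => h A B + h' A B), (fun A B => g A B + g' A B).
split; [exact: is_linD|exact: spannedD|] => A B.
have [p [q [r [q0 fE pE]]]] := e A B; have [p' [q' [r' [q0' fE' pE']]]] := e' A B.
exists (p * q' + p' * q), (q * q'), (r * q' + r' * q); split=> [s|s|].
- by rewrite hornerM mulf_neq0.
- by rewrite !(hornerM, hornerD) -fE -fE'; ring.
- by rewrite pE pE'; cbv beta; rewrite !polyCD; ring.
Qed.

Lemma expandable_scale ps x f : expandable ps f -> expandable ps (fun A B => x * f A B).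
Proof.
move=> [c [h [g [lh sg e]]]].
exists (x * c), (fun A B => x * h A B), (fun A B => x * g A B).
split; [exact: is_linZ|exact: spannedZ|] => A B.
have [p [q [r [q0 fE pE]]]] := e A B.
exists (x%:P * p), q, (x%:P * r); split=> [//|s|].
- by rewrite hornerM hornerC -fE; ring.
- by rewrite pE; cbv beta; rewrite !polyCM; ring.
Qed.

(** In the coefficient c g' + c' g + h h' of s^2 only the last term is new, so a multiplication
    costs a single product of linear forms. *)
Lemma expandable_mul ps f f' : expandable ps f -> expandable ps f' ->
  exists x, expandable (rcons ps x) (fun A B => f A B * f' A B).
Proof.
move=> [c [h [g [lh sg e]]]] [c' [h' [g' [lh' sg' e']]]].
have [x sx] := spanned_product ps lh lh'; exists x.
exists (c * c'), (fun A B => c * h' A B + c' * h A B),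
  (fun A B => c * g' A B + c' * g A B + h A B * h' A B); split.
- by apply: is_linD; apply: is_linZ.
- by apply: spannedD sx; apply: spannedD; apply: spannedZ; apply: spanned_rcons.
move=> A B.
have [p [q [r [q0 fE pE]]]] := e A B; have [p' [q' [r' [q0' fE' pE']]]] := e' A B.
set U := c%:P + (h A B)%:P * 'X + (g A B)%:P * 'X^2 in pE.
set U' := c'%:P + (h' A B)%:P * 'X + (g' A B)%:P * 'X^2 in pE'.
exists (p * p'), (q * q'), (r * q' * U' + r' * q * U + r * r' * 'X^3 +
  q * q' * ((h A B)%:P * (g' A B)%:P + (g A B)%:P * (h' A B)%:P + (g A B)%:P * (g' A B)%:P * 'X)).
split=> [s|s|].
- by rewrite hornerM mulf_neq0.
- by rewrite !hornerM -fE -fE'; ring.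
- by rewrite pE pE' /U /U'; cbv beta; rewrite !(polyCD, polyCM); ring.
Qed.

(** The quotient w is found degree by degree from f = f' w, and only w1 v1 is a new product. The
    constant term v0 is invertible because the divisor does not vanish at A = B = 0. *)
Lemma expandable_div ps f f' : (forall A B, f' A B != 0) ->
  expandable ps f -> expandable ps f' ->
  exists x, expandable (rcons ps x) (fun A B => f A B / f' A B).
Proof.
move=> nz [u0 [u1 [u2 [lh sg e]]]] [v0 [v1 [v2 [lh' sg' e']]]].
have v00 : v0 != 0.
  have [p' [q' [r' [q0' fE' pE']]]] := e' 0 0.
  have := fE' 0; rewrite pE' !hornerE /= !mulr0 !addr0 => E.
  have : f' (0 *: 0) (0 *: 0) * q'.[0] != 0 by rewrite mulf_neq0.
  by rewrite E mulf_eq0 negb_or => /andP[].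
pose w0 := u0 / v0.
pose w1 A B := v0^-1 * (u1 A B + - w0 * v1 A B).
have lw1 : is_lin w1 by apply/is_linZ/is_linD => //; exact: is_linZ.
have [x sx] := spanned_product ps lw1 lh'; exists x.
pose w2 A B := v0^-1 * (u2 A B + - w0 * v2 A B + -1 * (w1 A B * v1 A B)).
exists w0, w1, w2; split=> //.
- apply/spannedZ/spannedD; last exact: spannedZ.
  by apply: spannedD; [|apply: spannedZ]; exact: spanned_rcons.
move=> A B.
have [p [q [r [q0 fE pE]]]] := e A B; have [p' [q' [r' [q0' fE' pE']]]] := e' A B.
have E0 : u0 = v0 * w0 by rewrite /w0; field.
have E1 : u1 A B = v0 * w1 A B + w0 * v1 A B by rewrite /w1; field.
have E2 : u2 A B = v0 * w2 A B + w1 A B * v1 A B + w0 * v2 A B by rewrite /w2; field.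
set W := w0%:P + (w1 A B)%:P * 'X + (w2 A B)%:P * 'X^2.
exists (p * q'), (q * p'), (q' * r - q * r' * W -
  q * q' * ((v1 A B)%:P * (w2 A B)%:P + (v2 A B)%:P * (w1 A B)%:P + (v2 A B)%:P * (w2 A B)%:P * 'X)).
split=> [s|s|].
- by rewrite hornerM mulf_neq0 // -fE' mulf_neq0.
- rewrite !hornerM -fE -fE'; have := nz (s *: A) (s *: B).
  by move: (f' _ _) (f _ _) => y z y0; field.
- by rewrite pE pE' E0 E1 E2 /W !(polyCD, polyCM); ring.
Qed.

Lemma poly_eq0_horner (p : {poly rat}) : (forall s, p.[s] = 0) -> p = 0.
Proof.
move=> H; apply/eqP/negPn/negP => p0.
pose rs : seq rat := [seq k%:R | k <- iota 0 (size p)].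
have H1 : all (root p) rs by apply/allP => x _; rewrite /root H.
have H2 : uniq rs.
  by rewrite map_inj_uniq ?iota_uniq // => i j /eqP; rewrite eqr_nat => /eqP.
by have := max_poly_roots p0 H1 H2; rewrite size_map size_iota ltnn.
Qed.

(** By homogeneity the expansion must be f s^2. Since the denominator is nonzero at 0, coefficients
    can be compared one after the other: c = 0, h = 0 and g = f. *)
Lemma expandable_quadratic ps f : expandable ps f ->
  (forall s A B, f (s *: A) (s *: B) = s ^+ 2 * f A B) -> spanned ps f.
Proof.
move=> [c [h [g [_ [co gE] e]]]] hom; exists co => A B; rewrite -gE.
have [p [q [r [q0 fE pE]]]] := e A B.
have E : q * (c%:P + (h A B)%:P * 'X + (g A B - f A B)%:P * 'X^2) + r * 'X^3 = 0.
  rewrite [LHS](_ : _ = p - q * ((f A B)%:P * 'X^2)); last by rewrite pE polyCB; ring.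
  apply: poly_eq0_horner => s; rewrite hornerD hornerN -fE hom !(hornerM, hornerC, hornerX); ring.
have qn : q`_0 != 0 by rewrite -horner_coef0.
have co3 k : (k < 3)%N -> (c *: q + (h A B) *: (q * 'X) + (g A B - f A B) *: (q * 'X^2))`_k = 0.
  move=> k3; rewrite (_ : _ + _ = - (r * 'X^3)); first by rewrite coefN coefMXn k3 oppr0.
  by apply/eqP; rewrite -addr_eq0 -E -!mul_polyC; apply/eqP; ring.
have c0 : c = 0.
  have := co3 0%N isT; rewrite !coefD !coefZ coefMX coefMXn /= !mulr0 !addr0 => /eqP.
  by rewrite mulf_eq0 (negbTE qn) orbF => /eqP.
have h0 : h A B = 0.
  have := co3 1%N isT; rewrite c0 !coefD !coefZ coefMX coefMXn /= mul0r !mulr0 addr0 add0r => /eqP.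
  by rewrite mulf_eq0 (negbTE qn) orbF => /eqP.
have := co3 2%N isT; rewrite c0 h0 !coefD !coefZ coefMX coefMXn /= !mul0r !add0r => /eqP.
by rewrite mulf_eq0 (negbTE qn) orbF subr_eq0 => /eqP.
Qed.

(** Each instruction appends one product, a dummy one for sums and differences, so that the lengths
    agree. Divisors vanish nowhere because the program succeeds on all inputs. Functions have no
    decidable equality, hence [List.In]. *)
Lemma slp_expandable (p : slp rat n) (fs : seq (M -> M -> rat)) ps :
  (forall f, List.In f fs -> expandable ps f) ->
  (forall A B, exists vs, slp_eval A B [seq f A B | f <- fs] p = Some vs) ->
  exists fs' ps', [/\ size ps' = (size ps + size p)%N,
    size fs' = (size fs + size p)%N,
    forall A B, slp_eval A B [seq f A B | f <- fs] p = Some [seq f A B | f <- fs'] &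
    forall f, List.In f fs' -> expandable ps' f].
Proof.
elim: p fs ps => [|[[op x] y] p IH] fs ps ex tot.
  by exists fs, ps; rewrite !addn0.
have opE z : expandable ps (fun A B => operand_eval A B [seq f A B | f <- fs] z).
  case: z => [c|i j|i j|k] /=.
  - have := expandable_lin ps c is_lin0; congr expandable.
    by apply/funext => A; apply/funext => B; rewrite addr0.
  - have := expandable_lin ps 0 (is_lin_entA i j); congr expandable.
    by apply/funext => A; apply/funext => B; rewrite add0r.
  - have := expandable_lin ps 0 (is_lin_entB i j); congr expandable.
    by apply/funext => A; apply/funext => B; rewrite add0r.
  - have [lt|ge] := ltnP k (size fs).
      have : expandable ps (nth (fun _ _ => 0) fs k).
        apply: ex; elim: fs k lt {tot IH} => // f fs IHf [|k] lt /=; [by left | right; exact: IHf].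
      congr expandable; apply/funext => A; apply/funext => B.
      by rewrite (nth_map (fun _ _ => 0)).
    have := expandable_lin ps 0 is_lin0; congr expandable.
    by apply/funext => A; apply/funext => B; rewrite nth_default ?size_map // addr0.
pose u A B := operand_eval A B [seq f A B | f <- fs] x.
pose v A B := operand_eval A B [seq f A B | f <- fs] y.
have eu : expandable ps u := opE x.
have ev : expandable ps v := opE y.
have [z [w [ew wE]]] : exists z w, expandable (rcons ps z) w /\
    forall A B, field_op op (u A B) (v A B) = Some (w A B).
  case: op tot => /= tot.
  - exists 0, (fun A B => u A B + v A B); split=> //.
    exact/expandable_rcons/expandable_add.
  - exists 0, (fun A B => u A B + -1 * v A B); split; last by move=> A B; rewrite mulN1r.
    exact/expandable_rcons/expandable_add/expandable_scale.
  - by have [z ez] := expandable_mul eu ev; exists z, (fun A B => u A B * v A B).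
  - have nz A B : v A B != 0.
      by have [vs] := tot A B; rewrite -/(v A B); case: eqP.
    have [z ez] := expandable_div nz eu ev; exists z, (fun A B => u A B / v A B); split=> // A B.
    by rewrite (negbTE (nz A B)).
have stepE A B : slp_eval A B [seq f A B | f <- fs] ((op, x, y) :: p) =
    slp_eval A B [seq f A B | f <- rcons fs w] p.
  by rewrite /= -/(u A B) -/(v A B) wE map_rcons.
have [||fs' [ps' [s1 s2 E ex']]] := IH (rcons fs w) (rcons ps z).
- move=> f; rewrite -cats1 => H; have [/ex|] := List.in_app_or _ _ _ H; first exact: expandable_rcons.
  by case=> [<-|].
- by move=> A B; have [vs] := tot A B; rewrite stepE; exists vs.
exists fs', ps'; split=> //.
- by rewrite s1 size_rcons addSnnS.
- by rewrite s2 size_rcons addSnnS.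
- by move=> A B; rewrite stepE.
Qed.

Lemma multiplies_spanned (p : slp rat n) out : multiplies p out ->
  exists2 ps : products, size ps = size p & forall i j, spanned ps (fun A B => (A *m B) i j).
Proof.
move=> mul.
have [||fs [ps [s1 _ E ex]]] := @slp_expandable p [::] [::] => //.
  by move=> A B; have [vs ? _] := mul A B; exists vs.
exists ps => // i j; apply: expandable_quadratic; last first.
  move=> s A B; rewrite -scalemxAl -scalemxAr scalerA mxE expr2 //.
have outE A B : (A *m B) i j = operand_eval A B [seq f A B | f <- fs] (out i j).
  by have [vs] := mul A B; rewrite E => -[<-] ->.
case: (out i j) outE => [c|i' j'|i' j'|k] outE.
- have := expandable_lin ps c is_lin0; congr expandable.
  by apply/funext => A; apply/funext => B; rewrite outE addr0.
- have := expandable_lin ps 0 (is_lin_entA i' j'); congr expandable.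
  by apply/funext => A; apply/funext => B; rewrite outE add0r.
- have := expandable_lin ps 0 (is_lin_entB i' j'); congr expandable.
  by apply/funext => A; apply/funext => B; rewrite outE add0r.
- have [lt|ge] := ltnP k (size fs).
    have : expandable ps (nth (fun _ _ => 0) fs k).
      apply: ex; elim: fs k lt {E outE} => // f fs IHf [|k] lt /=; [by left | right; exact: IHf].
    congr expandable; apply/funext => A; apply/funext => B.
    by rewrite outE /= (nth_map (fun _ _ => 0)).
  have := expandable_lin ps 0 is_lin0; congr expandable.
  by apply/funext => A; apply/funext => B; rewrite outE /= nth_default ?size_map // addr0.
Qed.
End LowDegree.

(** * Integer trilinear identities of a fixed order *)

Lemma clear_denominators (x : nat -> nat -> rat) m n : exists d (z : nat -> nat -> int),
  (0 < d)%N /\ forall i j, (i < m)%N -> (j < n)%N -> d%:R * x i j = (z i j)%:~R.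
Proof.
pose d := (\prod_(i < m) \prod_(j < n) `|denq (x i j)|)%N.
exists d, (fun i j => numq (d%:R * x i j)); split.
  by apply: prodn_gt0 => i; apply: prodn_gt0 => j; rewrite absz_gt0 denq_neq0.
move=> i j im jn.
have [e dE] : exists e, d = (e * `|denq (x i j)|)%N.
  apply/dvdnP; rewrite /d (bigD1 (Ordinal im)) //= (bigD1 (Ordinal jn)) //= -mulnA.
  exact: dvdn_mulr.
rewrite {2}dE dE.
have -> : (e * `|denq (x i j)|)%:R * x i j = (e%:Z * numq (x i j))%:~R :> rat.
  rewrite natrM -mulrA [_ * x i j]mulrC (_ : `|denq (x i j)|%:R = (denq (x i j))%:~R); last first.
    by rewrite -[in RHS](gtz0_abs (denq_gt0 (x i j))).
  by rewrite -numqE intrM.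
by rewrite numq_int.
Qed.

(** The support of the matrix multiplication tensor, the entry (i, j) having index i q + j: [c] and
    [a] share the row, [b] and [c] the column, and the inner indices of [a] and [b] agree. *)
Definition tri (q c a b : nat) : bool :=
  [&& (c %/ q == a %/ q)%N, (a %% q == b %/ q)%N & (b %% q == c %% q)%N].

Lemma mulmx_delta (q : nat) (i1 m1 m2 j2 i j : 'I_q) :
  (delta_mx i1 m1 *m delta_mx m2 j2 : 'M[rat]_q) i j = [&& i == i1, m1 == m2 & j2 == j]%:R.
Proof.
rewrite mul_delta_mx_cond; case: (m1 == m2); rewrite ?mulr1n ?mulr0n mxE ?andbF //=.
by rewrite [j == _]eq_sym.
Qed.

(** The products are of forms in A and B jointly. The part of l l' that is linear in each matrix is
    l(A) l'(B) + l(B) l'(A), two bilinear terms, which doubles the length. *)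
Lemma multiplies_trilinear q (p : slp rat q) out : multiplies p out ->
  exists D (U V W : nat -> nat -> int), (0 < D)%N /\
  forall c a b, (c < q * q)%N -> (a < q * q)%N -> (b < q * q)%N ->
    \sum_(k < size p + size p) W c k * U k a * V k b = (D * tri q c a b)%N%:Z.
Proof.
case: q p out => [|q'] p out mul; first by exists 1%N, (fun _ _ => 0), (fun _ _ => 0), (fun _ _ => 0).
set q := q'.+1 in p out mul *.
have [ps sps span] := multiplies_spanned mul.
pose S := size p.
have [g gE] := choice (fun ij : 'I_q * 'I_q => span ij.1 ij.2).
pose l k := (nth 0 ps k).1; pose l' k := (nth 0 ps k).2.
have lin1 (x : 'M[rat]_q * 'M[rat]_q) i j : lin x (delta_mx i j) 0 = x.1 i j.
  rewrite /lin [X in _ + X]big1 ?addr0 => [|i' _]; last by rewrite big1 // => j' _; rewrite mxE mulr0.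
  rewrite -[RHS]lin_delta; apply: eq_bigr => i' _; apply: eq_bigr => j' _; exact: mulrC.
have lin2 (x : 'M[rat]_q * 'M[rat]_q) i j : lin x 0 (delta_mx i j) = x.2 i j.
  rewrite /lin [X in X + _]big1 ?add0r => [|i' _]; last by rewrite big1 // => j' _; rewrite mxE mulr0.
  rewrite -[RHS]lin_delta; apply: eq_bigr => i' _; apply: eq_bigr => j' _; exact: mulrC.
have lin12 (x : 'M[rat]_q * 'M[rat]_q) A B : lin x A B = lin x A 0 + lin x 0 B.
  have z (C : 'M[rat]_q) : \sum_i \sum_j C i j * (0 : 'M[rat]_q) i j = 0.
    by rewrite big1 // => i _; rewrite big1 // => j _; rewrite mxE mulr0.
  by rewrite /lin !z addr0 add0r.
have key i j i1 m1 m2 j2 :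
    \sum_(k < S) g (i, j) k * ((l k).1 i1 m1 * (l' k).2 m2 j2 + (l k).2 m2 j2 * (l' k).1 i1 m1)
    = [&& i == i1, m1 == m2 & j2 == j]%:R.
  rewrite -mulmx_delta.
  have E A B := gE (i, j) A B; rewrite /= sps in E.
  pose A : 'M[rat]_q := delta_mx i1 m1; pose Bm : 'M[rat]_q := delta_mx m2 j2.
  have z1 : (A *m (0 : 'M[rat]_q)) i j = 0 by rewrite mulmx0 mxE.
  have z2 : ((0 : 'M[rat]_q) *m Bm) i j = 0 by rewrite mul0mx mxE.
  (* Polarisation: subtracting the values at (A, 0) and (0, B), both zero, leaves the mixed
     terms. *)
  rewrite -[RHS]subr0 -[in RHS]z1 -[RHS]subr0 -[X in _ = _ - X]z2 !E -!sumrB.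
  apply: eq_bigr => k _; rewrite -!mulrBr; congr (_ * _).
  rewrite (lin12 _ A Bm) (lin12 (nth 0 ps k).2 A Bm) !lin1 !lin2 -/(l k) -/(l' k); ring.
pose row (a : nat) : 'I_q := inord (a %/ q); pose col (a : nat) : 'I_q := inord (a %% q).
pose Ur k a := if (k < S)%N then (l k).1 (row a) (col a) else (l' (k - S)%N).1 (row a) (col a).
pose Vr k b := if (k < S)%N then (l' k).2 (row b) (col b) else (l (k - S)%N).2 (row b) (col b).
pose Wr c k := g (row c, col c) (if (k < S)%N then k else (k - S)%N).
have [d1 [U [d1p UE]]] := clear_denominators Ur (S + S) (q * q).
have [d2 [V [d2p VE]]] := clear_denominators Vr (S + S) (q * q).
have [d3 [W [d3p WE]]] := clear_denominators Wr (q * q) (S + S).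
exists (d3 * d1 * d2)%N, U, V, W; split; first by rewrite !muln_gt0 d1p d2p d3p.
move=> c a b cq aq bq; apply: (@intr_inj rat).
rewrite [LHS]rmorph_sum /=.
rewrite (eq_bigr (fun k : 'I_(S + S) => (d3 * d1 * d2)%:R * (Wr c k * Ur k a * Vr k b))); last first.
  by move=> k _; rewrite !rmorphM /= -UE // -VE // -WE // ?natrM; ring.
rewrite -mulr_sumr.
have -> : ((d3 * d1 * d2 * tri q c a b)%N%:Z%:~R = (d3 * d1 * d2)%:R * (tri q c a b)%:R :> rat).
  by rewrite -natrM.
congr (_ * _); rewrite big_split_ord /= -big_split /=.
have rowE (x y : nat) : (x < q * q)%N -> (y < q * q)%N -> (row x == row y) = (x %/ q == y %/ q)%N.
  by move=> xq yq; rewrite -(inj_eq val_inj) /= !inordK // ltn_divLR.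
have colE (x y : nat) : (col x == col y) = (x %% q == y %% q)%N.
  by rewrite -(inj_eq val_inj) /= !inordK // ltn_pmod.
have colrowE (x y : nat) : (y < q * q)%N -> (col x == row y) = (x %% q == y %/ q)%N.
  by move=> yq; rewrite -(inj_eq val_inj) /= !inordK ?ltn_pmod // ltn_divLR.
rewrite /tri -rowE // -colE -colrowE // -key.
apply: eq_bigr => k _; rewrite /Wr /Ur /Vr /= ltn_ord ltnNge leq_addr /= addKn.
ring.
Qed.

(** No constant or input entry can be an output, and on the matrix units E_ii and E_ij the only
    nonzero output is (i, j). So the outputs are distinct results of operations. *)
Lemma multiplies_size q (p : slp rat q) out : multiplies p out -> (q * q <= size p)%N.
Proof.
move=> mul.
have size_eval A B vs vs' (p' : slp rat q) : slp_eval A B vs p' = Some vs' ->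
    size vs' = (size vs + size p')%N.
  elim: p' vs => [|[[op x] y] p' IH] vs /=; first by case=> <-; rewrite addn0.
  by case: field_op => // v /IH ->; rewrite size_rcons addSnnS.
have dE i j i' j' : (delta_mx i i *m delta_mx i j : 'M[rat]_q) i' j' = [&& i' == i & j == j']%:R.
  by rewrite mulmx_delta eqxx.
have outE ij : exists2 k, (k < size p)%N & out ij.1 ij.2 = Res _ _ k.
  case: ij => i j /=; case O: (out i j) => [c|i' j'|i' j'|k].
  - have [vs _ /(_ i j)] := mul 0 0; rewrite O /= mul0mx mxE => c0.
    have [vs' _ /(_ i j)] := mul (delta_mx i i) (delta_mx i j); rewrite O /= dE !eqxx c0.
    by move/eqP; rewrite eq_sym oner_eq0.
  - have [vs' _ /(_ i j)] := mul (const_mx 1) 0; rewrite O /= mulmx0 !mxE.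
    by move/eqP; rewrite oner_eq0.
  - have [vs' _ /(_ i j)] := mul 0 (const_mx 1); rewrite O /= mul0mx !mxE.
    by move/eqP; rewrite oner_eq0.
  - case: (ltnP k (size p)) => [lt|ge]; first by exists k.
    have [vs' sv /(_ i j)] := mul (delta_mx i i) (delta_mx i j).
    rewrite O /= dE !eqxx nth_default; first by move/eqP; rewrite eq_sym oner_eq0.
    by rewrite (size_eval _ _ _ _ _ sv).
have [f fP] := choice (fun ij => let: ex_intro2 k h1 h2 := outE ij in
  ex_intro (fun k : 'I_(size p) => out ij.1 ij.2 = Res _ _ k) (Ordinal h1) h2).
have injf : injective f.
  move=> [i j] [i' j'] E; have := fP (i', j'); rewrite -E -(fP (i, j)) /= => O.
  have [vs _ H] := mul (delta_mx i i) (delta_mx i j).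
  have := H i j; rewrite -O (H i' j') !dE !eqxx /=.
  by case: (eqVneq i' i) => [->|]; case: (eqVneq j j') => [->|] //= _ _ /eqP; rewrite eq_sym oner_eq0.
by have := leq_card f injf; rewrite card_prod !card_ord.
Qed.

Lemma matmul_in_ge2 (R : realType) (t : R) : matmul_in rat t -> 2 <= t.
Proof.
move=> [m [bm H]]; apply: (bigO_power_ge2 (K := 1) (N := 0) bm) => n _.
by have [p [out [le mul]]] := H n; rewrite mul1n (leq_trans (multiplies_size mul)).
Qed.

Definition trilinear_identity q r D (U V W : nat -> nat -> int) :=
  forall c a b, (c < q * q)%N -> (a < q * q)%N -> (b < q * q)%N ->
    \sum_(k < r) W c k * U k a * V k b = (D * tri q c a b)%N%:Z.

Lemma powR_unbounded (R : realType) (d M : R) N : 0 < d ->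
  exists2 n, (N <= n)%N & M <= n%:R `^ d.
Proof.
move=> d0; pose x := Num.max M 1 `^ d^-1.
have M0 : 0 < Num.max M 1 by rewrite lt_max ltr01 orbT.
exists (maxn N (Num.bound x)); first exact: leq_maxl.
apply: (@le_trans _ _ (Num.max M 1)); first by rewrite le_max lexx.
have -> : Num.max M 1 = x `^ d.
  by rewrite /x -powRrM mulVf ?lt0r_neq0 // powRr1 // ltW.
apply: ge0_ler_powR; rewrite ?nnegrE ?powR_ge0 ?ler0n ?(ltW d0) //.
apply: ltW; apply: lt_le_trans (archi_boundP (powR_ge0 _ _)) _.
by rewrite ler_nat leq_maxr.
Qed.

(** Padding with q^2 zero products ensures q^2 <= r. With s the size of the program, 2r = 4s + 2q^2
    <= (4C + 2) q^t, and for large q the constant is at most q^(t'-t). *)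
Lemma matmul_trilinear (R : realType) (t t' : R) : matmul_in rat t -> t < t' ->
  exists q r D U V W, [/\ (2 <= q)%N, (0 < D)%N, (q * q <= r)%N,
    trilinear_identity q r D U V W & (2 * r)%:R <= q%:R `^ t' :> R].
Proof.
move=> mt tt'; have t2 := matmul_in_ge2 mt; have [m [/bigO_powerP[C [N bm]] H]] := mt.
have d0 : 0 < t' - t by rewrite subr_gt0.
have [q qN qd] := powR_unbounded (4 * C + 2) (maxn 2 N) d0.
have q2 : (2 <= q)%N by lia.
have {}qN : (N <= q)%N by lia.
have [p [out [le mul]]] := H q.
have [D [U [V [W [D0 E]]]]] := multiplies_trilinear mul.
pose S := (size p + size p)%N.
exists q, (S + q * q)%N, D, (fun k a => if (k < S)%N then U k a else 0), V, W; split=> //.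
- exact: leq_addl.
- move=> c a b cq aq bq; rewrite -E // big_split_ord /= [X in _ + X]big1 ?addr0.
    by apply: eq_bigr => k _; rewrite ltn_ord.
  by move=> k _; rewrite ltnNge leq_addr /= mulr0 mul0r.
have q0 : 0 < q%:R :> R by rewrite ltr0n; lia.
have q1 : 1 <= q%:R :> R by rewrite ler1n; lia.
have -> : t' = (t' - t) + t by rewrite subrK.
rewrite powRD; last by rewrite (gt_eqF q0) implybT.
apply: (@le_trans _ _ ((4 * C + 2) * q%:R `^ t)); last by rewrite ler_wpM2r ?powR_ge0.
rewrite mulrDl -mulrA.
have h1 : (size p)%:R <= C * q%:R `^ t by apply: le_trans (bm q qN); rewrite ler_nat.
have h2 : q%:R * q%:R <= q%:R `^ t :> R.
  apply: le_trans (_ : q%:R `^ 2 <= _); last exact: ler_powR.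
  by rewrite powR_mulrn ?ler0n // expr2.
rewrite /S !(natrD, natrM); lra.
Qed.

(** * Tensor powers of a bilinear identity *)

(* An index of the L-th tensor power is a number of L digits in base r or p; the
   pass number l of [yates] replaces one leading base-p digit by one trailing
   base-r digit, so that after L passes the digits are back in order. *)
Fixpoint tens (M : nat -> nat -> int) r p L k a : int :=
  if L is L'.+1 then tens M r p L' (k %/ r)%N (a %/ p)%N * M (k %% r)%N (a %% p)%N else 1.

Definition pass (M : nat -> nat -> int) r p h (x : nat -> int) i : int :=
  \sum_(a < p) M (i %% r)%N a * x (a * h + i %/ r)%N.

Definition pass_step r p L l := (p ^ (L - l.+1) * r ^ l)%N.

Fixpoint yates M r p L (x : nat -> int) l : nat -> int :=
  if l is l'.+1 then pass M r p (pass_step r p L l') (yates M r p L x l') else x.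

Lemma sum_ord_mul (F : nat -> int) m r :
  \sum_(k < m * r) F k = \sum_(i < m) \sum_(j < r) F (i * r + j)%N.
Proof.
elim: m => [|m IH]; first by rewrite !big_ord0.
by rewrite big_ord_recr /= mulSnr big_split_ord IH.
Qed.

(** After l passes the leading digits [b] have been summed out in favour of the trailing digits [k],
    while [a] stands for the digits not yet treated. *)
Lemma yatesE M r p L x l k a : (0 < r)%N -> (l <= L)%N -> (k < r ^ l)%N -> (a < p ^ (L - l))%N ->
  yates M r p L x l (a * r ^ l + k)%N =
  \sum_(b < p ^ l) tens M r p l k b * x (b * p ^ (L - l) + a)%N.
Proof.
move=> r0; elim: l k a => [|l IH] k a lL; rewrite ?expn0 ?subn0.
  case: k => // _ _; rewrite big_ord_recr big_ord0 /= mul1r add0r.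
  by congr x; lia.
move=> kr ap /=; rewrite /pass.
have E0 : (a * r ^ l.+1 + k)%N = ((a * r ^ l + k %/ r) * r + k %% r)%N.
  by rewrite expnSr {1}(divn_eq k r); lia.
have E1 : ((a * r ^ l.+1 + k) %% r)%N = (k %% r)%N by rewrite E0 modnMDl modn_mod.
have E2 : ((a * r ^ l.+1 + k) %/ r)%N = (a * r ^ l + k %/ r)%N.
  by rewrite E0 divnMDl // (divn_small (ltn_pmod k r0)) addn0.
rewrite E1 E2 (expnSr p l) (sum_ord_mul (fun b => tens M r p l (k %/ r)%N (b %/ p)%N *
  M (k %% r)%N (b %% p)%N * x (b * p ^ (L - l.+1) + a)%N)) exchange_big /=.
apply: eq_bigr => d _.
have Lp : (p ^ (L - l) = p * p ^ (L - l.+1))%N by rewrite -expnS; congr expn; lia.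
have -> : (d * pass_step r p L l + (a * r ^ l + k %/ r) =
    (d * p ^ (L - l.+1) + a) * r ^ l + k %/ r)%N by rewrite /pass_step; lia.
rewrite IH //; first last.
- rewrite Lp; have := ltn_ord d; nia.
- by rewrite ltn_divLR // -expnSr.
- exact: ltnW.
rewrite mulr_sumr; apply: eq_bigr => b _.
have p0 : (0 < p)%N by exact: leq_ltn_trans (ltn_ord d).
rewrite divnMDl // (divn_small (ltn_ord d)) addn0 modnMDl (modn_small (ltn_ord d)).
rewrite mulrCA mulrA; congr (_ * x _).
by rewrite Lp; lia.
Qed.

Lemma yates_final M r p L x k : (0 < r)%N -> (k < r ^ L)%N ->
  yates M r p L x L k = \sum_(b < p ^ L) tens M r p L k b * x b.
Proof.
move=> r0 kr; have := @yatesE M r p L x L k 0 r0 (leqnn _) kr.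
rewrite subnn expn0 mul0n add0n => -> //.
by apply: eq_bigr => b _; rewrite muln1 addn0.
Qed.

Lemma pass_bound M r p h x mu X : (0 < r)%N ->
  (forall k a, (k < r)%N -> (a < p)%N -> `|M k a| <= mu%:Z) ->
  (forall i, (i < p * h)%N -> `|x i| <= X%:Z) ->
  forall i, (i < h * r)%N -> `|pass M r p h x i| <= (p * mu * X)%N%:Z.
Proof.
move=> r0 Mb xb i ih; apply: le_trans (ler_norm_sum _ _ _) _.
rewrite (_ : (p * mu * X)%N%:Z = \sum_(a < p) (mu%:Z * X%:Z)); last first.
  by rewrite sumr_const card_ord -mulr_natl -mulnA !PoszM natz.
apply: ler_sum => a _; rewrite normrM ler_pM //.
  by apply: Mb => //; rewrite ltn_pmod.
apply: xb; have : (i %/ r < h)%N by rewrite ltn_divLR.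
have := ltn_ord a; nia.
Qed.

Fixpoint tri_power (q L c a b : nat) : bool :=
  if L is L'.+1 then
    tri_power q L' (c %/ (q * q))%N (a %/ (q * q))%N (b %/ (q * q))%N &&
    tri q (c %% (q * q)) (a %% (q * q)) (b %% (q * q))
  else true.

(** The sum over k factors over its base-r digits, and each factor is an instance of the base
    identity. *)
Lemma tens_trilinear q r D U V W L c a b : (0 < q)%N -> (0 < r)%N ->
  trilinear_identity q r D U V W ->
  \sum_(k < r ^ L) tens W (q * q) r L c k * tens U r (q * q) L k a * tens V r (q * q) L k b
    = (D ^ L * tri_power q L c a b)%N%:Z.
Proof.
move=> q0 r0 id; have p0 : (0 < q * q)%N by rewrite muln_gt0 q0.
elim: L c a b => [|L IH] c a b; first by rewrite big_ord_recr big_ord0.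
rewrite (expnSr r) (sum_ord_mul (fun k => tens W (q * q) r L.+1 c k *
  tens U r (q * q) L.+1 k a * tens V r (q * q) L.+1 k b)).
transitivity ((\sum_(k < r ^ L) tens W (q * q) r L (c %/ (q * q)) k *
    tens U r (q * q) L k (a %/ (q * q)) * tens V r (q * q) L k (b %/ (q * q))) *
   (\sum_(j < r) W (c %% (q * q))%N j * U j (a %% (q * q))%N * V j (b %% (q * q))%N)).
  rewrite mulr_suml; apply: eq_bigr => k _; rewrite mulr_sumr; apply: eq_bigr => j _ /=.
  rewrite divnMDl // (divn_small (ltn_ord j)) addn0 modnMDl (modn_small (ltn_ord j)); ring.
rewrite IH id ?ltn_pmod // -PoszM; congr Posz.
by rewrite expnSr /= -mulnb mulnACA.
Qed.

(* [interleave q L i j] is the index in the L-th tensor power of the entry (i, j):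
   the base-q digits of i and j alternate. *)
Fixpoint spread (q L i : nat) : nat :=
  if L is L'.+1 then (spread q L' (i %/ q)%N * (q * q) + i %% q)%N else 0%N.

Definition interleave q L i j := (q * spread q L i + spread q L j)%N.

Lemma spread0 q L : spread q L 0 = 0%N.
Proof. by elim: L => //= L; rewrite div0n mod0n => ->. Qed.

Lemma spread_stable q L i : (0 < q)%N -> (i < q ^ L)%N -> spread q L.+1 i = spread q L i.
Proof.
move=> q0; elim: L i => [|L IH] i.
  by rewrite expn0; case: i => //= _; rewrite ?div0n ?mod0n.
by rewrite expnSr -ltn_divLR // => /IH E; rewrite -[LHS]/(spread q L.+1 (i %/ q) * (q * q) + i %% q)%N E.
Qed.

Lemma interleaveS q L i j : interleave q L.+1 i j =
  (interleave q L (i %/ q) (j %/ q) * (q * q) + (q * (i %% q) + j %% q))%N.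
Proof. by rewrite /interleave /=; lia. Qed.

Lemma digits_lt q i j : (0 < q)%N -> (q * (i %% q) + j %% q < q * q)%N.
Proof. by move=> q0; have := ltn_pmod i q0; have := ltn_pmod j q0; nia. Qed.

Lemma interleave_div q L i j : (0 < q)%N ->
  (interleave q L.+1 i j %/ (q * q))%N = interleave q L (i %/ q) (j %/ q).
Proof.
by move=> q0; rewrite interleaveS divnMDl ?muln_gt0 ?q0 // (divn_small (digits_lt i j q0)) addn0.
Qed.

Lemma interleave_mod q L i j : (0 < q)%N ->
  (interleave q L.+1 i j %% (q * q))%N = (q * (i %% q) + j %% q)%N.
Proof. by move=> q0; rewrite interleaveS modnMDl (modn_small (digits_lt i j q0)). Qed.

Lemma interleave_lt q L i j : (0 < q)%N -> (interleave q L i j < (q * q) ^ L)%N.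
Proof.
move=> q0; elim: L i j => [|L IH] i j; first by rewrite /interleave muln0.
by rewrite expnSr -ltn_divLR ?muln_gt0 ?q0 // interleave_div.
Qed.

Lemma eq_divmod q i j : (i == j) = (i %/ q == j %/ q)%N && (i %% q == j %% q)%N.
Proof.
apply/eqP/andP => [->|[/eqP E1 /eqP E2]]; first by rewrite !eqxx.
by rewrite (divn_eq i q) E1 E2 -divn_eq.
Qed.

Lemma tri_digits q c c' a a' b b' : (c' < q)%N -> (a' < q)%N -> (b' < q)%N ->
  tri q (q * c + c') (q * a + a') (q * b + b') = [&& c == a, a' == b & b' == c'].
Proof.
move=> h1 h2 h3; have q0 : (0 < q)%N by exact: leq_ltn_trans h1.
by rewrite /tri ![(q * _)%N]mulnC !divnMDl // !divn_small // !addn0 !modnMDl !modn_small.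
Qed.

(** Each base-q^2 digit of an interleaved index is the position of an entry in a q x q matrix, so
    the conditions of [tri] on all digits add up to equalities of the whole indices. *)
Lemma tri_interleave q L i j i1 m1 m2 j2 : (0 < q)%N ->
  (i < q ^ L)%N -> (j < q ^ L)%N -> (i1 < q ^ L)%N -> (m1 < q ^ L)%N -> (m2 < q ^ L)%N ->
  (j2 < q ^ L)%N ->
  tri_power q L (interleave q L i j) (interleave q L i1 m1) (interleave q L m2 j2)
    = [&& i == i1, m1 == m2 & j2 == j].
Proof.
move=> q0; elim: L i j i1 m1 m2 j2 => [|L IH] i j i1 m1 m2 j2.
  by rewrite expn0 !ltnS !leqn0 => /eqP -> /eqP -> /eqP -> /eqP -> /eqP -> /eqP ->.
rewrite expnSr -!ltn_divLR // => h1 h2 h3 h4 h5 h6.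
rewrite [LHS]/= !interleave_div // !interleave_mod // IH // tri_digits ?ltn_pmod //.
rewrite (eq_divmod q i i1) (eq_divmod q m1 m2) (eq_divmod q j2 j).
by do 6 case: (_ == _).
Qed.

Lemma interleave_inj q L i j i' j' : (0 < q)%N ->
  (i < q ^ L)%N -> (j < q ^ L)%N -> (i' < q ^ L)%N -> (j' < q ^ L)%N ->
  interleave q L i j = interleave q L i' j' -> i = i' /\ j = j'.
Proof.
move=> q0; elim: L i j i' j' => [|L IH] i j i' j'.
  by rewrite expn0 !ltnS !leqn0 => /eqP -> /eqP -> /eqP -> /eqP ->.
rewrite expnSr -!ltn_divLR // => h1 h2 h3 h4 E.
have [E1 E2] : (i %/ q = i' %/ q)%N /\ (j %/ q = j' %/ q)%N.
  by apply: IH => //; rewrite -!interleave_div // E.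
have E3 : (q * (i %% q) + j %% q = q * (i' %% q) + j' %% q)%N by rewrite -!(interleave_mod L) // E.
have E4 : (i %% q = i' %% q)%N.
  have := congr1 (fun k => (k %/ q)%N) E3; rewrite ![(q * _)%N]mulnC !divnMDl //.
  by rewrite !(divn_small (ltn_pmod _ q0)) !addn0.
have E5 : (j %% q = j' %% q)%N by move: E3; rewrite E4 => /addnI.
by split; apply/eqP; rewrite (eq_divmod q) ?E1 ?E2 ?E4 ?E5 !eqxx.
Qed.

Lemma sum_interleave q L (F : nat -> int) : (0 < q)%N ->
  \sum_(a < (q * q) ^ L) F a = \sum_(i < q ^ L) \sum_(j < q ^ L) F (interleave q L i j).
Proof.
move=> q0; elim: L F => [|L IH] F.
  by rewrite (big_ord_recl 0) big_ord0 (big_ord_recl 0) big_ord0 (big_ord_recl 0) big_ord0 !addr0 /interleave muln0.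
rewrite (expnSr (q * q)) (sum_ord_mul F).
rewrite (IH (fun i => \sum_(j < q * q) F (i * (q * q) + j)%N)) (expnSr q).
rewrite (sum_ord_mul (fun i => \sum_(j < q ^ L * q) F (interleave q L.+1 i j))).
apply: eq_bigr => i _.
transitivity (\sum_(j < q ^ L) \sum_(i0 < q) \sum_(j0 < q)
   F (interleave q L i j * (q * q) + (i0 * q + j0))%N).
  by apply: eq_bigr => j _; rewrite (sum_ord_mul (fun d => F (interleave q L i j * (q * q) + d)%N)).
rewrite exchange_big; apply: eq_bigr => i0 _.
rewrite (sum_ord_mul (fun j => F (interleave q L.+1 (i * q + i0) j))).
apply: eq_bigr => j _; apply: eq_bigr => j0 _; congr F.
rewrite interleaveS !divnMDl // (divn_small (ltn_ord i0)) (divn_small (ltn_ord j0)) !addn0.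
by rewrite !modnMDl (modn_small (ltn_ord i0)) (modn_small (ltn_ord j0)) [(i0 * q)%N]mulnC.
Qed.

(** Expanding the products and exchanging sums leaves the tensor of order q^L, which selects the
    terms of the matrix product. The factor D^L is removed later by an exact division. *)
Lemma fast_product q r D U V W L (A B : nat -> nat -> int) x y i j :
  (0 < q)%N -> (0 < r)%N -> trilinear_identity q r D U V W ->
  (forall i j, (i < q ^ L)%N -> (j < q ^ L)%N -> x (interleave q L i j) = A i j) ->
  (forall i j, (i < q ^ L)%N -> (j < q ^ L)%N -> y (interleave q L i j) = B i j) ->
  (i < q ^ L)%N -> (j < q ^ L)%N ->
  \sum_(k < r ^ L) tens W (q * q) r L (interleave q L i j) k *
    ((\sum_(a < (q * q) ^ L) tens U r (q * q) L k a * x a) *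
     (\sum_(b < (q * q) ^ L) tens V r (q * q) L k b * y b))
  = (D ^ L)%N%:Z * \sum_(m < q ^ L) A i m * B m j.
Proof.
move=> q0 r0 id xA yB iL jL.
set c := interleave q L i j.
transitivity (\sum_(a < (q * q) ^ L) \sum_(b < (q * q) ^ L)
   (D ^ L * tri_power q L c a b)%N%:Z * (x a * y b)).
  transitivity (\sum_(k < r ^ L) \sum_(a < (q * q) ^ L) \sum_(b < (q * q) ^ L)
     tens W (q * q) r L c k * tens U r (q * q) L k a * tens V r (q * q) L k b * (x a * y b)).
    apply: eq_bigr => k _; rewrite mulr_suml mulr_sumr; apply: eq_bigr => a _.
    rewrite mulr_sumr mulr_sumr; apply: eq_bigr => b _; ring.
  rewrite exchange_big; apply: eq_bigr => a _.
  rewrite exchange_big; apply: eq_bigr => b _.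
  by rewrite -mulr_suml (tens_trilinear L c a b q0 r0 id).
pose G a b : int := (D ^ L * tri_power q L c a b)%N%:Z * (x a * y b).
rewrite (sum_interleave L (fun a => \sum_(b < (q * q) ^ L) G a b) q0).
transitivity (\sum_(i1 < q ^ L) \sum_(m < q ^ L) \sum_(m2 < q ^ L) \sum_(j2 < q ^ L)
    (D ^ L * [&& i == i1, m == m2 :> nat & j2 == j :> nat])%N%:Z * (A i1 m * B m2 j2)).
  apply: eq_bigr => i1 _; apply: eq_bigr => m _; rewrite (sum_interleave L (G _) q0).
  apply: eq_bigr => m2 _; apply: eq_bigr => j2 _.
  by rewrite /G /c tri_interleave // xA // yB.
rewrite (bigD1 (Ordinal iL)) //= [X in _ + X]big1 ?addr0; last first.
  move=> i1 ne; rewrite big1 // => m _; rewrite big1 // => m2 _; rewrite big1 // => j2 _.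
  by rewrite [i == i1]eq_sym -[i1 == i :> nat]/(i1 == Ordinal iL) (negbTE ne) muln0 mul0r.
rewrite mulr_sumr; apply: eq_bigr => m _.
rewrite (bigD1 m) //= [X in _ + X]big1 ?addr0; last first.
  move=> m2 ne; rewrite big1 // => j2 _.
  by rewrite [m == m2 :> nat]eq_sym -[m2 == m :> nat]/(m2 == m) (negbTE ne) andbF muln0 mul0r.
rewrite (bigD1 (Ordinal jL)) //= [X in _ + X]big1 ?addr0; last first.
  by move=> j2 ne; rewrite -[j2 == j :> nat]/(j2 == Ordinal jL) (negbTE ne) !andbF muln0 mul0r.
by rewrite !eqxx muln1.
Qed.

(** * The counting program *)

(* Memory layout: arrays 4 and 5 hold the transformed vector, array 6 the values of
   [spread], array 7 the first factor, arrays 8, 9, 10 the coefficients U, V, W.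
   Variables: 12 current length, 14 L, 15 q^L, 16 D^L, 17 (q^2)^L, 19 trace of the
   fourth power, 20 and 21 the sums of d(d-1)(d-2) over out- and in-degrees. *)
Definition pass_cmd t p r : cmd :=
  13 <-- $12 '/ #(Posz p) ;;
  For 2 $13 (For 3 #(Posz r)
    (6 <-- #0 ;;
     For 5 #(Posz p)
       (6 <-- $6 '+ Arr t ($3 '* #(Posz p) '+ $5) '* Arr 4 ($5 '* $13 '+ $2)) ;;
     Store 5 ($2 '* #(Posz r) '+ $3) $6)) ;;
  12 <-- $13 '* #(Posz r) ;;
  For 2 $12 (Store 4 $2 (Arr 5 $2)).

Definition yates_cmd t p r : cmd := For 1 $14 (pass_cmd t p r).

Lemma small_nat B i : (i <= B)%N -> small B i%:Z.
Proof. by []. Qed.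

Lemma small_index B i N : (i < N)%N -> (16 * N + 16 <= B)%N -> small B (16%:Z * i%:Z + 16%:Z).
Proof. by rewrite /small; lia. Qed.

Lemma small_norm B (z : int) N : `|z| <= N%:Z -> (N <= B)%N -> small B z.
Proof. by rewrite /small; lia. Qed.

Lemma leq_expl a b i : (a <= b)%N -> (a ^ i <= b ^ i)%N.
Proof. by case: i => [|i]; rewrite ?expn0 // leq_exp2r. Qed.

Section Yates.
Variables (B : nat) (inp : int -> int) (M : nat -> nat -> int) (t p r mu : nat).
Hypotheses (t16 : (t < 16)%N) (t4 : t != 4%N) (t5 : t != 5%N).
Hypotheses (p0 : (0 < p)%N) (r0 : (0 < r)%N) (mu0 : (0 < mu)%N).
Hypothesis Mmu : forall k a, (k < r)%N -> (a < p)%N -> `|M k a| <= mu%:Z.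
Hypothesis prB : (16 * (r * p) + 16 <= B)%N.

Definition holds_table (s : store) :=
  forall k a, (k < r)%N -> (a < p)%N -> arr s t (k * p + a)%N = M k a.

Lemma pass_spec s h (y : nat -> int) Y :
  var s 12 = (p * h)%N -> holds_table s ->
  (forall i, (i < p * h)%N -> arr s 4 i = y i) ->
  (forall i, (i < p * h)%N -> `|y i| <= Y%:Z) ->
  (p * mu * Y <= B)%N -> (16 * (p * h) + 16 <= B)%N -> (16 * (h * r) + 16 <= B)%N ->
  trip B inp (pass_cmd t p r) s (100 * (p + 1) * (r + 1) * (h + 1))
    (fun s' => var s' 12 = (h * r)%N /\
       forall i, (i < h * r)%N -> arr s' 4 i = pass M r p h y i).
Proof.
move=> s12 tab y4 yY YB phB hrB.
have pB : (p <= B)%N by nia.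
have rB : (r <= B)%N by nia.
apply: trip_le.
- have E13 : (var s 12 %/ p%:Z)%Z = h by rewrite s12 divz_nat mulKn.
  apply: trip_seq; apply: trip_set.
    by rewrite /= E13 /small; split=> //; nia.
  rewrite /= E13; set s1 := setv s 13 h.
  apply: trip_seq; apply: trip_weaken.
  + apply: (@trip_for _ _ _ _ _ _ _ h (fun b s' => forall i, (i < b * r)%N ->
      arr s' 5 i = pass M r p h y i)) => //=.
    move=> b s2 bh I2 K2; apply: trip_weaken.
    * apply: (@trip_for _ _ _ _ _ _ _ r (fun k s' => forall i, (i < b * r + k)%N ->
        arr s' 5 i = pass M r p h y i)) => //=.
        by move=> i; rewrite addn0; apply: I2.
      move=> k s3 kr I3 K3.
      apply: trip_seq; apply: trip_set => //=.
      apply: trip_seq; apply: trip_weaken.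
      -- apply: (@trip_for _ _ _ _ _ _ _ p (fun a s' => var s' 6 =
           \sum_(a' < a) M k a' * y (a' * h + b)%N)) => //=.
           by rewrite big_ord0.
         move=> a s4 ap I4 K4.
         have /= s43 := K4.1 3 isT.
         have /= s413 := K4.1 13 isT; rewrite (K3.1 13 isT) /= (K2.1 13 isT) /= in s413.
         have /= s42 := K4.1 2 isT; rewrite (K3.1 2 isT) /= in s42.
         have s4t : arr s4 t (k * p + a)%N = M k a.
           by rewrite (K4.2 t) //= (K3.2 t) //= (K2.2 t) //= tab.
         have s44 : arr s4 4 (a * h + b)%N = y (a * h + b)%N.
           rewrite (K4.2 4 _ isT) /= (K3.2 4 _ isT) /= (K2.2 4 _ isT) /= y4 //; nia.
         have i1 : (k * p + a < r * p)%N by nia.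
         have i2 : (a * h + b < p * h)%N by nia.
         have v1 := Mmu kr ap.
         have v2 := yY _ i2.
         have v3 : `|M k a * y (a * h + b)%N| <= (mu * Y)%N%:Z by rewrite normrM PoszM ler_pM.
         have v4 : `|\sum_(a' < a) M k a' * y (a' * h + b)%N| <= (a * (mu * Y))%N%:Z.
           apply: le_trans (ler_norm_sum _ _ _) _.
           apply: (@le_trans _ _ (\sum_(a' < a) (mu * Y)%N%:Z)).
             apply: ler_sum => a' _; rewrite normrM PoszM; apply: ler_pM => //.
               by apply: Mmu => //; exact: ltn_trans ap.
             by apply: yY; have := ltn_ord a'; nia.
           by rewrite sumr_const card_ord -mulr_natl PoszM natz.
         have v5 : (a.+1 * (mu * Y) <= B)%N by apply: leq_trans YB; rewrite -mulnA leq_mul2r ap orbT.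
         have E1 : k%:Z * p%:Z + a%:Z = (k * p + a)%N by lia.
         have E2 : a%:Z * h%:Z + b%:Z = (a * h + b)%N by lia.
         apply: trip_set => /=.
           rewrite s43 s413 s42 E1 E2 /= s4t s44 I4.
           have linear_fits : (r * p <= B)%N by apply: leq_trans prB; rewrite mulSn -addnA leq_addr.
           have square_fits : (p * h <= B)%N by apply: leq_trans phB; rewrite mulSn -addnA leq_addr.
           rewrite -!PoszM; split.
           -- by split.
           -- split.
              ++ split; rewrite ?E1; [|by []|by []|exact: small_index i1 prB].
                 split; [|by []|exact: small_nat (leq_trans (ltnW i1) linear_fits)].
                 split; [by []|exact: small_nat pB|].
                 by apply: small_nat; apply: leq_trans linear_fits; rewrite leq_mul2r (ltnW kr) orbT.
              ++ split; [|by []|by []|exact: small_index i2 phB].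
                 split; [|by []|exact: small_nat (leq_trans (ltnW i2) square_fits)].
                 split; [by []|by []|].
                 by apply: small_nat; apply: leq_trans square_fits; rewrite leq_mul2r (ltnW ap) orbT.
              ++ apply: (small_norm v3); apply: leq_trans YB.
                 by rewrite -mulnA leq_pmull.
           -- apply: (small_norm _ v5); apply: le_trans (ler_normD _ _) _.
              by rewrite mulSn PoszD addrC lerD.
         by rewrite s43 s413 s42 E1 E2 /= s4t s44 I4 big_ord_recr.
      -- exact: leqnn.
      move=> s4 K4 I4.
      have /= s43 := K4.1 3 isT.
      have /= s42 := K4.1 2 isT; rewrite (K3.1 2 isT) /= in s42.
      have i1 : (b * r + k < h * r)%N by nia.
      have E1 : b%:Z * r%:Z + k%:Z = (b * r + k)%N by lia.
      have E2 : b%:Z * r%:Z = (b * r)%N by lia.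
      apply: trip_store => //=.
      ++ rewrite s42 s43 E1 E2 /small; move: (b * r + k)%N (b * r)%N i1 (leq_addr k (b * r)%N) => I J i1 i2.
         by repeat split=> //; lia.
      ++ move=> i ib; rewrite s42 s43 E1 /=.
         case: eqP => [->|ne]; last by rewrite (K4.2 5 _ isT) /= I3 //; lia.
         rewrite I4 /pass modnMDl modn_small // divnMDl // divn_small // addn0.
         by [].
    * exact: leqnn.
    * by move=> s3 K3 I3 i; rewrite mulSn addnC; apply: I3.
  + exact: leqnn.
  move=> s2 K2 I2; have /= s213 := K2.1 13 isT.
  have E2 : var s2 13 * r%:Z = (h * r)%N by rewrite s213; lia.
  apply: trip_seq; apply: trip_set.
    by rewrite /= E2 /small; split=> //; lia.
  rewrite [ev _ _ _]/= E2.
  apply: trip_weaken.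
  + apply: (@trip_for _ _ _ _ _ _ _ (h * r) (fun b s' => forall i, (i < b)%N ->
      arr s' 4 i = pass M r p h y i)) => //=.
    move=> b s3 bh I3 K3.
    apply: trip_store => //=.
    * by rewrite /small; repeat split=> //; lia.
    * by rewrite /small; repeat split=> //; lia.
    * move=> i ib; case: eqP => [->|ne]; first by rewrite (K3.2 5 _ isT) /= I2.
      by apply: I3; lia.
  + exact: leqnn.
  + by move=> s3 K3 I3; split=> //; rewrite (K3.1 12 isT).
- have : (h * r <= (h + 1) * (r + 1))%N by nia.
  rewrite /= ![(_ * (h + 1))%N]mulnC; nia.
Qed.

(** The intermediate lengths p^(L-l) r^l stay below m^L for any common bound m of p and r, and the
    values grow by a factor p mu in each pass. *)
Lemma yates_spec s m L X (x : nat -> int) :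
  (p <= m)%N -> (r <= m)%N -> (0 < X)%N -> (16 * m ^ L + 16 <= B)%N ->
  ((p * mu) ^ L * X <= B)%N ->
  var s 14 = L%:Z -> var s 12 = (p ^ L)%N -> holds_table s ->
  (forall i, (i < p ^ L)%N -> arr s 4 i = x i) ->
  (forall i, (i < p ^ L)%N -> `|x i| <= X%:Z) ->
  trip B inp (yates_cmd t p r) s (L * (100 * (p + 1) * (r + 1) * (m ^ L + 1) + 6) + 6)
    (fun s' => var s' 12 = (r ^ L)%N /\ forall i, (i < r ^ L)%N ->
       arr s' 4 i = \sum_(b < p ^ L) tens M r p L i b * x b /\
       `|arr s' 4 i| <= ((p * mu) ^ L * X)%N).
Proof.
move=> pm rm X0 mB XB s14 s12 tab x4 xX.
have m0 : (0 < m)%N by exact: leq_trans pm.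
have pmu : (0 < p * mu)%N by rewrite muln_gt0 p0.
have sz i j : (i + j <= L)%N -> (p ^ i * r ^ j <= m ^ L)%N.
  move=> ij; apply: (@leq_trans (m ^ i * m ^ j)); first by rewrite leq_mul // leq_expl.
  by rewrite -expnD leq_pexp2l.
apply: trip_weaken.
- apply: (@trip_for _ _ _ _ _ _ _ L (fun l s' => 
    [/\ var s' 12 = (p ^ (L - l) * r ^ l)%N,
      forall i, (i < p ^ (L - l) * r ^ l)%N -> arr s' 4 i = yates M r p L x l i &
      forall i, (i < p ^ (L - l) * r ^ l)%N -> `|yates M r p L x l i| <= ((p * mu) ^ l * X)%N])) => //=.
    by rewrite subn0 expn0 muln1 mul1n.
  move=> l s1 lL [I1 I2 I3] K1.
  have pE : (p ^ (L - l) * r ^ l = p * pass_step r p L l)%N.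
    by rewrite /pass_step mulnA -expnS; congr (_ ^ _ * _)%N; lia.
  have rE : (p ^ (L - l.+1) * r ^ l.+1 = pass_step r p L l * r)%N by rewrite /pass_step expnSr mulnA.
  have Yl : (p * mu * ((p * mu) ^ l * X) <= (p * mu) ^ L * X)%N.
    by rewrite mulnA -expnS leq_mul2r leq_pexp2l // orbT.
  rewrite pE in I1 I2 I3; rewrite rE.
  apply: trip_weaken.
  + apply: (@pass_spec _ (pass_step r p L l) (yates M r p L x l) ((p * mu) ^ l * X)%N) => //=.
    * by move=> k a kr ap; rewrite (K1.2 t) /= ?tab //; case: (t =P 4%N) t4 => //; case: (t =P 5%N) t5.
    * exact: leq_trans XB.
    * by apply: leq_trans mB; rewrite leq_add2r leq_mul2l -pE sz; lia.
    * by apply: leq_trans mB; rewrite leq_add2r leq_mul2l -rE sz; lia.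
  + have : (pass_step r p L l <= m ^ L)%N by rewrite /pass_step sz; lia.
    move=> le; apply: (@leq_trans (100 * (p + 1) * (r + 1) * (m ^ L + 1))); last exact: leqnn.
    by rewrite leq_mul2l leq_add2r le orbT.
  + move=> s2 K2 [J1 J2]; split=> // i ih.
    by rewrite expnS -mulnA; apply: (pass_bound r0 Mmu I3 ih).
- by rewrite /=; lia.
- move=> s1 _ [I1 I2 I3]; rewrite subnn expn0 mul1n in I1 I2 I3; split=> // i ir.
  by rewrite I2 // yates_final // -yates_final // I3.
Qed.
End Yates.

(** Shows that loading a matrix determines all (q^2)^L cells, so that a bound on its entries bounds
    the whole vector. *)
Lemma interleave_surj q L c : (0 < q)%N -> (c < (q * q) ^ L)%N ->
  exists i j, [/\ (i < q ^ L)%N, (j < q ^ L)%N & c = interleave q L i j].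
Proof.
move=> q0; elim: L c => [|L IH] c.
  by rewrite expn0; case: c => // _; exists 0%N, 0%N; rewrite /interleave muln0.
have qq0 : (0 < q * q)%N by rewrite muln_gt0 q0.
rewrite expnSr -ltn_divLR // => /IH[i [j [iL jL E]]].
pose d := (c %% (q * q))%N; have dq : (d %/ q < q)%N by rewrite ltn_divLR // ltn_pmod.
have lt x y : (x < q ^ L)%N -> (y < q)%N -> (x * q + y < q ^ L * q)%N.
  move=> xL yq; apply: (@leq_trans (x.+1 * q)); last by rewrite leq_mul2r xL orbT.
  by rewrite mulSn addnC ltn_add2r.
exists (i * q + d %/ q)%N, (j * q + d %% q)%N; split.
- by rewrite expnSr lt.
- by rewrite expnSr lt // ltn_pmod.
rewrite interleaveS !divnMDl // (divn_small dq) (divn_small (ltn_pmod d q0)) !addn0 -E.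
rewrite !modnMDl (modn_small dq) modn_mod {1}(divn_eq c (q * q)) -/d; congr addn.
by rewrite {1}(divn_eq d q) [(q * _)%N]mulnC.
Qed.

Lemma spread_lt q L i : (0 < q)%N -> (spread q L i < (q * q) ^ L)%N.
Proof. by move=> q0; have := interleave_lt L 0 i q0; rewrite /interleave spread0 muln0. Qed.

(** The coefficient tables do not depend on n, so they are unrolled into stores of constants. *)
Fixpoint fill t (F : nat -> int) k : cmd :=
  if k is k'.+1 then fill t F k' ;; Store t #(Posz k') #(F k') else Skip.

Lemma modv_fill t F k y : modv (fill t F k) y = false.
Proof. by elim: k => //= k ->. Qed.

Lemma moda_fill t F k t' : t' != t -> moda (fill t F k) t' = false.
Proof. by move=> ne; elim: k => //= k ->; apply/negbTE. Qed.

Lemma fill_spec B inp t F k s : (t < 16)%N -> (16 * k + 16 <= B)%N ->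
  (forall i, (i < k)%N -> small B (F i)) ->
  trip B inp (fill t F k) s (k * 7) (fun s' => forall i, (i < k)%N -> arr s' t i = F i).
Proof.
move=> t16; elim: k => [|k IH] kB FB; first exact: trip_skip.
apply: trip_le.
  apply: trip_seq; apply: trip_weaken.
  - by apply: IH => [|i ik]; [lia | apply: FB; exact: ltnW].
  - exact: leqnn.
  move=> s1 _ I1; apply: trip_store => //=.
  - by rewrite /small; repeat split=> //; lia.
  - exact: FB.
  move=> i ik; rewrite eqxx /=; case: eqP => [-> //|ne]; apply: I1; lia.
by rewrite /=; lia.
Qed.

(** Loops have no early exit, so n rounds are made, which do nothing once n <= q^L. They suffice
    because n <= q^n. *)
Definition setup_cmd (q D : nat) : cmd :=
  14 <-- #0 ;; 15 <-- #1 ;; 16 <-- #1 ;; 17 <-- #1 ;;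
  For 1 $0 (IfLe $0 $15 Skip
    (14 <-- $14 '+ #1 ;; 15 <-- $15 '* #(Posz q) ;; 16 <-- $16 '* #(Posz D) ;;
     17 <-- $17 '* #(Posz (q * q)))).

(** The table is filled in increasing order, the entry at k/q being known by then; k mod q is
    computed as k - (k/q) q. Entry 0 relies on the array being zero there at the start. *)
Definition spread_cmd (q : nat) : cmd :=
  For 1 $15 (18 <-- $1 '/ #(Posz q) ;;
    Store 6 $1 (Arr 6 $18 '* #(Posz (q * q)) '+ ($1 '- $18 '* #(Posz q)))).

Definition index_expr (q u v : nat) : expr := #(Posz q) '* Arr 6 $u '+ Arr 6 $v.

Definition load_cmd q : cmd :=
  For 1 $15 (For 2 $15
    (3 <-- #0 ;;
     IfLe ($1 '+ #1) $0 (IfLe ($2 '+ #1) $0 (3 <-- arc_expr false 1 2) Skip) Skip ;;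
     Store 4 (index_expr q 1 2) $3)) ;;
  12 <-- $17.

(** The fourth power has as trace the sum of C_ij C_ji for the square C; array 4 holds D^L times
    C. *)
Definition trace_cmd q : cmd :=
  19 <-- #0 ;;
  For 1 $0 (For 2 $0
    (19 <-- $19 '+ (Arr 4 (index_expr q 1 2) '/ $16) '* (Arr 4 (index_expr q 2 1) '/ $16))).

Definition cubes_cmd rev x : cmd :=
  degrees_cmd rev ;; x <-- #0 ;;
  For 1 $0 (x <-- $x '+ Arr 0 $1 '* (Arr 0 $1 '- #1) '* (Arr 0 $1 '- #2)).

Section Programs.
Variables (B n : nat) (inp : int -> int) (a : nat -> nat -> bool) (q r D L : nat).
Hypothesis B_ge : (16 * (n + 2) ^ 4 <= B)%N.
Hypothesis inpE : forall u v, (u < n)%N -> (v < n)%N ->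
  inp (u%:Z * n%:Z + v%:Z) = a u v.
Hypotheses (q2 : (2 <= q)%N) (D0 : (0 < D)%N) (qr : (q * q <= r)%N).
Hypothesis LE : L = up_log q n.
Hypotheses (HB1 : (16 * r ^ L + 16 <= B)%N) (HB2 : (D ^ L <= B)%N) (HBD : (D <= B)%N).
Hypotheses (HB3 : (q * q <= B)%N).

Let q0 : (0 < q)%N. Proof. exact: ltnW. Qed.
Let nN : (n <= q ^ L)%N. Proof. by rewrite LE up_logP. Qed.
Let NR : (q ^ L * q ^ L <= r ^ L)%N. Proof. by rewrite -expnMn leq_expl. Qed.
Let N0 : (0 < q ^ L)%N. Proof. by rewrite expn_gt0 q0. Qed.
Let NB : (16 * q ^ L + 16 <= B)%N.
Proof. by apply: leq_trans HB1; rewrite leq_add2r leq_mul2l /= (leq_trans _ NR) // leq_pmulr. Qed.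
Let pB : ((q * q) ^ L <= r ^ L)%N. Proof. exact: leq_expl. Qed.
Let qB : (q <= B)%N. Proof. by apply: leq_trans HB3; rewrite leq_pmulr. Qed.

Lemma setup_spec s : var s 0 = n%:Z ->
  trip B inp (setup_cmd q D) s (100 * (n + 1))
   (fun s' => [/\ var s' 14 = L%:Z, var s' 15 = (q ^ L)%N, var s' 16 = (D ^ L)%N &
      var s' 17 = ((q * q) ^ L)%N]).
Proof.
have sm1 : small B 1 by exact: (small_bool B_ge true).
have sm0 : small B 0 by exact: (small_bool B_ge false).
move=> s0; apply: trip_le.
  do 4 (apply: trip_seq; apply: trip_set => //=).
  apply: trip_weaken.
  - apply: (@trip_for _ _ _ _ _ _ _ n (fun k s' => [/\ var s' 14 = (minn k L)%:Z,
      var s' 15 = (q ^ minn k L)%N, var s' 16 = (D ^ minn k L)%N &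
      var s' 17 = ((q * q) ^ minn k L)%N])) => //=.
      by rewrite min0n !expn0.
    move=> k s1 kn [I1 I2 I3 I4] K1.
    have /= s10 := K1.1 0 isT; rewrite s0 in s10.
    have upE l : (n <= q ^ l)%N = (L <= l)%N.
      apply/idP/idP => [h|h]; first by rewrite LE up_log_min.
      by apply: leq_trans nN _; rewrite leq_pexp2l.
    apply: trip_if => //=; rewrite s10 I2 ?lez_nat ?ltz_nat ?ltnNge upE => h.
      apply: trip_skip => /=; have -> : minn k.+1 L = minn k L by lia.
      by [].
    have -> : minn k.+1 L = (minn k L).+1 by lia.
    have lL : ((minn k L).+1 <= L)%N by lia.
    move: (minn k L) I1 I2 I3 I4 lL => l I1 I2 I3 I4 lL.
    have e1 : (q ^ l.+1 <= B)%N by apply: leq_trans NB; rewrite (leq_trans (leq_pexp2l q0 lL)) //; lia.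
    have e2 : (D ^ l.+1 <= B)%N by rewrite (leq_trans (leq_pexp2l D0 lL)).
    have e3 : ((q * q) ^ l.+1 <= B)%N.
      have qq0 : (0 < q * q)%N by rewrite muln_gt0 q0.
      by apply: leq_trans HB1; rewrite (leq_trans (leq_pexp2l qq0 lL)) //; lia.
    have e4 : (L <= B)%N.
      have : (L < q ^ L)%N by exact: ltn_expl.
      by lia.
    rewrite !expnSr in e1 e2 e3 *.
    apply: trip_seq; apply: trip_set => /=.
      by rewrite I1; split=> //; rewrite /small; lia.
    apply: trip_seq; apply: trip_set => /=; first by rewrite I2 -PoszM.
    apply: trip_seq; apply: trip_set => /=; first by rewrite I3 -PoszM.
    apply: trip_set => /=; first by rewrite I4 -PoszM.
    by rewrite I1 I2 I3 I4 -!PoszM; split=> //; lia.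
  - exact: leqnn.
  - move=> s1 K1; rewrite (_ : minn n L = L) //; apply/minn_idPr.
    by rewrite LE up_log_min // ltnW // ltn_expl.
by rewrite /= /maxn /=; lia.
Qed.

Lemma spread_spec s : var s 15 = (q ^ L)%N -> arr s 6 0 = 0 ->
  trip B inp (spread_cmd q) s (100 * (q ^ L + 1))
    (fun s' => forall i, (i < q ^ L)%N -> arr s' 6 i = spread q L i).
Proof.
move=> s15 s6; apply: trip_le.
  apply: trip_weaken.
  - apply: (@trip_for _ _ _ _ _ _ _ (q ^ L) (fun k s' => forall i, (i < k)%N || (i == 0%N) ->
      arr s' 6 i = spread q L i)) => //=.
      by move=> i /eqP ->; rewrite s6 spread0.
    move=> k s1 kN I1 K1.
    have dE : (k%:Z %/ q%:Z)%Z = (k %/ q)%N by rewrite divz_nat.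
    have dk : (k %/ q <= k)%N by exact: leq_div.
    have sp : arr s1 6 (k %/ q)%N = spread q L (k %/ q)%N.
      apply: I1; case: (posnP k) => [-> |k0]; first by rewrite div0n eqxx orbT.
      by rewrite ltn_Pdiv.
    have mE : k%:Z - (k %/ q)%N%:Z * q%:Z = (k %% q)%N.
      by rewrite {1}(divn_eq k q) -PoszM PoszD addrC addKr.
    have E : (spread q L (k %/ q) * (q * q) + k %% q = spread q L k)%N.
      by rewrite -[RHS](spread_stable q0 kN).
    have lt : (spread q L k <= B)%N.
      apply: leq_trans HB1; have := leq_trans (spread_lt L k q0) pB; lia.
    have kB : (k <= B)%N by lia.
    apply: trip_seq; apply: trip_set => /=.
      by split=> //; rewrite dE; apply: small_nat; exact: leq_trans kB.
    rewrite dE; apply: trip_store => //=.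
    + by split=> //; apply: small_index kN NB.
    + rewrite sp mE -!PoszM -PoszD E; split=> //; split=> //.
      * split=> //.
          by apply: (@small_index _ _ (q ^ L) _ NB); exact: leq_ltn_trans kN.
        by apply: small_nat; rewrite -E in lt; lia.
      * split=> //; apply: small_nat; apply: leq_trans kB; exact: leq_divM.
      * by apply: small_nat; rewrite -E in lt; lia.
    + move=> i ik; rewrite sp mE -!PoszM -PoszD E; case: eqP => [-> //|ne].
      by apply: I1; lia.
  - exact: leqnn.
  - by move=> s1 _ I1 i ik; apply: I1; rewrite ik.
by rewrite /=; lia.
Qed.
End Programs.

Section Programs.
Variables (B n : nat) (inp : int -> int) (a : nat -> nat -> bool) (q r D L : nat).
Hypothesis B_ge : (16 * (n + 2) ^ 4 <= B)%N.
Hypothesis inpE : forall u v, (u < n)%N -> (v < n)%N ->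
  inp (u%:Z * n%:Z + v%:Z) = a u v.
Hypotheses (q2 : (2 <= q)%N) (D0 : (0 < D)%N) (qr : (q * q <= r)%N).
Hypothesis LE : L = up_log q n.
Hypotheses (HB1 : (16 * r ^ L + 16 <= B)%N) (HB2 : (D ^ L <= B)%N) (HBD : (D <= B)%N).
Hypotheses (HB3 : (q * q <= B)%N).

Let q0 : (0 < q)%N. Proof. exact: ltnW. Qed.
Let nN : (n <= q ^ L)%N. Proof. by rewrite LE up_logP. Qed.
Let NR : (q ^ L * q ^ L <= r ^ L)%N. Proof. by rewrite -expnMn leq_expl. Qed.
Let N0 : (0 < q ^ L)%N. Proof. by rewrite expn_gt0 q0. Qed.
Let NB : (16 * q ^ L + 16 <= B)%N.
Proof. by apply: leq_trans HB1; rewrite leq_add2r leq_mul2l /= (leq_trans _ NR) // leq_pmulr. Qed.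
Let pB : ((q * q) ^ L <= r ^ L)%N. Proof. exact: leq_expl. Qed.
Let qB : (q <= B)%N. Proof. by apply: leq_trans HB3; rewrite leq_pmulr. Qed.

Definition has_spread s := forall i, (i < q ^ L)%N -> arr s 6 i = spread q L i.

Lemma interleave_le i j : (interleave q L i j < r ^ L)%N.
Proof. exact: leq_trans (interleave_lt L i j q0) pB. Qed.

Lemma index_ev s u v i j : has_spread s -> (i < q ^ L)%N -> (j < q ^ L)%N ->
  var s u = i%:Z -> var s v = j%:Z -> ev inp (index_expr q u v) s = interleave q L i j.
Proof. by move=> sp iN jN su sv; rewrite /= su sv /= !sp // -PoszM. Qed.

Lemma index_ok s u v i j : has_spread s -> (i < q ^ L)%N -> (j < q ^ L)%N ->
  var s u = i%:Z -> var s v = j%:Z -> eok B inp (index_expr q u v) s.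
Proof.
move=> sp iN jN su sv; rewrite /= su sv /= !sp // -!PoszM -PoszD.
have le := interleave_le i j; have le1 : (q * spread q L i <= interleave q L i j)%N by exact: leq_addr.
have leB : (interleave q L i j <= B)%N by apply: leq_trans HB1; lia.
split.
- split; [exact: qB| |by apply: small_nat; exact: leq_trans leB].
  by split=> //; apply: (@small_index _ _ (q ^ L) _ NB).
- by split=> //; apply: (@small_index _ _ (q ^ L) _ NB).
- exact: small_nat.
Qed.

(** The adjacency matrix padded with zeros to order q^L. *)
Definition entry i j : nat := [&& (i < n)%N, (j < n)%N & a i j].

Lemma load_spec s : var s 0 = n%:Z -> var s 15 = (q ^ L)%N -> var s 17 = ((q * q) ^ L)%N ->
  has_spread s ->
  trip B inp (load_cmd q) s (400 * r ^ L)
    (fun s' => var s' 12 = ((q * q) ^ L)%N /\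
       forall i j, (i < q ^ L)%N -> (j < q ^ L)%N -> arr s' 4 (interleave q L i j) = (entry i j)%:Z).
Proof.
have sm1 : small B 1 by exact: (small_bool B_ge true).
have sm0 : small B 0 by exact: (small_bool B_ge false).
move=> s0 s15 s17 sp; apply: trip_le.
  apply: trip_seq; apply: trip_weaken.
  - apply: (@trip_for _ _ _ _ _ _ _ (q ^ L) (fun k s' => forall i j, (i < k)%N -> (j < q ^ L)%N ->
      arr s' 4 (interleave q L i j) = (entry i j)%:Z)) => //=.
    move=> i s1 iN I1 K1.
    have /= s10 := K1.1 0 isT; rewrite s0 in s10.
    have /= s115 := K1.1 15 isT; rewrite s15 in s115.
    apply: trip_weaken.
    + apply: (@trip_for _ _ _ _ _ _ _ (q ^ L) (fun k s' => forall i' j, (i' < q ^ L)%N -> (j < q ^ L)%N ->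
        (i' < i)%N || ((i' == i) && (j < k)%N) ->
        arr s' 4 (interleave q L i' j) = (entry i' j)%:Z)) => //=.
        by move=> i' j i'N jN; rewrite andbF orbF => i'i; apply: I1.
      move=> j s2 jN I2 K2.
      have /= s20 := K2.1 0 isT; rewrite s10 in s20.
      have /= s21 := K2.1 1 isT.
      have sp2 : has_spread s2 by move=> k kN; rewrite (K2.2 6 k isT) /= (K1.2 6 k isT) sp.
      apply: trip_seq; apply: trip_set => //=.
      apply: trip_seq; set s3 := setv _ 3 0; apply: trip_weaken.
      * have iB : (i.+1 <= B)%N by lia.
        have jB : (j.+1 <= B)%N by lia.
        apply: (@trip_if _ _ _ _ _ _ _ 30 0 (fun s' => var s' 3 = (entry i j)%:Z)) => //=.
        -- by split=> //; rewrite s21 /small; lia.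
        -- rewrite s21 s20 => h1; have in_ : (i < n)%N by lia.
           apply: trip_le.
             apply: (@trip_if _ _ _ _ _ _ _ 11 0 (fun s' => var s' 3 = (entry i j)%:Z)) => //=.
             ++ by split=> //; rewrite /small; lia.
             ++ rewrite s20 => h2; have jn : (j < n)%N by lia.
                apply: trip_set.
                  by apply: (@eok_arc _ _ inp false B_ge _ _ _ i j).
                by rewrite (@ev_arc n inp a false inpE 1 2 s3 i j) // /entry in_ jn.
             ++ rewrite s20 => h2; apply: trip_skip; rewrite /= /entry.
                by rewrite in_ (_ : (j < n)%N = false) //; lia.
           by rewrite /= /maxn.
        -- rewrite s21 s20 => h1; apply: trip_skip; rewrite /= /entry.
           by have -> : (i < n)%N = false by lia.
      * exact: leqnn.
      move=> s4 K4 I4.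
      have /= s41 := K4.1 1 isT; rewrite s21 in s41.
      have /= s42 := K4.1 2 isT.
      have sp4 : has_spread s4 by move=> k kN; rewrite (K4.2 6 k isT) /= sp2.
      have E := index_ev sp4 iN jN s41 s42.
      apply: trip_store => //.
      * split=> //; rewrite ?E //; first exact: index_ok sp4 iN jN s41 s42.
        exact: small_index (interleave_le i j) HB1.
      * move=> i' j' i'N j'N h; rewrite E /=.
        case: eqP => [|ne]; first by move/(interleave_inj q0 i'N j'N iN jN) => [-> ->]; rewrite I4.
        rewrite (K4.2 4 _ isT) /=; apply: I2 => //.
        case/orP: h => [->//|/andP[/eqP Ei jj]]; rewrite Ei eqxx ltnn /=.
        by move: jj; rewrite ltnS leq_eqVlt => /orP[/eqP Ej|//]; case: ne; rewrite Ei Ej.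
    + exact: leqnn.
    + move=> s2 K2 I2 i' j i'i jN; apply: I2 => //; first by lia.
      by move: i'i; rewrite ltnS leq_eqVlt jN andbT orbC.
  - exact: leqnn.
  move=> s1 K1 I1; apply: trip_set => //=; split=> //.
  by rewrite (K1.1 17 isT).
rewrite /= /maxn /=; nia.
Qed.

Lemma trace_spec s (C : nat -> nat -> nat) : var s 0 = n%:Z -> var s 16 = (D ^ L)%N ->
  has_spread s -> (forall i j, (i < n)%N -> (j < n)%N -> (C i j <= n)%N) ->
  (forall i j, (i < n)%N -> (j < n)%N -> arr s 4 (interleave q L i j) = (D ^ L * C i j)%N) ->
  trip B inp (trace_cmd q) s (400 * (n + 1) ^ 2)
    (fun s' => var s' 19 = (\sum_(i < n) \sum_(j < n) C i j * C j i)%N%:Z).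
Proof.
have sm0 : small B 0 by exact: (small_bool B_ge false).
have b4 := fourth_power_fits B_ge.
move=> s0 s16 sp Cn s4; apply: trip_le.
  have rowB i k : (i < n)%N -> (k <= n)%N -> (\sum_(j < k) C i j * C j i <= k * (n * n))%N.
    move=> iN kn; rewrite -[X in (X * _)%N]card_ord -sum_nat_const leq_sum // => j _.
    by have jn := leq_trans (ltn_ord j) kn; rewrite leq_mul // Cn.
  have allB k : (k <= n)%N -> (\sum_(i < k) \sum_(j < n) C i j * C j i <= k * (n * (n * n)))%N.
    move=> kn; rewrite -[X in (X * _)%N]card_ord -sum_nat_const leq_sum // => i _.
    by rewrite rowB //; exact: leq_trans kn.
  apply: trip_seq; apply: trip_set => //=.
  apply: (@trip_for _ _ _ _ _ _ _ n (fun k s' => var s' 19 = (\sum_(i < k) \sum_(j < n) C i j * C j i)%N%:Z)) => //=.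
    by rewrite big_ord0.
  move=> i s1 iN I1 K1.
  have /= s10 := K1.1 0 isT; rewrite s0 in s10.
  have /= s116 := K1.1 16 isT; rewrite s16 in s116.
  apply: trip_weaken.
  + apply: (@trip_for _ _ _ _ _ _ _ n (fun k s' => var s' 19 =
      (\sum_(i' < i) \sum_(j < n) C i' j * C j i' + \sum_(j < k) C i j * C j i)%N%:Z)) => //=.
      by rewrite big_ord0 addn0.
    move=> j s2 jN I2 K2.
    have /= s216 := K2.1 16 isT; rewrite s116 in s216.
    have /= s21 := K2.1 1 isT.
    have sp2 : has_spread s2 by move=> k kN; rewrite (K2.2 6 k isT) /= (K1.2 6 k isT) sp.
    have iL : (i < q ^ L)%N by exact: leq_trans nN.
    have jL : (j < q ^ L)%N by exact: leq_trans nN.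
    set s3 := setv s2 2 j%:Z.
    have s31 : var s3 1 = i by [].
    have s32 : var s3 2 = j by [].
    have E1 := @index_ev s3 1 2 i j sp2 iL jL s31 s32.
    have E2 := @index_ev s3 2 1 j i sp2 jL iL s32 s31.
    have O1 := @index_ok s3 1 2 i j sp2 iL jL s31 s32.
    have O2 := @index_ok s3 2 1 j i sp2 jL iL s32 s31.
    have DL0 : (D ^ L)%N%:Z != 0 by rewrite -lt0n expn_gt0 D0.
    have V i' j' : (i' < n)%N -> (j' < n)%N ->
        (arr s3 4 (interleave q L i' j') %/ var s3 16)%Z = C i' j'.
      move=> h1 h2; rewrite /= (K2.2 4 _ isT) /= (K1.2 4 _ isT) /= s4 // s216.
      by rewrite PoszM mulKz.
    have V1 := V i j iN jN; have V2 := V j i jN iN.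
    have c1 := Cn i j iN jN; have c2 := Cn j i jN iN.
    have le1 := allB i (ltnW iN); have le2 := rowB i j.+1 iN jN.
    have nB : (n <= B)%N by have := linear_fits B_ge; lia.
    have nnB : (n * n <= B)%N := square_fits B_ge.
    have tot : (i * (n * (n * n)) + j.+1 * (n * n) <= B)%N.
      have : (i * (n * (n * n)) + j.+1 * (n * n) <= n * (n * (n * n)))%N.
        by apply: (@leq_trans (i.+1 * (n * (n * n)))); [rewrite (mulSn i) addnC leq_add2r leq_mul2r jN orbT|rewrite leq_mul2r iN orbT].
      rewrite !mulnA in b4 *; lia.
    have EV u v e : eok B inp e s3 -> ev inp e s3 = interleave q L u v -> (u < n)%N -> (v < n)%N ->
        ev inp (Arr 4 e '/ $16) s3 = C u v /\ eok B inp (Arr 4 e '/ $16) s3.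
      move=> oe ee un vn; have VV : ev inp (Arr 4 e '/ $16) s3 = C u v.
        by rewrite -(V u v un vn) /= ee.
      split=> //; split=> //; last by rewrite -/(ev inp (Arr 4 e '/ $16) s3) VV; apply: small_nat; apply: leq_trans nB; apply: Cn.
      by split=> //; rewrite ee //; apply: small_index (interleave_le u v) HB1.
    have [W1 X1] := EV i j _ O1 E1 iN jN; have [W2 X2] := EV j i _ O2 E2 jN iN.
    move: W1 X1 W2 X2; set f1 := Arr 4 _ '/ _; set f2 := Arr 4 _ '/ _ => W1 X1 W2 X2.
    have bC : (C i j * C j i <= n * n)%N by rewrite leq_mul.
    have V19 : var s3 19 + C i j * C j i = (\sum_(i' < i) \sum_(j' < n) C i' j' * C j' i' +
        \sum_(j' < j.+1) C i j' * C j' i)%N%:Z.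
      by rewrite big_ord_recr /= I2 addnA.
    apply: trip_set.
    * split=> //.
        split=> //; change (small B (ev inp f1 s3 * ev inp f2 s3)); rewrite W1 W2 -PoszM; apply: small_nat; exact: leq_trans nnB.
      change (small B (var s3 19 + ev inp f1 s3 * ev inp f2 s3)); rewrite W1 W2 V19; apply: small_nat.
      by apply: leq_trans tot; rewrite leq_add.
    * change (var s3 19 + ev inp f1 s3 * ev inp f2 s3 = (\sum_(i' < i) \sum_(j < n) C i' j * C j i' +
        \sum_(j < j.+1) C i j * C j i)%N%:Z); by rewrite W1 W2 V19.
  + exact: leqnn.
  + by move=> s2 _ ->; rewrite big_ord_recr.
rewrite /=; nia.
Qed.
End Programs.

Lemma cubes_spec B n (inp : int -> int) (a : nat -> nat -> bool) rev x s :
  (16 * (n + 2) ^ 4 <= B)%N ->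
  (forall u v, (u < n)%N -> (v < n)%N -> inp (u%:Z * n%:Z + v%:Z) = a u v) ->
  (3 < x)%N -> var s 0 = n%:Z ->
  trip B inp (cubes_cmd rev x) s (300 * (n + 1) ^ 2)
    (fun s' => var s' x = (\sum_(v < n) 6 * 'C(degree n a rev v, 3))%N%:Z).
Proof.
move=> B_ge inpE x3 s0.
have [nB nnB n3B n4B] := And4 (linear_fits B_ge) (square_fits B_ge) (cube_fits B_ge) (fourth_power_fits B_ge).
have sm1 : small B 1 by exact: (small_bool B_ge true).
have sm2 : small B 2 by rewrite /small; lia.
have sm0 : small B 0 by exact: (small_bool B_ge false).
have x0 : (0 == x) = false by lia.
have x1 : (x == 1)%N = false by lia.
have x01 : (0 == x)%N = false by lia.
apply: trip_le.
  apply: trip_seq; apply: trip_weaken; first exact: (degrees_spec B_ge inpE).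
    exact: leqnn.
  move=> s1 K1 D1; have s10 := K1.1 0 isT; rewrite s0 in s10.
  apply: trip_seq; apply: trip_set => //=.
  apply: trip_weaken.
  - apply: (@trip_for _ _ _ _ _ _ _ n (fun k s' => var s' x = (\sum_(v < k) 6 * 'C(degree n a rev v, 3))%N)) => //=.
    + by rewrite x01 s10.
    + by rewrite eqxx big_ord0.
    move=> v s2 vn I2 K2; have /= s20 := K2.2 0 v isT; rewrite D1 // in s20.
    have le0 := degree_le n a rev v.
    have c3 := bin3E (degree n a rev v).
    have le3 u : (6 * 'C(degree n a rev u, 3) <= n * n * n)%N.
      have := bin3E (degree n a rev u); have := degree_le n a rev u.
      move: (degree _ _ _ _) => d dn H.
      have : ((6 * 'C(d, 3))%N <= d * d * d)%N by case: d {dn} H => [|[|d]]; [by []|by []|nia].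
      by move/leq_trans; apply; rewrite !leq_mul.
    have le : (\sum_(u < v) 6 * 'C(degree n a rev u, 3) <= v * (n * n * n))%N.
      exact: (@sum_le_const (fun u => 6 * 'C(degree n a rev u, 3))%N).
    have le' : (v.+1 * (n * n * n) <= n * (n * n * n))%N by rewrite leq_mul2r vn orbT.
    have := le3 v => le3v.
    have e2 : (degree n a rev v)%:Z * ((degree n a rev v)%:Z - 1) = 2 * 'C(degree n a rev v, 2)%:Z.
      exact: bin2E.
    have e2b : (2 * 'C(degree n a rev v, 2) <= n * n)%N.
      move: e2 le0; move: (degree _ _ _ _) ('C(_, 2)) => d c H dn.
      have h : (2 * c <= d * d)%N by nia.
      by apply: leq_trans h _; rewrite leq_mul.
    apply: trip_set => /=; rewrite x1 s20.
      rewrite e2 in c3; rewrite e2 c3 I2.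
      move: le le3v e2b; move: (\sum_(_ < v) _)%N ('C(_, 3)) ('C(_, 2)) => S c c' le le3v e2b.
      have b1 : (n * (n * n * n) <= B)%N by rewrite !mulnA in n4B *; lia.
      move: (n * (n * n * n))%N (v * (n * n * n))%N (n * n * n)%N (n * n)%N b1 le' le le3v e2b n3B nnB; rewrite mulSn => P4 P4' P3 P2 b1 le' le le3v e2b n3B' nnB'.
      rewrite /small; repeat split=> //; lia.
    by rewrite eqxx c3 I2 big_ord_recr /= PoszD.
  - exact: leqnn.
  - by move=> s2 K2.
rewrite /= !expnS expn0; nia.
Qed.

(** * Squaring the adjacency matrix on the machine *)

Definition table_of (M : nat -> nat -> int) p i := M (i %/ p)%N (i %% p)%N.

Definition tables_cmd q r D U V W : cmd :=
  setup_cmd q D ;; fill 8 (table_of U (q * q)) (r * (q * q)) ;;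
  fill 9 (table_of V (q * q)) (r * (q * q)) ;; fill 10 (table_of W r) (q * q * r) ;;
  spread_cmd q.

(** Both factors are the adjacency matrix, transformed by U and by V. Array 4 is the work space of
    every transform, so the first result is saved in array 7 before the second. *)
Definition square_cmd q r : cmd :=
  (load_cmd q ;; yates_cmd 8 (q * q) r) ;; For 2 $12 (Store 7 $2 (Arr 4 $2)) ;;
  (load_cmd q ;; yates_cmd 9 (q * q) r) ;;
  For 2 $12 (Store 4 $2 (Arr 7 $2 '* Arr 4 $2)) ;; yates_cmd 10 r (q * q).

Definition measure_cmd q r D U V W : cmd :=
  tables_cmd q r D U V W ;; square_cmd q r ;; trace_cmd q ;; cubes_cmd false 20 ;;
  cubes_cmd true 21.

Lemma Posz_sum m (F : nat -> nat) : (\sum_(i < m) F i)%N%:Z = \sum_(i < m) (F i)%:Z.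
Proof. by elim: m => [|m IH]; rewrite ?big_ord0 // !big_ord_recr /= PoszD IH. Qed.

Section Programs.
Variables (B n : nat) (inp : int -> int) (a : nat -> nat -> bool) (q r D L mu : nat).
Variables (U V W : nat -> nat -> int).
Hypothesis B_ge : (16 * (n + 2) ^ 4 <= B)%N.
Hypothesis inpE : forall u v, (u < n)%N -> (v < n)%N ->
  inp (u%:Z * n%:Z + v%:Z) = a u v.
Hypotheses (q2 : (2 <= q)%N) (D0 : (0 < D)%N) (qr : (q * q <= r)%N) (mu0 : (0 < mu)%N).
Hypothesis LE : L = up_log q n.
Hypotheses (HB1 : (16 * r ^ L + 16 <= B)%N) (HB2 : (D ^ L <= B)%N) (HBD : (D <= B)%N).
Hypotheses (HB3 : (16 * (r * (q * q)) + 16 <= B)%N) (HBmu : (mu <= B)%N).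
Let P := ((q * q * mu) ^ L)%N.
Hypothesis HB4 : ((r * mu) ^ L * (P * P) <= B)%N.
Hypothesis Umu : forall k c, (k < r)%N -> (c < q * q)%N -> `|U k c| <= mu%:Z.
Hypothesis Vmu : forall k c, (k < r)%N -> (c < q * q)%N -> `|V k c| <= mu%:Z.
Hypothesis Wmu : forall c k, (c < q * q)%N -> (k < r)%N -> `|W c k| <= mu%:Z.
Hypothesis id : trilinear_identity q r D U V W.

Let q0 : (0 < q)%N. Proof. exact: ltnW. Qed.
Let p0 : (0 < q * q)%N. Proof. by rewrite muln_gt0 q0. Qed.
Let r0 : (0 < r)%N. Proof. exact: leq_trans qr. Qed.
Let nN : (n <= q ^ L)%N. Proof. by rewrite LE up_logP. Qed.
Let NR : (q ^ L * q ^ L <= r ^ L)%N. Proof. by rewrite -expnMn leq_expl. Qed.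
Let qqB : (q * q <= B)%N.
Proof. by apply: leq_trans HB3; have := leq_pmull (q * q) r0; lia. Qed.
Let pB : ((q * q) ^ L <= r ^ L)%N. Proof. exact: leq_expl. Qed.

Definition ready s :=
  [/\ var s 0 = n%:Z, var s 14 = L%:Z, var s 15 = (q ^ L)%N, var s 16 = (D ^ L)%N &
      var s 17 = ((q * q) ^ L)%N] /\
  [/\ holds_table U 8 (q * q) r s, holds_table V 9 (q * q) r s,
      holds_table W 10 r (q * q) s & has_spread q L s].

Lemma ready_keeps c s s' : keeps c s s' ->
  all (fun y => ~~ modv c y) [:: 0; 14; 15; 16; 17]%N ->
  all (fun t => ~~ moda c t) [:: 6; 8; 9; 10]%N -> ready s -> ready s'.
Proof.
move=> [Kv Ka] /and5P[v0 v14 v15 v16 /andP[v17 _]] /and5P[a6 a8 a9 a10 _].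
move=> [[h1 h2 h3 h4 h5] [g1 g2 g3 g4]]; split; first by rewrite !Kv.
by split=> [k x kr xp|k x kr xp|x k xp kr|i iN]; rewrite Ka //; auto.
Qed.

Lemma small_table M p m i : (i < m * p)%N -> (0 < p)%N ->
  (forall k c, (k < m)%N -> (c < p)%N -> `|M k c| <= mu%:Z) -> small B (table_of M p i).
Proof.
move=> im p1 H; apply: (small_norm (H _ _ _ _) HBmu); last exact: ltn_pmod.
by rewrite ltn_divLR.
Qed.

Lemma table_of_holds M t p m s : (forall i, (i < m * p)%N -> arr s t i = table_of M p i) ->
  holds_table M t p m s.
Proof.
move=> H k c km cp; rewrite H.
  by rewrite /table_of divnMDl ?(leq_ltn_trans _ cp) // divn_small // addn0 modnMDl modn_small.
by apply: (@leq_trans (k.+1 * p)); [rewrite mulSn addnC ltn_add2r|rewrite leq_mul2r km orbT].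
Qed.

Lemma tables_spec s : var s 0 = n%:Z -> arr s 6 0 = 0 ->
  trip B inp (tables_cmd q r D U V W) s (500 * (r * (q * q) * r ^ L)) ready.
Proof.
move=> s0 s6; apply: trip_le.
  apply: trip_seq; apply: trip_weaken; first exact: (setup_spec B_ge q2 D0 qr LE HB1 HB2 HBD qqB s0).
    exact: leqnn.
  move=> s1 K1 [v14 v15 v16 v17].
  have v0 := K1.1 0 isT; rewrite s0 in v0.
  have w6 := K1.2 6 0 isT; rewrite s6 in w6.
  apply: trip_seq; apply: trip_weaken.
    by apply: (@fill_spec _ _ 8 (table_of U (q * q)) _ s1 isT HB3) => i ir; exact: small_table ir p0 Umu.
    exact: leqnn.
  move=> s2 K2 /table_of_holds T8.
  apply: trip_seq; apply: trip_weaken.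
    by apply: (@fill_spec _ _ 9 (table_of V (q * q)) _ s2 isT HB3) => i ir; exact: small_table ir p0 Vmu.
    exact: leqnn.
  move=> s3 K3 /table_of_holds T9.
  apply: trip_seq; apply: trip_weaken.
    apply: (@fill_spec _ _ 10 (table_of W r) (q * q * r) s3 isT); first by rewrite (mulnC (q * q)%N r).
    by move=> i ir; exact: small_table ir r0 Wmu.
    exact: leqnn.
  move=> s4 K4 /table_of_holds T10.
  have Kv y : var s4 y = var s1 y by rewrite K4.1 ?modv_fill // K3.1 ?modv_fill // K2.1 ?modv_fill.
  apply: trip_weaken.
  - apply: (spread_spec B_ge q2 D0 qr LE HB1 HB2 HBD qqB); first by rewrite Kv v15.
    by rewrite K4.2 ?moda_fill // K3.2 ?moda_fill // K2.2 ?moda_fill.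
  - exact: leqnn.
  move=> s5 K5 I5; split.
    by rewrite (K5.1 0 isT) (K5.1 14 isT) (K5.1 15 isT) (K5.1 16 isT) (K5.1 17 isT) !Kv.
  split=> //.
  - move=> k c kr cp; rewrite (K5.2 8 _ isT) K4.2 ?moda_fill // K3.2 ?moda_fill //; exact: T8.
  - move=> k c kr cp; rewrite (K5.2 9 _ isT) K4.2 ?moda_fill //; exact: T9.
  - move=> k c kr cp; rewrite (K5.2 10 _ isT); exact: T10.
have R0 : (0 < r ^ L)%N by rewrite expn_gt0 r0.
have NN : (q ^ L <= r ^ L)%N by rewrite leq_expl // (leq_trans _ qr) // leq_pmulr.
have t0 : (0 < r * (q * q))%N by rewrite muln_gt0 r0.
rewrite (mulnC (q * q)%N r).
have : (q ^ L + 1 <= 2 * r ^ L)%N by lia.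
have : (n + 1 <= 2 * r ^ L)%N by lia.
move: (r * (q * q))%N t0 (r ^ L)%N (q ^ L)%N R0 NN => t t0 R N R0 NN.
have := leq_pmull R t0; have := leq_pmulr t R0; move: (t * R)%N => X; lia.
Qed.

Definition entry_vector (x : nat -> int) := forall i j, (i < q ^ L)%N -> (j < q ^ L)%N ->
  x (interleave q L i j) = (entry n a i j)%:Z.

Lemma transform_spec s M t (t8 : (7 < t < 16)%N) : ready s -> holds_table M t (q * q) r s ->
  (forall k c, (k < r)%N -> (c < q * q)%N -> `|M k c| <= mu%:Z) ->
  trip B inp (load_cmd q ;; yates_cmd t (q * q) r) s
     (400 * r ^ L + (L * (100 * (q * q + 1) * (r + 1) * (r ^ L + 1) + 6) + 6))
    (fun s' => var s' 12 = (r ^ L)%N /\ exists2 x, entry_vector x &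
       forall k, (k < r ^ L)%N ->
       arr s' 4 k = \sum_(b < (q * q) ^ L) tens M r (q * q) L k b * x b /\
       `|arr s' 4 k| <= P%:Z).
Proof.
move=> rd tab Mmu; have [[s0 s14 s15 s16 s17] [T8 T9 T10 sp]] := rd.
apply: trip_seq; apply: trip_weaken; first exact: (load_spec B_ge inpE q2 D0 qr LE HB1 HB2 HBD qqB s0 s15 s17 sp).
  exact: leqnn.
move=> s1 K1 [v12 ent].
have tab1 : holds_table M t (q * q) r s1.
  by move=> k c kr cp; rewrite K1.2 ?tab //=; lia.
have rd1 := ready_keeps K1 isT isT rd.
have [[_ v14 _ _ _] _] := rd1.
have t16 : (t < 16)%N by lia.
have t4 : t != 4%N by lia.
have t5 : t != 5%N by lia.
have BP : (P * 1 <= B)%N.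
  apply: leq_trans HB4; rewrite muln1.
  have P0 : (0 < P)%N by rewrite expn_gt0 muln_gt0 p0 mu0.
  have rm0 : (0 < (r * mu) ^ L)%N by rewrite expn_gt0 muln_gt0 r0 mu0.
  by rewrite mulnA leq_pmull // muln_gt0 rm0.
apply: trip_weaken.
- apply: (@yates_spec B inp M t (q * q) r mu t16 t4 t5 p0 r0 mu0 Mmu HB3 s1 r L 1 (arr s1 4)) => //.
  move=> c cp; have [i [j [iN jN ->]]] := interleave_surj q0 cp.
  by rewrite ent // /entry; case: [&& _, _ & _].
- exact: leqnn.
- move=> s2 K2 [w12 H]; split=> //; exists (arr s1 4); first exact: ent.
  by move=> k kr; have := H k kr; rewrite muln1.
Qed.

Definition paths i j : nat := (\sum_(m < n) (a i m && a m j))%N.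

Lemma paths_le i j : (paths i j <= n)%N.
Proof. exact: (sum_bool_le (fun m => a i m && a m j)). Qed.

Lemma square_spec s : ready s ->
  trip B inp (square_cmd q r) s (2000 * (q * q + 1) * (r + 1) * (L.+1 * r ^ L))
    (fun s' => forall i j, (i < n)%N -> (j < n)%N ->
       arr s' 4 (interleave q L i j) = (D ^ L * paths i j)%N).
Proof.
move=> rd; have [[s0 s14 s15 s16 s17] [T8 T9 T10 sp]] := rd.
have P0 : (0 < P)%N by rewrite expn_gt0 muln_gt0 p0 mu0.
have rm0 : (0 < (r * mu) ^ L)%N by rewrite expn_gt0 muln_gt0 r0 mu0.
have BPP : (P * P <= B)%N by apply: leq_trans HB4; rewrite leq_pmull.
have BP : (P <= B)%N by apply: leq_trans BPP; rewrite leq_pmull.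
apply: trip_le.
  apply: trip_seq; apply: trip_weaken; first exact: (transform_spec (t := 8) isT rd T8 Umu).
    exact: leqnn.
  move=> s1 K1 [v12 [x xA xE]].
  have rd1 := ready_keeps K1 isT isT rd.
  apply: trip_seq; apply: trip_weaken.
    apply: (@trip_for _ _ _ _ _ _ _ (r ^ L) (fun b s' => forall k, (k < b)%N ->
      arr s' 7 k = arr s1 4 k)) => //=.
    move=> k s2 kr I2 K2; apply: trip_store => /=.
    + by split=> //; apply: small_index kr HB1.
    + by split=> //; apply: small_index kr HB1.
    move=> i ik; case: eqP => [->|ne]; first by rewrite (K2.2 4 _ isT).
    by apply: I2; lia.
    exact: leqnn.
  move=> s2 K2 I2; have rd2 := ready_keeps K2 isT isT rd1.
  have [_ [_ T9' _ _]] := rd2.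
  apply: trip_seq; apply: trip_weaken; first exact: (transform_spec (t := 9) isT rd2 T9' Vmu).
    exact: leqnn.
  move=> s3 K3 [w12 [y yA yE]].
  have rd3 := ready_keeps K3 isT isT rd2.
  apply: trip_seq; apply: trip_weaken.
    apply: (@trip_for _ _ _ _ _ _ _ (r ^ L) (fun b s' =>
      (forall k, (k < b)%N -> arr s' 4 k = arr s1 4 k * arr s3 4 k) /\
      (forall k, (b <= k)%N -> arr s' 4 k = arr s3 4 k))) => //=.
    move=> k s4 kr [I4 J4] K4.
    have s47 : arr s4 7 k = arr s1 4 k by rewrite (K4.2 7 _ isT) (K3.2 7 _ isT) I2.
    apply: trip_store => /=.
    + by split=> //; apply: small_index kr HB1.
    + rewrite s47 J4 //; split=> //; try by split=> //; apply: small_index kr HB1.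
      apply: (small_norm _ BPP); rewrite normrM PoszM ler_pM //; [exact: (xE k kr).2|exact: (yE k kr).2].
    + split=> i ik; case: eqP => [Ei|ne].
      * by rewrite Ei s47 J4.
      * by apply: I4; lia.
      * by lia.
      * by apply: J4; lia.
    exact: leqnn.
  move=> s4 K4 [I4 _]; have rd4 := ready_keeps K4 isT isT rd3.
  have [[_ v14 _ _ _] [_ _ T10' _]] := rd4.
  pose z k := arr s1 4 k * arr s3 4 k.
  have PP0 : (0 < P * P)%N by rewrite muln_gt0 P0.
  have HB3' : (16 * (q * q * r) + 16 <= B)%N by rewrite (mulnC (q * q)%N).
  apply: trip_weaken.
  - apply: (@yates_spec B inp W 10 r (q * q) mu isT isT isT r0 p0 mu0 Wmu HB3' s4 r L (P * P) z) => //.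
    + by rewrite (K4.1 12 isT).
    + move=> k kr; rewrite normrM PoszM ler_pM //; [exact: (xE k kr).2|exact: (yE k kr).2].
  - exact: leqnn.
  move=> s5 K5 [_ H] i j i_n jn.
  have iN := leq_trans i_n nN; have jN := leq_trans jn nN.
  have [-> _] := H _ (interleave_lt L i j q0).
  rewrite (eq_bigr (fun k : 'I_(r ^ L) => tens W (q * q) r L (interleave q L i j) k *
     ((\sum_(c < (q * q) ^ L) tens U r (q * q) L k c * x c) *
      (\sum_(c < (q * q) ^ L) tens V r (q * q) L k c * y c)))); last first.
    by move=> k _; rewrite /z (xE k (ltn_ord k)).1 (yE k (ltn_ord k)).1.
  rewrite (fast_product q0 r0 id xA yA iN jN) PoszM; congr (_ * _).
  (* The product of the padded matrices sums over q^L inner vertices, those from n on contributing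
     zero. *)
  have -> : paths i j = (\sum_(m < q ^ L) if (m < n)%N then nat_of_bool (a i m && a m j) else 0%N)%N.
    by rewrite /paths (big_ord_widen (q ^ L) (fun m => nat_of_bool (a i m && a m j)) nN) big_mkcond.
  apply: etrans (esym (Posz_sum (q ^ L) (fun m => if (m < n)%N then nat_of_bool (a i m && a m j) else 0%N))).
  apply: eq_bigr => m _.
  rewrite /entry i_n jn /= -PoszM mulnb; congr Posz.
  by case: (m < n)%N; rewrite ?andbF.
have K4 : (4 <= (q * q + 1) * (r + 1))%N by rewrite -[4%N]/(2 * 2)%N leq_mul // addn1 ltnS.
have R0 : (0 < r ^ L)%N by rewrite expn_gt0 r0.
cbn [esize]; move: (q * q + 1)%N (r + 1)%N K4 (r ^ L)%N R0 => u v K4 R R0.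
pose X := (u * v * R)%N.
have -> : (2000 * u * v * (L.+1 * R) = 2000 * (X + L * X))%N by rewrite /X mulSn; ring.
have -> : (100 * v * u * (R + 1) = 100 * u * v * (R + 1))%N by ring.
have : (100 * u * v * (R + 1) <= 200 * X)%N.
  have -> : (100 * u * v * (R + 1) = 100 * (u * v * (R + 1)))%N by ring.
  have : (u * v * (R + 1) <= u * v * (2 * R))%N by rewrite leq_mul2l; apply/orP; right; lia.
  have -> : (u * v * (2 * R) = 2 * X)%N by rewrite /X; ring.
  by move: (u * v * (R + 1))%N X => Y Z; lia.
have RX : (4 * R <= X)%N by rewrite leq_mul2r K4 orbT.
move: (100 * u * v * (R + 1))%N X RX => Y X RX YX.
have : (L * (Y + 6) <= 206 * (L * X))%N by rewrite mulnCA leq_mul2l; apply/orP; right; lia.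
move: (L * (Y + 6))%N (L * X)%N => Z LX; lia.
Qed.
End Programs.

Definition quadruples_expr : expr := $0 '* ($0 '- #1) '* ($0 '- #2) '* ($0 '- #3).

(** Solves four linear equations: variable 20 is 6 (transitive + source), 21 is 6 (transitive +
    sink), 19 is 4 strong, and 22 is 24 times the sum of all four counts. *)
Definition type_count_cmd (ty : bool * bool) : cmd :=
  22 <-- quadruples_expr ;;
  0 <-- match ty with
        | (false, false) => $19 '/ #4
        | (true, true) => (#4 '* $20 '+ #4 '* $21 '+ #6 '* $19 '- $22) '/ #24
        | (true, false) => ($22 '- #4 '* $21 '- #6 '* $19) '/ #24
        | (false, true) => ($22 '- #4 '* $20 '- #6 '* $19) '/ #24
        end.

Lemma type_count_spec B n inp (c : bool * bool -> nat) ty s :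
  (16 * (n + 2) ^ 4 <= B)%N -> var s 0 = n%:Z ->
  (c (true, true) + c (true, false) + c (false, true) + c (false, false) = 'C(n, 4))%N ->
  var s 19 = (4 * c (false, false))%N ->
  var s 20 = (6 * (c (true, true) + c (true, false)))%N ->
  var s 21 = (6 * (c (true, true) + c (false, true)))%N ->
  trip B inp (type_count_cmd ty) s 100 (fun s' => var s' 0 = (c ty)%:Z).
Proof.
move=> B_ge s0 tot s19 s20 s21.
have [b1 b2 b3 b4] := And4 (linear_fits B_ge) (square_fits B_ge) (cube_fits B_ge) (fourth_power_fits B_ge).
have e2 := bin2E n; have e3 := bin3E n; have e4 := bin4E n.
have c2 : (2 * 'C(n, 2) <= n * n)%N.
  by rewrite -lez_nat !PoszM -e2; case: (n) => // k; nia.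
have c3 : (6 * 'C(n, 3) <= n * n * n)%N.
  rewrite -lez_nat 3!PoszM -e3 e2; move: ('C(n, 2)) c2 => C2 c2.
  case: (n) c2 => [|[|k]] c2; [nia|nia|].
  have -> : k.+2%:Z - 2 = k%:Z by lia.
  nia.
have c4 : (24 * 'C(n, 4) <= n * n * n * n)%N.
  rewrite -lez_nat 4!PoszM -e4 e3; move: ('C(n, 3)) c3 => C3 c3.
  case: (n) c3 => [|[|[|k]]] c3; [nia|nia|nia|].
  have -> : k.+3%:Z - 3 = k%:Z by lia.
  rewrite -!PoszM lez_nat in c3 *; apply: leq_mul => //; lia.
apply: trip_le.
  apply: trip_seq; apply: trip_set.
    rewrite /= s0 e4 e3 e2 /small; move: ('C(n, 2)) ('C(n, 3)) ('C(n, 4)) (n * n)%N (n * n * n)%N (n * n * n * n)%N c2 c3 c4 b2 b3 b4 => C2 C3 C4 n2 n3 n4 c2 c3 c4 b2 b3 b4.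
    clear - b1 b2 b3 b4 c2 c3 c4.
    repeat split=> //; lia.
  have -> : ev inp quadruples_expr s = 24 * ('C(n, 4))%:Z by rewrite /= s0 e4.
  rewrite -tot in c4 *; apply: trip_set; last first.
    case: ty => [[] []] /=; rewrite ?s19 ?s20 ?s21; lia.
  move: c4 b4 b1; case: ty => [[] []] /=; rewrite ?s19 ?s20 ?s21;
    move: (c (true, true)) (c (true, false)) (c (false, true)) (c (false, false));
    move: (n * n * n * n)%N => n4 x y z w c4 b4 b1; clear - c4 b4 b1;
    rewrite /small; repeat split=> //; lia.
by case: ty => [[] []].
Qed.

Section Programs.
Variables (B n : nat) (inp : int -> int) (a : nat -> nat -> bool) (q r D L mu : nat).
Variables (U V W : nat -> nat -> int).
Hypothesis B_ge : (16 * (n + 2) ^ 4 <= B)%N.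
Hypothesis inpE : forall u v, (u < n)%N -> (v < n)%N ->
  inp (u%:Z * n%:Z + v%:Z) = a u v.
Hypotheses (q2 : (2 <= q)%N) (D0 : (0 < D)%N) (qr : (q * q <= r)%N) (mu0 : (0 < mu)%N).
Hypothesis LE : L = up_log q n.
Hypotheses (HB1 : (16 * r ^ L + 16 <= B)%N) (HB2 : (D ^ L <= B)%N) (HBD : (D <= B)%N).
Hypotheses (HB3 : (16 * (r * (q * q)) + 16 <= B)%N) (HBmu : (mu <= B)%N).
Hypothesis HB4 : ((r * mu) ^ L * ((q * q * mu) ^ L * (q * q * mu) ^ L) <= B)%N.
Hypothesis Umu : forall k c, (k < r)%N -> (c < q * q)%N -> `|U k c| <= mu%:Z.
Hypothesis Vmu : forall k c, (k < r)%N -> (c < q * q)%N -> `|V k c| <= mu%:Z.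
Hypothesis Wmu : forall c k, (c < q * q)%N -> (k < r)%N -> `|W c k| <= mu%:Z.
Hypothesis id : trilinear_identity q r D U V W.

Lemma measure_spec s : var s 0 = n%:Z -> arr s 6 0 = 0 ->
  trip B inp (measure_cmd q r D U V W) s (10 * 1000 * (q * q + 1) * (r + 1) * (2 * r) ^ L)
    (fun s' => [/\ var s' 0 = n%:Z,
       var s' 19 = (\sum_(i < n) \sum_(j < n) paths n a i j * paths n a j i)%N%:Z,
       var s' 20 = (\sum_(v < n) 6 * 'C(degree n a false v, 3))%N%:Z &
       var s' 21 = (\sum_(v < n) 6 * 'C(degree n a true v, 3))%N%:Z]).
Proof.
move=> s0 s6.
have q0 : (0 < q)%N by exact: ltnW.
have nN : (n <= q ^ L)%N by rewrite LE up_logP.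
have qqB : (q * q <= B)%N.
  have r0 : (0 < r)%N by apply: leq_trans qr; rewrite muln_gt0 q0.
  by apply: leq_trans HB3; have := leq_pmull (q * q) r0; lia.
apply: trip_le.
  apply: trip_seq; apply: trip_weaken.
    exact: (tables_spec B_ge q2 D0 qr mu0 LE HB1 HB2 HBD HB3 HBmu HB4 Umu Vmu Wmu s0 s6).
    exact: leqnn.
  move=> s1 K1 rd1.
  apply: trip_seq; apply: trip_weaken.
    exact: (square_spec B_ge inpE q2 D0 qr mu0 LE HB1 HB2 HBD HB3 HBmu HB4 Umu Vmu Wmu id rd1).
    exact: leqnn.
  move=> s2 K2 I2.
  have [[v0 _ _ v16 _] [_ _ _ sp]] := ready_keeps K2 isT isT rd1.
  apply: trip_seq; apply: trip_weaken.
    apply: (@trace_spec B n inp q r D L B_ge q2 D0 qr LE HB1 HB2 HBD qqB s2 (paths n a)) => //.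
    by move=> i j _ _; exact: paths_le.
    exact: leqnn.
  move=> s3 K3 I3; have /= w0 := K3.1 0 isT; rewrite v0 in w0.
  apply: trip_seq; apply: trip_weaken.
    exact: (@cubes_spec B n inp a false 20 s3 B_ge inpE isT w0).
    exact: leqnn.
  move=> s4 K4 I4; have /= x0 := K4.1 0 isT; rewrite w0 in x0.
  apply: trip_weaken.
    exact: (@cubes_spec B n inp a true 21 s4 B_ge inpE isT x0).
    exact: leqnn.
  move=> s5 K5 I5; split=> //.
  - by rewrite (K5.1 0 isT).
  - by rewrite (K5.1 19 isT) (K4.1 19 isT).
  - by rewrite (K5.1 20 isT).
have NR : (q ^ L * q ^ L <= r ^ L)%N by rewrite -expnMn leq_expl.
have N0 : (0 < q ^ L)%N by rewrite expn_gt0 q0.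
have n1 : ((n + 1) ^ 2 <= 4 * r ^ L)%N.
  by apply: (@leq_trans ((2 * q ^ L) ^ 2)); [rewrite leq_exp2r //; lia|rewrite expnMn leq_mul2l /= -mulnn].
(* The logarithmic number of passes is paid by L + 1 <= 2^L, whence the base 2r. *)
have LR : (L.+1 * r ^ L <= (2 * r) ^ L)%N.
  by rewrite expnMn leq_mul2r ltn_expl // orbT.
have RR : (r ^ L <= (2 * r) ^ L)%N by apply: leq_trans LR; rewrite leq_pmull.
move: (r ^ L)%N (L.+1 * r ^ L)%N ((2 * r) ^ L)%N ((n + 1) ^ 2)%N NR n1 LR RR => R LR' X n' NR n1 LR RR.
have t1 : (r * (q * q) * R <= (q * q + 1) * (r + 1) * X)%N by apply: leq_mul => //; rewrite mulnC leq_mul // leq_addr.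
have -> : (2000 * (q * q + 1) * (r + 1) * LR' = 2000 * ((q * q + 1) * (r + 1) * LR'))%N by ring.
have -> : (10 * 1000 * (q * q + 1) * (r + 1) * X = 10 * (1000 * ((q * q + 1) * (r + 1) * X)))%N by ring.
have t2 : ((q * q + 1) * (r + 1) * LR' <= (q * q + 1) * (r + 1) * X)%N by rewrite leq_mul2l LR orbT.
have t3 : (X <= (q * q + 1) * (r + 1) * X)%N by rewrite leq_pmull // muln_gt0 !addn1.
move: ((q * q + 1) * (r + 1) * X)%N ((q * q + 1) * (r + 1) * LR')%N (r * (q * q) * R)%N t1 t2 t3 => a1 a2 a3 t1 t2 t3.
clear - t1 t2 t3 n1 RR; lia.
Qed.
End Programs.

(** * Exponents *)

Lemma entries_bounded (M : nat -> nat -> int) m p : exists2 mu,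
  (0 < mu)%N & forall k c, (k < m)%N -> (c < p)%N -> `|M k c| <= mu%:Z.
Proof.
exists (\sum_(k < m) \sum_(c < p) `|M k c|).+1%N => // k c km cp.
rewrite -abszE lez_nat (bigD1 (Ordinal km)) //= (bigD1 (Ordinal cp)) //=.
by rewrite -!addnA (leq_trans _ (leqnSn _)) // leq_addr.
Qed.

Lemma exp_up_log_le q n : (2 <= q)%N -> (q ^ up_log q n <= q * maxn n 1)%N.
Proof.
move=> q2; have q0 := ltnW q2; case: (leqP n 1) => n1.
  by have /eqP -> : up_log q n == 0%N; [rewrite up_log_eq0 n1 orbT|rewrite expn0 muln_gt0 q0].
have L0 : (0 < up_log q n)%N by rewrite up_log_gt0 n1 q2.
rewrite -(prednK L0) expnS leq_mul2l; apply/orP; right.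
by rewrite (leq_trans (ltnW (up_log_gtn q2 n1))) // leq_maxl.
Qed.

(** A constant to a logarithmic power is polynomial: lam <= q^lam gives lam^L <= (q^L)^lam, and q^L
    is at most q max(n, 1). This keeps the words of the tensor power within bounds. *)
Lemma exp_up_log_poly q lam n : (2 <= q)%N -> (lam * lam ^ up_log q n <= (n + 2) ^ (lam * (q + 2)))%N.
Proof.
move=> q2; have le2 k : (k <= (n + 2) ^ k)%N.
  by apply: leq_trans (ltnW (ltn_expl k (isT : 1 < 2)%N)) _; rewrite leq_expl // leq_addl.
rewrite (_ : lam * (q + 2) = lam + (q + 1) * lam)%N; last by lia.
rewrite expnD leq_mul // expnM.
apply: (@leq_trans ((q ^ up_log q n) ^ lam)).
  rewrite -!expnM mulnC expnM leq_expl //.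
  by apply: leq_trans (ltnW (ltn_expl lam (isT : 1 < 2)%N)) _; rewrite leq_expl.
apply: leq_expl; apply: leq_trans (exp_up_log_le n q2) _.
by rewrite addn1 expnSr leq_mul // geq_max !addn2 leqW.
Qed.

Section Counting.
Variables (R : realType) (T : digraph 4).
Hypothesis tT : tournament T.
Local Notation type := (type_of (arcs T) [set: 'I_4]).

Lemma sum_paths n (G : digraph n) : tournament G ->
  (\sum_(i < n) \sum_(j < n) paths n (adjacent G) i j * paths n (adjacent G) j i)%N
    = (4 * card_type (arcs G) (false, false))%N.
Proof.
move=> tG; rewrite -(card_type_closed4 (tour_arcs tG)).
transitivity (\sum_(x < n) \sum_(y < n) \sum_(z < n) \sum_(w < n) closed4 (arcs G) (x, y, z, w))%N.
  apply: eq_bigr => x _; rewrite [RHS]exchange_big; apply: eq_bigr => z _.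
  rewrite /paths big_distrl; apply: eq_bigr => y _; rewrite big_distrr; apply: eq_bigr => w _ /=.
  by rewrite !adjacentE mulnb andbA.
rewrite pair_big /= pair_big /= pair_big /=.
by apply: eq_big => [[[[x y] z] w]|[[[x y] z] w] _].
Qed.

Lemma count_upper (t t' : R) : matmul_in rat t -> t < t' -> solvable_in (@count_copies 4 T) t'.
Proof.
move=> mm tt'; have [q [r [D [U [V [W [q2 D0 qr id le]]]]]]] := matmul_trilinear mm tt'.
have t0 : 0 <= t' by have := matmul_in_ge2 mm; lra.
have [m1 m10 Um] := entries_bounded U r (q * q).
have [m2 m20 Vm] := entries_bounded V r (q * q).
have [m3 m30 Wm] := entries_bounded W (q * q) r.
pose mu := (m1 + m2 + m3)%N.
have mu0 : (0 < mu)%N by rewrite /mu; lia.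
have Umu k c : (k < r)%N -> (c < q * q)%N -> `|U k c| <= mu%:Z.
  by move=> h1 h2; apply: le_trans (Um _ _ h1 h2) _; rewrite /mu; lia.
have Vmu k c : (k < r)%N -> (c < q * q)%N -> `|V k c| <= mu%:Z.
  by move=> h1 h2; apply: le_trans (Vm _ _ h1 h2) _; rewrite /mu; lia.
have Wmu k c : (k < q * q)%N -> (c < r)%N -> `|W k c| <= mu%:Z.
  by move=> h1 h2; apply: le_trans (Wm _ _ h1 h2) _; rewrite /mu; lia.
(* Dominates every base whose L-th power bounds a word, and the constants of the program. *)
pose lam := (32 + D + mu + r + 16 * (r * (q * q)) + r * mu * (q * q * mu * (q * q * mu)))%N.
pose e := (lam * (q + 2) + 8)%N.
pose K := (10 * 1000 * (q * q + 1) * (r + 1))%N.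
apply: (@trip_solvable _ _ _ (measure_cmd q r D U V W ;; type_count_cmd type) e
   (fun n => K * (2 * r) ^ up_log q n + 100)%N).
- by rewrite /e; lia.
- apply/bigO_powerP; exists ((K + 101)%:R * q%:R `^ t'), 1%N => n n1.
  have q0R : 0 <= q%:R :> R by exact: ler0n.
  have r0 : (0 < r)%N by apply: leq_trans qr; rewrite muln_gt0 (ltnW q2).
  have X1 : (1 <= (2 * r) ^ up_log q n)%N by rewrite expn_gt0 muln_gt0 r0.
  apply: (@le_trans _ _ ((K + 101)%:R * ((2 * r) ^ up_log q n)%:R)).
    rewrite -natrM ler_nat mulnDl -addnS leq_add2l.
    by move: ((2 * r) ^ _)%N X1 => X; lia.
  rewrite -mulrA ler_wpM2l ?ler0n // natrX.
  (* With L = [up_log q n], (2r)^L <= (q^t')^L = (q^L)^t' <= (q n)^t'. *)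
  apply: (@le_trans _ _ ((q%:R `^ t') ^+ up_log q n)); first by rewrite lerXn2r ?nnegrE ?ler0n ?powR_ge0.
  rewrite -powR_mulrn ?powR_ge0 // -powRrM mulrC powRrM powR_mulrn // -natrX.
  rewrite -powRM ?ler0n // -natrM ge0_ler_powR ?nnegrE ?ler0n // ler_nat.
  by have := exp_up_log_le n q2; rewrite (maxn_idPl n1).
- move=> n G tG; set B := ((n + 2) ^ e)%N; pose L := up_log q n.
  have B_ge : (16 * (n + 2) ^ 4 <= B)%N.
    by apply: leq_trans (bound_ge n) _; rewrite /B /e leq_pexp2l ?addn2 // leq_addl.
  have lamB : (lam * lam ^ L <= B)%N.
    apply: leq_trans (exp_up_log_poly lam n q2) _.
    by rewrite /B /e leq_pexp2l ?addn2 // leq_addr.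
  have lam0 : (0 < lam)%N by rewrite /lam; lia.
  have lamL0 : (0 < lam ^ L)%N by rewrite expn_gt0 lam0.
  have lB : (lam <= B)%N by apply: leq_trans lamB; rewrite leq_pmulr.
  have lLB : (lam ^ L <= B)%N by apply: leq_trans lamB; rewrite leq_pmull.
  have rl : (r <= lam)%N by rewrite /lam; lia.
  have Dl : (D <= lam)%N by rewrite /lam; lia.
  have l32 : (32 <= lam)%N by rewrite /lam; lia.
  have HB1 : (16 * r ^ L + 16 <= B)%N.
    apply: (@leq_trans (32 * lam ^ L)); last by apply: leq_trans lamB; rewrite leq_mul2r l32 orbT.
    by have := leq_expl L rl; lia.
  have HB2 : (D ^ L <= B)%N by apply: leq_trans lLB; exact: leq_expl.
  have HBD : (D <= B)%N by exact: leq_trans lB.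
  have HB3 : (16 * (r * (q * q)) + 16 <= B)%N by apply: leq_trans lB; rewrite /lam; lia.
  have HBmu : (mu <= B)%N by apply: leq_trans lB; rewrite /lam; lia.
  have HB4 : ((r * mu) ^ L * ((q * q * mu) ^ L * (q * q * mu) ^ L) <= B)%N.
    by apply: leq_trans lLB; rewrite -!expnMn; apply: leq_expl; rewrite /lam leq_addl.
  have te := tour_arcs tG.
  have dE rev (v : 'I_n) : degree n (adjacent G) rev v =
      #|out (if rev then converse (arcs G) else arcs G) v|.
    by rewrite card_set_sum; apply: eq_bigr => u _; rewrite /rel_of; case: rev; rewrite !adjacentE.
  apply: trip_le.
    apply: trip_seq; apply: trip_weaken.
      exact: (measure_spec B_ge (inputE G) q2 D0 qr mu0 (erefl L) HB1 HB2 HBD HB3 HBmu HB4 Umu Vmu Wmu id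
        (erefl : var (initial_store n) 0 = n%:Z) erefl).
      exact: leqnn.
    move=> s1 _ [v0 v19 v20 v21]; rewrite count_copiesE //.
    apply: (@type_count_spec B n (input G) (card_type (arcs G)) type s1 B_ge v0).
    + by rewrite card_type_total card_ord.
    + by rewrite v19 sum_paths.
    + rewrite v20 card_type_source // big_distrr /=; congr Posz; apply: eq_bigr => v _.
      by rewrite dE.
    + rewrite v21 card_type_sink // big_distrr /=; congr Posz; apply: eq_bigr => v _.
      by rewrite dE.
  by rewrite /K.
Qed.
End Counting.

Theorem theorem1p4 (R : realType) :
  max_detect_exponent R 4 = (2%:R)%:E /\ (max_count_exponent R 4 <= omega R)%E.
Proof.
split.
  apply/eqP; rewrite eq_le; apply/andP; split.
    apply: bigmax_le => [|T tT]; first exact: leNye.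
    by apply: ereal_inf_lbound; exists 2 => //; exact: detect_upper.
  apply: (@le_trans _ _ (detect_exponent R dominated_digraph)).
    by apply: le_ereal_inf_tmp => _ [t /= st <-]; rewrite lee_fin; exact: detect_lower st.
  by apply: le_bigmax_cond; exact: tournament_dominated.
apply: bigmax_le => [|T tT]; first exact: leNye.
apply: le_ereal_inf_tmp => _ [t /= mt <-].
(* The slack [eps] is what allows q to be chosen large; passing to the infimum removes it. *)
apply/lee_addgt0Pr => eps eps0.
apply: ereal_inf_lbound; exists (t + eps) => //=.
by apply: (count_upper tT mt); rewrite ltrDl.
Qed.
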